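(* Let $N\ge1$, $\rho\in[0,1)$, $\alpha\in[0,1]$, $q\in(0,1)$, and let $(r_n)_{n\ge0}$ satisfy $0\le r_n<1$ and $\lim_{n\to\infty}n^\gamma r_n=c>0$ for some $\gamma\in(\tfrac12,1]$. Let $Z_n(i)\in[0,1]$ ($i=1,\dots,N$, $n\ge0$) evolve by $Z_{n+1}(i)=(1-r_n)Z_n(i)+r_n(\rho I_{n+1}(i)+(1-\rho)q)$, where, with $\mathcal F_n=\sigma(Z_k(i):\,1\le i\le N,\ 0\le k\le n)$ and $Z_n=\frac1N\sum_{i=1}^N Z_n(i)$, the $I_{n+1}(1),\dots,I_{n+1}(N)\in\{0,1\}$ are conditionally independent given $\mathcal F_n$ with $P(I_{n+1}(i)=1\mid\mathcal F_n)=(1-\alpha)Z_n(i)+\alpha Z_n$. Assume the law of $(Z_0(1),\dots,Z_0(N))$ is permutation invariant, $E[Z_0(i)]=\tfrac12$ and $E[Z_0(1-Z_0)]>0$. Fix $i\in\{1,\dots,N\}$ and set $\beta=1-\rho(1-\alpha)$. (i) If $\tfrac12<\gamma<1$, then \[\Big(n^{\gamma/2}e^{c\beta t}\big(Z_{\lfloor n+n^\gamma t\rfloor}(i)-Z_{\lfloor n+n^\gamma t\rfloor}\big)\Big)_{t\ge0}\xrightarrow{d}(W_{V_t})_{t\ge0},\quad V_t=\Big(1-\frac1N\Big)\frac{c\rho^2q(1-q)}{2\beta}e^{2c\beta t}.\] (ii) If $\gamma=1$ and $2c\beta>1$, then \[\Big(n^{1/2}(1+t)^{c\beta}\big(Z_{\lfloor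 n+nt\rfloor}(i)-Z_{\lfloor n+nt\rfloor}\big)\Big)_{t\ge0}\xrightarrow{d}(W_{V_t})_{t\ge0},\quad V_t=\Big(1-\frac1N\Big)\frac{c^2\rho^2q(1-q)}{2c\beta-1}(1+t)^{2c\beta-1}.\] Here $W$ is a standard Brownian motion and convergence in distribution is with respect to the Skorohod topology on $D[0,+\infty)$. *)

(* Defs.v *)
From HB Require Import structures.
From mathcomp Require Import all_boot all_order all_algebra.
From mathcomp Require Import all_classical all_reals all_analysis.
From mathcomp Require Import normal_distribution.
From mathcomp Require Import fingroup perm.

Set Implicit Arguments.
Unset Strict Implicit.
Unset Printing Implicit Defensive.

Import Order.TTheory GRing.Theory Num.Theory.
Import numFieldNormedType.Exports.

Local Open Scope classical_set_scope.
Local Open Scope ring_scope.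

(* The Skorohod space D[0,+oo) and the Skorohod (J1) metric                   *)
(* (Ethier--Kurtz, Markov Processes, Ch. 3, (5.2)).  Paths are functions      *)
(* R -> R of which only the restriction to [0,+oo) matters.                   *)

Section Skorohod.
Context {R : realType}.
Local Open Scope ereal_scope.

Definition cadlag (x : R -> R) : Prop :=
  (forall t : R, (0 <= t)%R -> x @ at_right t --> x t) /\
  (forall t : R, (0 < t)%R -> cvg (x @ at_left t)).

Definition time_change (l : R -> R) : Prop :=
  (forall s t : R, (0 <= s)%R -> (s < t)%R -> (l s < l t)%R) /\
  (forall t : R, (0 <= t)%R -> (0 <= l t)%R) /\
  (forall y : R, (0 <= y)%R -> exists2 t : R, (0 <= t)%R & l t = y).

Definition tc_gamma (l : R -> R) : \bar R :=
  ereal_sup [set (`| ln ((l st.1 - l st.2) / (st.1 - st.2)) |)%:E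
            | st in [set st : R * R | (0 <= st.2)%R /\ (st.2 < st.1)%R]].

Definition sk_du (x y l : R -> R) (u : R) : \bar R :=
  ereal_sup [set (Num.min 1 `| x (Num.min t u) - y (Num.min (l t) u) |)%:E
            | t in [set t : R | (0 <= t)%R]].

Definition sk_int (x y l : R -> R) : \bar R :=
  \int[lebesgue_measure]_(u in `[0%R, +oo[%classic)
     ((expR (- u))%:E * sk_du x y l u).

Definition skorohod_dist (x y : R -> R) : \bar R :=
  ereal_inf [set maxe (tc_gamma l) (sk_int x y l) | l in time_change].

Definition sk_bounded_continuous (f : (R -> R) -> R) : Prop :=
  (exists M : R, forall x, cadlag x -> (`| f x | <= M)%R) /\
  (forall x, cadlag x -> forall e : R, (0 < e)%R ->
     exists2 delta : R, (0 < delta)%R &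
       forall y, cadlag y -> skorohod_dist x y < delta%:E ->
                 (`| f x - f y | < e)%R).

Definition sk_conv_dist {d d'} {Omega : measurableType d}
    {Omega' : measurableType d'} (P : probability Omega R)
    (P' : probability Omega' R)
    (X : nat -> Omega -> (R -> R)) (Y : Omega' -> (R -> R)) : Prop :=
  forall f : (R -> R) -> R, sk_bounded_continuous f ->
    (fun n => \int[P]_w (f (X n w))%:E) @ \oo --> \int[P']_w (f (Y w))%:E.

End Skorohod.

Definition brownian_motion {R : realType} {d} {Omega : measurableType d}
    (P : probability Omega R) (W : R -> Omega -> R) : Prop :=
  (forall t, measurable_fun setT (W t)) /\
  (forall w, W 0 w = 0) /\
  (forall w, {within `[0, +oo[%classic, continuous (fun t => W t w)}) /\
  (forall (k : nat) (t : 'I_k.+1 -> R) (B : 'I_k -> set R),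
     (0 <= t ord0) ->
     (forall j : 'I_k, t (widen_ord (leqnSn k) j) < t (lift ord0 j)) ->
     (forall j, measurable (B j)) ->
     P [set w | forall j : 'I_k,
                  W (t (lift ord0 j)) w - W (t (widen_ord (leqnSn k) j)) w
                  \in B j]
     = (\prod_(j < k)
          normal_prob 0 (Num.sqrt (t (lift ord0 j) - t (widen_ord (leqnSn k) j)))
                      (B j))%E).

Section Model.
Context {R : realType} {d} {Omega : measurableType d}.
Variable N : nat.

Definition avg (Z : nat -> 'I_N -> Omega -> R) (n : nat) (w : Omega) : R :=
  N%:R^-1 * \sum_(i < N) Z n i w.

Definition gen_F (Z : nat -> 'I_N -> Omega -> R) (n : nat) : set (set Omega) :=
  [set A | exists k : nat, exists i : 'I_N, exists B : set R,
     (k <= n)%N /\ measurable B /\ A = Z k i @^-1` B].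

Definition filtration (Z : nat -> 'I_N -> Omega -> R) (n : nat)
  : set (set Omega) := <<s gen_F Z n >>.

Definition urn_model (P : probability Omega R) (r : nat -> R)
    (rho alpha q : R) (Z : nat -> 'I_N -> Omega -> R)
    (I : nat -> 'I_N -> Omega -> bool) : Prop :=
  (forall n i, measurable_fun setT (Z n i)) /\
  (forall n i, measurable [set w | I n i w]) /\
  (forall n i w, 0 <= Z n i w <= 1) /\
  (forall n i w, Z n.+1 i w =
      (1 - r n) * Z n i w + r n * (rho * (I n.+1 i w)%:R + (1 - rho) * q)) /\
  (* given F_n, I_{n+1}(1..N) are conditionally independent with
     P(I_{n+1}(i) = 1 | F_n) = (1 - alpha) Z_n(i) + alpha Z_n *)
  (forall n (A : set Omega), filtration Z n A ->
     forall e : 'I_N -> bool,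
       P (A `&` [set w | forall j, I n.+1 j w = e j]) =
       (\int[P]_(w in A)
          (\prod_(j < N)
             (let p := (1 - alpha) * Z n j w + alpha * avg Z n w in
              if e j then p else 1 - p))%:E)%E).

End Model.

(* Main.v *)
Require Import Defs.
From HB Require Import structures.
From mathcomp Require Import all_boot all_order all_algebra.
From mathcomp Require Import all_classical all_reals all_analysis.
From mathcomp Require Import normal_distribution.
From mathcomp Require Import fingroup perm.
From mathcomp Require Import measurable_realfun.
From mathcomp Require Import ring lra.
Set Implicit Arguments.
Unset Strict Implicit.
Unset Printing Implicit Defensive.
Import Order.TTheory GRing.Theory Num.Theory.
Import numFieldNormedType.Exports.
Local Open Scope classical_set_scope.
Local Open Scope ring_scope.

(** The deviation [D_n = Z_n(i) - Z_n] satisfies [D_(n+1) = (1 - beta r_n) D_n +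
    rho r_n xi_n], where [xi_n] is a bounded martingale difference whose conditional
    variance tends to [(1 - 1/N) q (1 - q)], because every [Z_n(j)] converges to [q] in
    [L^2].  With [a_n = prod_(k < n) (1 - beta r_k)], the quotient [D_n / a_n] is a
    martingale, and the rescaled deviation is [n^(gamma/2) a_n] times this martingale at
    time [floor (n + n^gamma t)], up to a factor that tends to 1 locally uniformly in
    [t]; its quadratic variation converges to the deterministic function [V_t].
    The increments over a time grid converge to those of [W_(V_t)] by replacing the
    martingale differences one at a time by Gaussian variables (Lindeberg); a maximal
    inequality for fourth moments controls the oscillations between grid points.
    A locally uniform distance between paths dominates the Skorohod metric, and a
    Skorohod-continuous bounded functional is an increasing limit of functionals that
    are Lipschitz for this distance, so that these suffice as test functionals. *)

(** * Expectation of bounded random variables *)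

Section Expectation.
Context {R : realType} {d : measure_display} {T : measurableType d}.
Variable P : probability T R.
Implicit Types f g : T -> R.

(** No conditional expectation is ever formed. Conditional means, variances and independence are
    stated weakly, as identities between expectations after multiplication by an arbitrary bounded
    [F_k]-measurable factor [U]. The model provides them on events of [F_k], [Ex_orth] extends them
    to bounded [U], and such a [U] carries the earlier grid increments through the replacement by
    Gaussians. All variables are bounded, so expectations are real numbers. The test functionals in
    [sk_conv_dist] come without measurability; that of [f] along the paths is obtained on the way,
    from functionals of finitely many coordinates. Both regimes are one statement with two
    parameters: [delta], the limit of [n^gamma ((n+1)^gamma / n^gamma - 1)], equal to 0 or 1, and a
    clock [Lam], the limit of the sum of [k^(-gamma)] over a block, equal to [t] or [ln (1 + t)].
    Then [V_t] is a constant times [expR (kappa Lam_t)] with [kappa = 2 c beta - delta]. The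
    martingale starts at step 0, and its history up to step [n] produces the initial value [V_0]. *)

Definition bounded_rv f : Prop :=
  measurable_fun setT f /\ exists M, forall w, `|f w| <= M.

Definition Ex f : R := Rintegral P setT f.

Lemma bounded_rv_integrable f : bounded_rv f -> P.-integrable setT (EFin \o f).
Proof.
move=> [mf [M fM]]; apply: measurable_bounded_integrable => //.
  by rewrite (le_lt_trans (probability_le1 P measurableT))// ltry.
exists M; split; first exact: num_real.
by move=> x Mx w _; rewrite /= (le_trans (fM w))// ltW.
Qed.

Lemma Ex_EFin f : bounded_rv f -> (\int[P]_w (f w)%:E)%E = (Ex f)%:E.
Proof.
move=> bf; rewrite /Ex /Rintegral fineK//.
exact: (integrable_fin_num measurableT (bounded_rv_integrable bf)).
Qed.

Lemma bounded_rv_cst (c : R) : bounded_rv (fun=> c).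
Proof. by split; [exact: measurable_cst | exists `|c|]. Qed.

Lemma bounded_rvD f g : bounded_rv f -> bounded_rv g ->
  bounded_rv (fun w => f w + g w).
Proof.
move=> [mf [M fM]] [mg [M' gM]]; split; first exact: measurable_funD.
by exists (M + M') => w; rewrite (le_trans (ler_normD _ _))// lerD.
Qed.

Lemma bounded_rvM f g : bounded_rv f -> bounded_rv g ->
  bounded_rv (fun w => f w * g w).
Proof.
move=> [mf [M fM]] [mg [M' gM]]; split; first exact: measurable_funM.
by exists (M * M') => w; rewrite normrM ler_pM.
Qed.

Lemma bounded_rvN f : bounded_rv f -> bounded_rv (fun w => - f w).
Proof.
move=> [mf [M fM]]; split; first exact: measurableT_comp.
by exists M => w; rewrite normrN.
Qed.

Lemma bounded_rvB f g : bounded_rv f -> bounded_rv g ->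
  bounded_rv (fun w => f w - g w).
Proof. by move=> bf bg; apply: bounded_rvD => //; exact: bounded_rvN. Qed.

Lemma bounded_rvX f n : bounded_rv f -> bounded_rv (fun w => f w ^+ n).
Proof.
move=> bf; elim: n => [|n IH].
  by under [X in bounded_rv X]funext do rewrite expr0; exact: bounded_rv_cst.
by under [X in bounded_rv X]funext do rewrite exprS; exact: bounded_rvM.
Qed.

Lemma bounded_rv_norm f : bounded_rv f -> bounded_rv (fun w => `|f w|).
Proof.
move=> [mf [M fM]]; split; first exact: measurableT_comp.
by exists M => w; rewrite normr_id.
Qed.

Lemma bounded_rvZ (c : R) f : bounded_rv f -> bounded_rv (fun w => c * f w).
Proof. by move=> bf; apply: bounded_rvM => //; exact: bounded_rv_cst. Qed.

Lemma bounded_rv_sum (J : Type) (s : seq J) (Q : pred J) (F : J -> T -> R) :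
  (forall j, bounded_rv (F j)) ->
  bounded_rv (fun w => \sum_(j <- s | Q j) F j w).
Proof.
move=> bF; elim: s => [|a s IH].
  by under [X in bounded_rv X]funext do rewrite big_nil; exact: bounded_rv_cst.
under [X in bounded_rv X]funext do rewrite big_cons.
by case: (Q a) => //; exact: bounded_rvD.
Qed.

Lemma bounded_rv_prod (J : Type) (s : seq J) (Q : pred J) (F : J -> T -> R) :
  (forall j, bounded_rv (F j)) ->
  bounded_rv (fun w => \prod_(j <- s | Q j) F j w).
Proof.
move=> bF; elim: s => [|a s IH].
  by under [X in bounded_rv X]funext do rewrite big_nil; exact: bounded_rv_cst.
under [X in bounded_rv X]funext do rewrite big_cons.
by case: (Q a) => //; exact: bounded_rvM.
Qed.

Lemma bounded_rv_indic (A : set T) : measurable A -> bounded_rv (\1_A : T -> R).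
Proof.
move=> mA; split; first exact: measurable_indic.
by exists 1 => w; rewrite indicE; case: (_ \in _); rewrite ?normr1 ?normr0.
Qed.

Lemma Ex_ext f g : f =1 g -> Ex f = Ex g.
Proof. by move=> /funext ->. Qed.

Lemma Ex_cst (c : R) : Ex (fun=> c) = c.
Proof.
rewrite /Ex Rintegral_cst//.
by rewrite -[X in c * X]/(fine (P setT)) probability_setT mulr1.
Qed.

Lemma ExD f g : bounded_rv f -> bounded_rv g ->
  Ex (fun w => f w + g w) = Ex f + Ex g.
Proof. by move=> bf bg; apply: RintegralD => //; exact: bounded_rv_integrable. Qed.

Lemma ExB f g : bounded_rv f -> bounded_rv g ->
  Ex (fun w => f w - g w) = Ex f - Ex g.
Proof. by move=> bf bg; apply: RintegralB => //; exact: bounded_rv_integrable. Qed.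

Lemma ExZ (c : R) f : bounded_rv f -> Ex (fun w => c * f w) = c * Ex f.
Proof. by move=> bf; apply: RintegralZl => //; exact: bounded_rv_integrable. Qed.

Lemma ExN f : bounded_rv f -> Ex (fun w => - f w) = - Ex f.
Proof.
by move=> bf; rewrite -mulN1r -ExZ//; apply: Ex_ext => w; rewrite mulN1r.
Qed.

Lemma Ex_sum (J : Type) (s : seq J) (Q : pred J) (F : J -> T -> R) :
  (forall j, bounded_rv (F j)) ->
  Ex (fun w => \sum_(j <- s | Q j) F j w) = \sum_(j <- s | Q j) Ex (F j).
Proof.
move=> bF; elim: s => [|a s IH].
  by rewrite big_nil -[RHS]Ex_cst; apply: Ex_ext => w; rewrite big_nil.
rewrite big_cons; under Ex_ext do rewrite big_cons.
by case: (Q a) => //; rewrite ExD ?IH//; exact: bounded_rv_sum.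
Qed.

Lemma le_Ex f g : bounded_rv f -> bounded_rv g -> (forall w, f w <= g w) ->
  Ex f <= Ex g.
Proof.
move=> bf bg fg; apply: le_Rintegral => //; exact: bounded_rv_integrable.
Qed.

Lemma Ex_ge0 f : (forall w, 0 <= f w) -> 0 <= Ex f.
Proof. by move=> f0; apply: Rintegral_ge0. Qed.

Lemma normr_Ex f : bounded_rv f -> `|Ex f| <= Ex (fun w => `|f w|).
Proof.
by move=> bf; apply: le_normr_Rintegral => //; exact: bounded_rv_integrable.
Qed.

Lemma normr_Ex_le f (M : R) : bounded_rv f -> (forall w, `|f w| <= M) ->
  `|Ex f| <= M.
Proof.
move=> bf fM; rewrite (le_trans (normr_Ex bf))// -[leRHS](Ex_cst M).
by apply: le_Ex => //; [exact: bounded_rv_norm | exact: bounded_rv_cst].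
Qed.

Lemma Ex_indic (A : set T) : measurable A -> Ex \1_A = fine (P A).
Proof. by move=> mA; rewrite /Ex /Rintegral integral_indic// setIT. Qed.

Lemma Ex_indicM (A : set T) f : measurable A -> bounded_rv f ->
  (\int[P]_(w in A) (f w)%:E)%E = (Ex (fun w => \1_A w * f w))%:E.
Proof.
move=> mA bf; rewrite -Ex_EFin; last first.
  by apply: bounded_rvM => //; exact: bounded_rv_indic.
rewrite integral_mkcond; apply: eq_integral => w _.
by rewrite patchE indicE; case: (_ \in _); rewrite ?mul1r ?mul0r.
Qed.

Lemma Ex_cvg (F : nat -> T -> R) f (M : R) :
  (forall n, measurable_fun setT (F n)) -> (forall n w, `|F n w| <= M) ->
  (forall w, F ^~ w @ \oo --> f w) ->
  Ex (F n) @[n --> \oo] --> Ex f.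
Proof.
move=> mF FM Ff.
have mf : measurable_fun setT f by apply: measurable_fun_cvg mF _ => x _; exact: Ff.
have fM w : `|f w| <= M.
  have /cvg_lim <-// : `|F n w| @[n --> \oo] --> `|f w| by apply: cvg_norm; exact: Ff.
  by apply: limr_le; [apply: is_cvg_norm; apply/cvg_ex; eexists; exact: Ff|
    apply: nearW => n].
have bf : bounded_rv f by split => //; exists M.
have bF n : bounded_rv (F n) by split => //; exists M.
have H : (\int[P]_w (F n w)%:E)%E @[n --> \oo] --> (\int[P]_w (f w)%:E)%E.
  apply: (@dominated_cvg _ _ _ P setT measurableT (fun n w => (F n w)%:E)
    (fun w => (f w)%:E) (cst M%:E)).
  - by move=> n; exact/measurable_EFinP.
  - by move=> w _; apply: cvg_EFin; [exact: nearW | exact: Ff].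
  - by [].
  - exact: (bounded_rv_integrable (bounded_rv_cst M)).
  - by move=> n w _; rewrite lee_fin.
rewrite Ex_EFin// in H; exact: fine_cvg H.
Qed.

End Expectation.

(** * Limits of real sequences *)

Section SequenceLimits.
Context {R : realType}.

Lemma cvg_seqP (u : nat -> R) (l : R) : u @ \oo --> l <->
  forall e : R, 0 < e -> exists n0, forall n, (n0 <= n)%N -> `|u n - l| <= e.
Proof.
split => [ul e e0|H].
  have /cvgrPdist_le/(_ _ e0)[n0 _ Hn0] := ul.
  by exists n0 => n n0n; rewrite distrC; exact: Hn0.
apply/cvgrPdist_le => e e0; have [n0 Hn0] := H _ e0.
by exists n0 => // n /= n0n; rewrite distrC; exact: Hn0.
Qed.

Lemma archimedean_inv (e : R) : 0 < e -> exists k : nat, k.+1%:R^-1 <= e.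
Proof.
move=> e0; have [k _ /(_ k (leqnn k))/= Hk] := near_infty_natSinv_lt (PosNum e0).
by exists k; exact: ltW.
Qed.

Lemma archimedean_bound (x : R) : exists k : nat, x <= k%:R.
Proof.
exists (Num.truncn `|x|).+1; rewrite (le_trans (ler_norm x))//.
by have /andP[_ /ltW] := truncn_itv (normr_ge0 x).
Qed.

Lemma archimedean_le0 (x C : R) : 0 <= C ->
  (forall n : nat, x <= n.+1%:R^-1 * C) -> x <= 0.
Proof.
move=> C0 H; rewrite leNgt; apply/negP => x0.
have C1 : 0 < C + 1 by rewrite ltr_wpDl.
have [k Hk] := archimedean_inv (divr_gt0 x0 C1).
have : x <= x / (C + 1) * C by rewrite (le_trans (H k))// ler_wpM2r.
rewrite -mulrA ler_pMr// mulrC ler_pdivlMr// mul1r gerDl.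
by rewrite leNgt ltr01.
Qed.

Lemma cvg_seq_dominated (u v : nat -> R) (l : R) :
  v @ \oo --> (0 : R) -> (forall n, `|u n - l| <= v n) -> u @ \oo --> l.
Proof.
move=> /cvg_seqP v0 uv; apply/cvg_seqP => e e0; have [n0 H] := v0 _ e0.
exists n0 => n n0n; apply: (le_trans (uv n)).
by have := H _ n0n; rewrite subr0; apply: le_trans; exact: ler_norm.
Qed.

Lemma cvg_seqD (u v : nat -> R) (a b : R) : u @ \oo --> a -> v @ \oo --> b ->
  (fun n => u n + v n) @ \oo --> a + b.
Proof. by move=> ua vb; exact: cvgD. Qed.

Lemma cvg_seqB (u v : nat -> R) (a b : R) : u @ \oo --> a -> v @ \oo --> b ->
  (fun n => u n - v n) @ \oo --> a - b.
Proof. by move=> ua vb; exact: cvgB. Qed.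

Lemma cvg_seqM (u v : nat -> R) (a b : R) : u @ \oo --> a -> v @ \oo --> b ->
  (fun n => u n * v n) @ \oo --> a * b.
Proof. by move=> ua vb; exact: cvgM. Qed.

Lemma cvg_sub0 (u v : nat -> R) (l : R) :
  (fun n => u n - v n) @ \oo --> (0 : R) -> v @ \oo --> l -> u @ \oo --> l.
Proof.
move=> uv vl; rewrite (_ : u = (fun n => (u n - v n) + v n)); last first.
  by apply/funext => n; rewrite subrK.
by rewrite -[X in _ --> X]add0r; apply: cvgD.
Qed.

Lemma cvg_seq_eq (u v : nat -> R) (l l' : R) :
  (forall n, u n = v n) -> l = l' -> v @ \oo --> l' -> u @ \oo --> l.
Proof. by move=> /funext -> ->. Qed.

End SequenceLimits.

(** * Lipschitz functions of finitely many coordinates *)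

Section LipschitzCoordinates.
Context {R : realType}.

(** Whole sequences stand in for vectors, so that the dimension is a mere number: the bound forces
    [G] to ignore all coordinates from [m] on, and freezing the last one lowers the dimension. *)
Definition lip_coords (m : nat) (L : R) (G : (nat -> R) -> R) : Prop :=
  0 <= L /\ forall x y, `|G x - G y| <= L * \sum_(j < m) `|x j - y j|.

Definition fix_coord (m : nat) (G : (nat -> R) -> R) (z : R) (x : nat -> R) : R :=
  G (fun j => if (j < m)%N then x j else z).

Lemma lip_fix_coord m L G z : lip_coords m.+1 L G ->
  lip_coords m L (fix_coord m G z).
Proof.
move=> [L0 lG]; split=> // x y; rewrite (le_trans (lG _ _))//.
rewrite big_ord_recr/= ltnn subrr normr0 addr0.
by rewrite le_eqVlt; apply/orP; left; apply/eqP; congr *%R;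
  apply: eq_bigr => j _; rewrite ltn_ord.
Qed.

Lemma lip_fix_coord_dist m L G z x : lip_coords m.+1 L G ->
  `|G x - fix_coord m G z x| <= L * `|x m - z|.
Proof.
move=> [L0 lG]; rewrite (le_trans (lG _ _))//.
rewrite big_ord_recr/= ltnn big1 ?add0r// => j _.
by rewrite ltn_ord subrr normr0.
Qed.

Lemma quantize_dist (k : nat) (x : R) :
  `|x - (Num.floor (k.+1%:R * x))%:~R / k.+1%:R| <= k.+1%:R^-1.
Proof.
have k0 : (0 : R) < k.+1%:R by rewrite ltr0n.
rewrite -[X in `|X - _|](mulfK (lt0r_neq0 k0)) -mulrBl normrM.
rewrite [X in _ * X]gtr0_norm ?invr_gt0// ler_piMl ?invr_ge0 ?(ltW k0)//.
rewrite [x * _]mulrC; have /andP[h1 h2] := floor_itv (k.+1%:R * x).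
rewrite ger0_norm ?subr_ge0// lerBlDl -[X in _ <= _ + X]/(1%:~R) -intrD.
by rewrite ltW// addrC.
Qed.

(** Induction on the dimension. With the last coordinate rounded to a multiple of [1 / (k + 1)], the
    function has one coordinate fewer on each of countably many level sets; the rounding changes it
    by at most [L / (k + 1)]. As [T] is arbitrary, this also serves for sub-sigma-algebras. *)
Lemma measurable_lip d (T : measurableType d) m L G (S : nat -> T -> R) :
  lip_coords m L G -> (forall j, (j < m)%N -> measurable_fun setT (S j)) ->
  measurable_fun setT (fun w => G (fun j => S j w)).
Proof.
elim: m G => [|m IH] G lG mS.
  have -> : (fun w => G (fun j => S j w)) = cst (G (fun=> 0)); last by [].
  apply/funext => w /=; apply/eqP; rewrite -subr_eq0 -normr_le0.
  by have [_ /(_ (fun j => S j w) (fun=> 0))] := lG; rewrite big_ord0 mulr0.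
pose qz k w := (Num.floor (k.+1%:R * S m w))%:~R / (k.+1%:R : R).
pose h k w := fix_coord m G (qz k w) (fun j => S j w).
apply: (@measurable_fun_cvg _ _ _ _ h) => [k|w _]; last first.
  apply: (@cvg_seq_dominated _ _ (fun n => L * n.+1%:R^-1)).
    by rewrite -[X in _ --> X](mulr0 L); apply: cvgMr; exact: cvg_harmonic.
  move=> n; rewrite distrC (le_trans (lip_fix_coord_dist _ _ lG))//.
  by rewrite ler_wpM2l//; [case: lG|exact: quantize_dist].
move=> _ Y mY; rewrite setTI.
have -> : h k @^-1` Y = \bigcup_(z : int)
   ([set w | Num.floor (k.+1%:R * S m w) = z] `&`
    ((fun w => fix_coord m G (z%:~R / k.+1%:R) (fun j => S j w)) @^-1` Y)).
  apply/seteqP; split => [w /= Yw|w [z _ [/= <-]]//].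
  by exists (Num.floor (k.+1%:R * S m w)).
apply: countable_bigcupT_measurable => [|z]; first exact: countableP.
apply: measurableI.
  have -> : [set w | Num.floor (k.+1%:R * S m w) = z] =
      (fun w => k.+1%:R * S m w) @^-1` `[z%:~R, (z + 1)%:~R[%classic.
    apply/seteqP; split => [w /= <-|w /=]; rewrite in_itv/= ?floor_itv//.
    by move=> ?; exact: floor_def.
  rewrite -[X in measurable X]setTI.
  suff mk : measurable_fun setT (fun w => k.+1%:R * S m w) by exact: mk.
  by apply: measurable_funM => //; exact: mS.
rewrite -[X in measurable X]setTI.
apply: (IH (fix_coord m G (z%:~R / k.+1%:R)) (lip_fix_coord _ lG)) => // j jm.
by apply: mS; rewrite ltnS ltnW.
Qed.

End LipschitzCoordinates.

(** * Orthogonality tested on events *)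

Section Orthogonality.
Context {R : realType} {d : measure_display} {T : measurableType d}.
Variable P : probability T R.

Lemma sum_lt_nat (K t : nat) : (t <= K)%N -> (\sum_(k < K) (k < t) = t)%N.
Proof.
move=> tK; rewrite -[RHS](minn_idPl tK); elim: K {tK} => [|K IH].
  by rewrite big_ord0 minn0.
rewrite big_ord_recr/= IH; case: (boolP (K < t)%N) => Kt.
  by rewrite (minn_idPr (ltnW Kt)) (minn_idPr Kt) addn1.
rewrite -leqNgt in Kt; by rewrite (minn_idPl Kt) (minn_idPl (leqW Kt)) addn0.
Qed.

(* [U] is uniformly approximated by sums of indicators of [{U >= c}]. *)
Lemma Ex_orth (U Y : T -> R) : bounded_rv U -> bounded_rv Y ->
  (forall B, measurable B -> Ex P (fun w => \1_(U @^-1` B) w * Y w) = 0) ->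
  Ex P (fun w => U w * Y w) = 0.
Proof.
move=> bU bY UY0.
have [mU [M UM]] := bU; have [mY [M' YM]] := bY.
have mUB B : measurable B -> measurable (U @^-1` B).
  by move=> mB; rewrite -[X in measurable X]setTI; exact: mU.
have EY0 : Ex P Y = 0.
  rewrite -(UY0 setT measurableT); apply: Ex_ext => w.
  by rewrite preimage_setT indicT mul1r.
have M0 : 0 <= `|M| by [].
have key n : `|Ex P (fun w => U w * Y w)| <= n.+1%:R^-1 * `|M'|.
  (* Enough thresholds to cover the range of [U], since [U + |M| <= 2 |M|]. Counting the thresholds
     passed rounds [U] down at mesh [1 / (n + 1)]. *)
  have [K MK] := archimedean_bound (n.+1%:R * (`|M| + `|M|)).
  pose B k := `[k.+1%:R / n.+1%:R - `|M|, +oo[%classic : set R.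
  pose Un w := n.+1%:R^-1 * (\sum_(k < K) \1_(U @^-1` B k) w) - `|M|.
  have bUn : bounded_rv Un.
    apply: bounded_rvB; last exact: bounded_rv_cst.
    apply: bounded_rvZ; apply: bounded_rv_sum => k; apply: bounded_rv_indic.
    by apply: mUB; exact: measurable_itv.
  have n0 : (0 : R) < n.+1%:R by rewrite ltr0n.
  have UnE w : Un w = (Num.truncn (n.+1%:R * (U w + `|M|)))%:R / n.+1%:R - `|M|.
    rewrite /Un mulrC; congr (_ / _ - _).
    have UMw : 0 <= U w + `|M|.
      rewrite -lerBlDr sub0r; have := UM w.
      by rewrite ler_norml => /andP[+ _]; apply: le_trans; rewrite lerN2 ler_norm.
    have UMw' : 0 <= n.+1%:R * (U w + `|M|) by rewrite mulr_ge0.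
    rewrite -[in RHS](sum_lt_nat (K := K) (t := Num.truncn (n.+1%:R * (U w + `|M|)))); last first.
      have /andP[+ _] := truncn_itv UMw'; move=> h.
      rewrite -(ler_nat R) (le_trans h)// (le_trans _ MK)// ler_wpM2l// lerD2r.
      by rewrite (le_trans (ler_norm _))// (le_trans (UM w))// ler_norm.
    rewrite natr_sum; apply: eq_bigr => k _.
    rewrite indicE truncn_ge_nat//; congr (_%:R); congr nat_of_bool.
    rewrite /B; apply/idP/idP => [/set_mem/=|H].
      by rewrite in_itv/= andbT lerBlDr ler_pdivrMr// mulrC.
    by apply/mem_set; rewrite /= in_itv/= andbT lerBlDr ler_pdivrMr// mulrC.
  have E0 : Ex P (fun w => Un w * Y w) = 0.
    transitivity (Ex P (fun w => n.+1%:R^-1 *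
        (\sum_(k < K) \1_(U @^-1` B k) w * Y w) - `|M| * Y w)).
      by apply: Ex_ext => w; rewrite /Un mulrBl -mulrA mulr_suml.
    have bk k : bounded_rv (fun w => \1_(U @^-1` B k) w * Y w : R).
      by apply: bounded_rvM => //; apply: bounded_rv_indic; apply: mUB; exact: measurable_itv.
    rewrite ExB; [|by apply: bounded_rvZ; exact: bounded_rv_sum |exact: bounded_rvZ].
    rewrite !ExZ// ?EY0 ?mulr0 ?subr0; last exact: bounded_rv_sum.
    rewrite Ex_sum// big1 ?mulr0// => k _.
    by rewrite UY0//; exact: measurable_itv.
  rewrite -[X in `|X|]subr0 -E0 -ExB; [|exact: bounded_rvM..].
  apply: normr_Ex_le.
    by apply: bounded_rvB; exact: bounded_rvM.
  move=> w; rewrite -mulrBl normrM ler_pM//; last first.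
    by rewrite (le_trans (YM w))// ler_norm.
  rewrite UnE opprB addrA.
  have UMw : 0 <= U w + `|M|.
    rewrite -lerBlDr sub0r; have := UM w.
    by rewrite ler_norml => /andP[+ _]; apply: le_trans; rewrite lerN2 ler_norm.
  have UMw' : 0 <= n.+1%:R * (U w + `|M|) by rewrite mulr_ge0.
  have /andP[h1 h2] := truncn_itv UMw'.
  rewrite ger0_norm; last by rewrite subr_ge0 ler_pdivrMr// [_ * n.+1%:R]mulrC.
  rewrite lerBlDr -[X in _ <= X + _]mul1r -mulrDl ler_pdivlMr// [_ * n.+1%:R]mulrC.
  by rewrite (le_trans (ltW h2))// -natr1 addrC.
apply/eqP; rewrite -normr_le0.
exact: (archimedean_le0 (normr_ge0 M')).
Qed.

End Orthogonality.

(** * Locally uniform distance between paths *)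

Section LocallyUniformDistance.
Context {R : realType}.
Implicit Types x y z : R -> R.

Lemma min1_triangle (a b c : R) : 0 <= a -> 0 <= b -> c <= a + b ->
  Num.min 1 c <= Num.min 1 a + Num.min 1 b.
Proof.
move=> a0 b0 cab; have h1 : Num.min 1 c <= 1 by rewrite ge_min lexx.
have h2 : Num.min 1 c <= c by rewrite ge_min lexx orbT.
by case: (leP 1 a) => ?; case: (leP 1 b) => ?; lra.
Qed.

(** The exponential weight and the cap at 1 let a single number metrize uniform convergence on
    compact sets; it makes sense for arbitrary functions, not only for cadlag ones. *)
Definition ldist x y : R :=
  sup [set expR (- t) * Num.min 1 `|x t - y t| | t in [set t : R | 0 <= t]].

Let ldist_set_le1 x y : ubound
  [set expR (- t) * Num.min 1 `|x t - y t| | t in [set t : R | 0 <= t]] 1.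
Proof.
move=> _ [t /= t0 <-]; apply: mulr_ile1; rewrite ?expR_ge0//.
by rewrite expRN invf_le1 ?expR_gt0// -[leLHS]expR0 ler_expR.
Qed.

Lemma ldist_ub x y t : 0 <= t ->
  expR (- t) * Num.min 1 `|x t - y t| <= ldist x y.
Proof.
by move=> t0; apply: ub_le_sup; [exists 1; exact: ldist_set_le1|exists t].
Qed.

Lemma ldist_le x y b :
  (forall t, 0 <= t -> expR (- t) * Num.min 1 `|x t - y t| <= b) ->
  ldist x y <= b.
Proof.
move=> H; apply: ge_sup; last by move=> _ [t t0 <-]; exact: H.
by exists (expR (- 0) * Num.min 1 `|x 0 - y 0|); exists 0 => //=.
Qed.

Lemma ldist_ge0 x y : 0 <= ldist x y.
Proof.
by rewrite (le_trans _ (@ldist_ub x y 0 _))// mulr_ge0 ?expR_ge0.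
Qed.

Lemma ldist_le1 x y : ldist x y <= 1.
Proof. by apply: ldist_le => t t0; apply: (@ldist_set_le1 x y); exists t. Qed.

Lemma ldistC x y : ldist x y = ldist y x.
Proof.
suff H a b : ldist a b <= ldist b a by apply/eqP; rewrite eq_le !H.
by apply: ldist_le => t t0; rewrite distrC; exact: ldist_ub.
Qed.

Lemma ldistxx x : ldist x x = 0.
Proof.
apply/eqP; rewrite eq_le ldist_ge0 andbT; apply: ldist_le => t t0.
by rewrite subrr normr0 min_r ?mulr0.
Qed.

Lemma ldist_triangle x y z : ldist x z <= ldist x y + ldist y z.
Proof.
apply: ldist_le => t t0.
rewrite (le_trans _ (lerD (ldist_ub x y t0) (ldist_ub y z t0)))//.
rewrite -mulrDr ler_wpM2l ?expR_ge0//.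
have : `|x t - z t| <= `|x t - y t| + `|y t - z t|.
  by rewrite (le_trans _ (ler_normD _ _))// addrA subrK.
by apply: min1_triangle.
Qed.

Lemma ldist_local x y T e : 0 <= e ->
  (forall t, 0 <= t -> t <= T -> `|x t - y t| <= e) ->
  ldist x y <= e + expR (- T).
Proof.
move=> e0 H; apply: ldist_le => t t0; have [tT|Tt] := leP t T.
  rewrite (@le_trans _ _ e)//; last by rewrite lerDl expR_ge0.
  rewrite -[leRHS]mul1r ler_pM ?expR_ge0 ?le_min ?normr_ge0 ?ler01//.
    by rewrite -[leRHS]expR0 ler_expR oppr_le0.
  by rewrite ge_min H ?orbT.
rewrite (@le_trans _ _ (expR (- t)))//.
  by rewrite ler_piMr ?expR_ge0// ge_min lexx.
by rewrite (@le_trans _ _ (expR (- T))) ?ler_expR ?lerN2 ?(ltW Tt)// lerDr.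
Qed.

Lemma ldist_lip x y C : 0 <= C ->
  (forall t, 0 <= t -> `|x t - y t| <= C) -> ldist x y <= C.
Proof.
move=> C0 H; apply: ldist_le => t t0.
rewrite -[leRHS]mul1r ler_pM ?expR_ge0 ?le_min ?normr_ge0 ?ler01//.
  by rewrite -[leRHS]expR0 ler_expR oppr_le0.
by rewrite ge_min H ?orbT.
Qed.

End LocallyUniformDistance.

(** * Comparison with the Skorohod metric *)

Section SkorohodLocallyUniform.
Context {R : realType}.
Implicit Types x y : R -> R.
Local Notation mu := (@lebesgue_measure R).

(** The integral of a nonnegative function is a supremum over simple functions below it, hence
    monotone without measurability. This spares a proof that [sk_du] is measurable in [u]. *)
Lemma ge0_le_integral_nomeas d (T : measurableType d)
    (m : {measure set T -> \bar R}) (D : set T) (f g : T -> \bar R) :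
  (forall u, D u -> (0 <= f u)%E) -> (forall u, D u -> (f u <= g u)%E) ->
  (\int[m]_(u in D) f u <= \int[m]_(u in D) g u)%E.
Proof.
move=> f0 fg; rewrite !(integral_mkcond D).
have f0' u : (0 <= (f \_ D) u)%E.
  by rewrite patchE; case: ifPn => // /set_mem/f0.
have fg' u : ((f \_ D) u <= (g \_ D) u)%E.
  by rewrite !patchE; case: ifPn => // /set_mem/fg.
rewrite !ge0_integralTE//; last by move=> u; exact: le_trans (f0' u) (fg' u).
apply: le_ereal_sup => _ [h /= hf <-]; exists h => // u.
exact: le_trans (hf u) (fg' u).
Qed.

Lemma integral_expR_half :
  (\int[mu]_(u in `[0%R, +oo[%classic) (expR (- (u / 2)))%:E <= 2%:E)%E.
Proof.
have h0 : 0 < (2^-1 : R) by rewrite invr_gt0.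
apply: (@le_trans _ _ (\int[mu]_u (2%:E * (exponential_pdf 2^-1 u)%:E))%E).
  rewrite integral_mkcond; apply: ge0_le_integral_nomeas => u _.
    by rewrite patchE; case: ifPn => // _; rewrite lee_fin expR_ge0.
  rewrite patchE; case: ifPn => [/set_mem/=|_].
    rewrite in_itv/= andbT => u0; rewrite exponential_pdfE//.
    rewrite -EFinM lee_fin mulrA divff// mul1r.
    by rewrite ler_expR mulNr mulrC.
  by rewrite mule_ge0// lee_fin exponential_pdf_ge0.
rewrite ge0_integralZl//; last 2 first.
- by apply/measurable_EFinP; exact: measurable_exponential_pdf.
- by move=> u _; rewrite lee_fin exponential_pdf_ge0.
by rewrite integral_exponential_pdf// mule1.
Qed.

Lemma expRN_le_inv (a : R) : 0 < a -> expR (- a) <= a^-1.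
Proof.
move=> a0; rewrite expRN lef_pV2 ?posrE ?expR_gt0//.
by rewrite (le_trans _ (expR_ge1Dx a))// lerDr.
Qed.

(** The identity serves as time change, so [tc_gamma] vanishes and only the integral must be small:
    up to [T] because the paths are close there, after [T] because of the exponential weight. *)
Lemma skorohod_dist_small (delta : R) : 0 < delta -> exists2 eta : R, 0 < eta &
  forall x y, ldist x y <= eta -> (skorohod_dist x y < delta%:E)%E.
Proof.
(* As [expR (- a) <= 1 / a], this makes [expR (- T / 2) <= delta / 8]. One half of the weight
   [expR (- u)] provides this smallness, the other half stays as a majorant with integral at most
   2. *)
move=> d0; pose T := 16 / delta.
have T0 : 0 < T by rewrite divr_gt0.
have eT : expR (- (T / 2)) <= delta / 8.
  rewrite (le_trans (expRN_le_inv _)) ?divr_gt0// /T.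
  rewrite le_eqVlt; apply/orP; left; apply/eqP.
  by field; rewrite ?gt_eqF//; lra.
exists (expR (- T) * (delta / 8)) => [|x y xy].
  by rewrite mulr_gt0 ?expR_gt0 ?divr_gt0.
have K0 : 0 <= delta / 8 by lra.
have near t : 0 <= t -> t <= T -> Num.min 1 `|x t - y t| <= delta / 8.
  move=> t0 tT; have := le_trans (ldist_ub x y t0) xy.
  have : expR (- T) * (delta / 8) <= expR (- t) * (delta / 8).
    by rewrite ler_wpM2r// ler_expR lerN2.
  move=> /[swap] /le_trans /[apply].
  by rewrite ler_pM2l ?expR_gt0.
have du u : 0 <= u -> (sk_du x y id u <= (if (u <= T)%R then delta / 8 else 1)%:E)%E.
  move=> u0; apply: ge_ereal_sup => _ [t /= t0 <-]; rewrite lee_fin.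
  case: ifPn => uT; last by rewrite ge_min lexx.
  by apply: near; [rewrite le_min t0 | rewrite ge_min uT orbT].
have du0 u : (0 <= sk_du x y id u)%E.
  apply: (@le_trans _ _ (Num.min 1 `|x (Num.min 0 u) - y (Num.min 0 u)|)%:E).
    by rewrite lee_fin le_min ler01 normr_ge0.
  by apply: ereal_sup_ubound; exists 0 => /=.
apply: (@le_lt_trans _ _ (maxe (tc_gamma id) (sk_int x y id))).
  apply: ereal_inf_lbound; exists id => //; split; first by [].
  by split => // t t0; exists t.
rewrite gt_max; apply/andP; split.
  apply: (@le_lt_trans _ _ 0%E); last by rewrite lte_fin.
  apply: ge_ereal_sup => _ [[s t] /= [t0 ts] <-].
  by rewrite divff ?subr_eq0 ?gt_eqF// ln1 normr0.
apply: (@le_lt_trans _ _ ((delta / 4)%:E * 2%:E)%E); last first.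
  by rewrite -EFinM lte_fin; lra.
rewrite (@le_trans _ _ (\int[mu]_(u in `[0%R, +oo[%classic)
   ((delta / 4)%:E * (expR (- (u / 2)))%:E))%E)//.
  apply: ge0_le_integral_nomeas => u /=; rewrite in_itv/= andbT => u0.
    by rewrite mule_ge0// lee_fin expR_ge0.
  rewrite (@le_trans _ _ ((expR (- u))%:E *
      (if (u <= T)%R then delta / 8 else 1)%:E)%E)//.
    by rewrite lee_wpmul2l ?lee_fin ?expR_ge0// du.
  rewrite -!EFinM lee_fin.
  have eu : expR (- u) = expR (- (u / 2)) * expR (- (u / 2)).
    by rewrite -expRD; congr expR; lra.
  have e1 : expR (- (u / 2)) <= 1 by rewrite -[leRHS]expR0 ler_expR; lra.
  have e0 := expR_gt0 (- (u / 2)).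
  rewrite eu; case: (leP u T) => uT.
    rewrite [leRHS]mulrC -mulrA ler_wpM2l ?(ltW e0)//.
    by rewrite (le_trans (ler_piMl K0 e1))//; lra.
  have : expR (- (u / 2)) <= delta / 8.
    by rewrite (le_trans _ eT)// ler_expR lerN2 ler_pM2r ?invr_gt0// ltW.
  by move=> h; rewrite mulr1 ler_wpM2r ?ltW//; lra.
rewrite ge0_integralZl//=; last 2 first.
- apply/measurable_EFinP/measurable_funTS; apply: measurableT_comp => //.
  by apply: measurableT_comp => //; exact: measurable_funM.
- by rewrite lee_fin; lra.
by rewrite lee_wpmul2l ?integral_expR_half// lee_fin; lra.
Qed.

End SkorohodLocallyUniform.

(** * Lipschitz lower envelopes *)

Section LowerEnvelope.
Context {R : realType}.
Implicit Types x y : R -> R.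

Lemma cadlag_cst (c : R) : cadlag (fun=> c).
Proof. by split => t _; [exact: cvg_cst | exact: is_cvg_cst]. Qed.

(** The inf-convolution of [f] with [k ldist] (Pasch-Hausdorff envelope). Only cadlag [y] compete,
    since [f] is controlled there alone; [x] is arbitrary, so the envelope is Lipschitz on all
    functions. *)
Definition lower_env (f : (R -> R) -> R) (k : nat) x : R :=
  inf [set f y + k%:R * ldist x y | y in cadlag].

Variables (f : (R -> R) -> R) (M : R).
Hypothesis fM : forall x, cadlag x -> `|f x| <= M.

Let lbd k x : lbound [set f y + k%:R * ldist x y | y in cadlag] (- M).
Proof.
move=> _ [y cy <-]; rewrite (@le_trans _ _ (f y))//.
  by have := fM cy; rewrite ler_norml => /andP[].
by rewrite lerDl mulr_ge0// ldist_ge0.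
Qed.

Let nonempty k x : [set f y + k%:R * ldist x y | y in cadlag] !=set0.
Proof. by exists (f (fun=> 0) + k%:R * ldist x (fun=> 0)); exists (fun=> 0) => //; exact: cadlag_cst. Qed.

Lemma lower_env_ub k x y : cadlag y ->
  lower_env f k x <= f y + k%:R * ldist x y.
Proof. by move=> cy; apply: ge_inf; [exists (- M); exact: lbd | exists y]. Qed.

Lemma lower_env_le k x : cadlag x -> lower_env f k x <= f x.
Proof. by move=> cx; have := lower_env_ub k x cx; rewrite ldistxx mulr0 addr0. Qed.

Lemma lower_env_ge k x : - M <= lower_env f k x.
Proof. by apply: lb_le_inf => //; exact: lbd. Qed.

Lemma lower_env_bounded k x : `|lower_env f k x| <= M + k%:R.
Proof.
have c0 := cadlag_cst 0.
have h : lower_env f k x <= M + k%:R.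
  rewrite (le_trans (lower_env_ub k x c0))// lerD//.
    by have := fM c0; rewrite ler_norml => /andP[].
  by rewrite ler_piMr// ldist_le1.
rewrite ler_norml h andbT (le_trans _ (lower_env_ge k x))//.
by rewrite lerN2 lerDl.
Qed.

Lemma lower_env_lip k x x' :
  `|lower_env f k x - lower_env f k x'| <= k%:R * ldist x x'.
Proof.
suff H a b : lower_env f k a - lower_env f k b <= k%:R * ldist a b.
  by rewrite ler_norml H andbT lerNl opprB ldistC H.
rewrite lerBlDr -lerBlDl; apply: lb_le_inf => // _ [y cy <-].
rewrite lerBlDl (le_trans (lower_env_ub k a cy))// addrCA lerD2l -mulrDr.
by rewrite ler_wpM2l// ldist_triangle.
Qed.

Lemma lower_env_cvg x : sk_bounded_continuous f -> cadlag x ->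
  (lower_env f k x) @[k --> \oo] --> f x.
Proof.
move=> [_ fc] cx; apply/cvg_seqP => e e0.
have [delta d0 fd] := fc _ cx _ e0.
have [eta n0 H] := skorohod_dist_small d0.
have M0 : 0 <= M := le_trans (normr_ge0 _) (fM cx).
(* From this [k] on, a competitor farther than [eta] pays at least [2 M], the largest possible gain;
   a nearer one is Skorohod-close to [x], where the continuity of [f] applies. *)
have [k0 Hk0] := archimedean_bound (2 * M / eta).
exists k0 => k k0k; rewrite distrC ger0_norm ?subr_ge0 ?lower_env_le//.
rewrite lerBlDl -lerBlDr; apply: lb_le_inf => // _ [y cy <-].
have [xy|xy] := leP (ldist x y) eta.
  have := fd _ cy (H _ _ xy).
  rewrite ltr_norml => /andP[h1 h2].
  by rewrite (@le_trans _ _ (f y))// ?lerDl ?mulr_ge0 ?ldist_ge0//; lra.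
have h : 2 * M <= k%:R * ldist x y.
  have : 2 * M / eta <= k%:R by rewrite (le_trans Hk0)// ler_nat.
  rewrite ler_pdivrMr// => /le_trans; apply.
  by rewrite ler_wpM2l// ltW.
have := fM cx; have := fM cy; rewrite !ler_norml => /andP[a1 a2] /andP[b1 b2].
by move: (k%:R * ldist x y) h => z; lra.
Qed.

End LowerEnvelope.

(** * Reduction to Lipschitz test functionals *)

Section ReductionToLipschitz.
Context {R : realType} {d d' : measure_display}.
Context {Omega : measurableType d} {Omega' : measurableType d'}.
Variables (P : probability Omega R) (P' : probability Omega' R).
Variables (X : nat -> Omega -> (R -> R)) (Y : Omega' -> (R -> R)).

(** The bounds are required on all functions, so that step approximations can be inserted without a
    proof that they are cadlag. *)
Definition bounded_lip (g : (R -> R) -> R) : Prop :=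
  (exists M : R, forall x, `|g x| <= M) /\
  (exists2 L : R, 0 <= L & forall x y, `|g x - g y| <= L * ldist x y).

Hypothesis cX : forall n w, cadlag (X n w).
Hypothesis cY : forall w, cadlag (Y w).
Hypothesis mX : forall g, bounded_lip g ->
  forall n, measurable_fun setT (fun w => g (X n w)).
Hypothesis mY : forall g, bounded_lip g -> measurable_fun setT (fun w => g (Y w)).
Hypothesis XY : forall g, bounded_lip g ->
  Ex P (fun w => g (X n w)) @[n --> \oo] --> Ex P' (fun w => g (Y w)).

Let lower_env_bounded_lip f (M : R) k : (forall x, cadlag x -> `|f x| <= M) ->
  bounded_lip (lower_env f k).
Proof.
move=> fM; split; first by exists (M + k%:R) => x; exact: lower_env_bounded.
by exists k%:R => // x y; exact: lower_env_lip fM _ _ _.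
Qed.

(** [f] is not assumed measurable; along [X n] it is a pointwise limit of envelopes, which are. *)
Let rvX f : sk_bounded_continuous f -> forall n, bounded_rv (fun w => f (X n w)).
Proof.
move=> cf n; have [[M fM] _] := cf; split; last by exists M => w; exact: fM.
apply: (@measurable_fun_cvg _ _ _ _ (fun k w => lower_env f k (X n w))) => [k|w _].
  exact: mX (lower_env_bounded_lip _ fM) _.
exact: lower_env_cvg fM _ _ _.
Qed.

Let rvY f : sk_bounded_continuous f -> bounded_rv (fun w => f (Y w)).
Proof.
move=> cf; have [[M fM] _] := cf; split; last by exists M => w; exact: fM.
apply: (@measurable_fun_cvg _ _ _ _ (fun k w => lower_env f k (Y w))) => [k|w _].
  exact: mY (lower_env_bounded_lip _ fM).
exact: lower_env_cvg fM _ _ _.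
Qed.

(** The envelope lies below [f] along [X n], and for large [k] its mean is close to that of [f]
    along [Y]. Applied to [- f] as well, this yields convergence. *)
Let half f : sk_bounded_continuous f -> forall e : R, 0 < e ->
  exists n0, forall n, (n0 <= n)%N ->
    Ex P' (fun w => f (Y w)) - e <= Ex P (fun w => f (X n w)).
Proof.
move=> cf e e0; have [[M fM] _] := cf.
have lb k : bounded_lip (lower_env f k) := lower_env_bounded_lip k fM.
have e20 : 0 < e / 2 by rewrite divr_gt0.
have cvgk : Ex P' (fun w => lower_env f k (Y w)) @[k --> \oo] -->
    Ex P' (fun w => f (Y w)).
  apply: (@Ex_cvg _ _ _ _ _ _ M) => [k|k w|w]; first exact: mY.
    rewrite ler_norml (lower_env_ge fM)/= (le_trans (lower_env_le fM k (cY w)))//.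
    by have := fM _ (cY w); rewrite ler_norml => /andP[].
  exact: lower_env_cvg fM _ _ _.
have /cvg_seqP/(_ _ e20)[k0 /(_ k0 (leqnn _)) Hk] := cvgk.
have /cvg_seqP/(_ _ e20)[n0 Hn] := XY (lb k0).
exists n0 => n n0n; have := Hn _ n0n.
have : Ex P (fun w => lower_env f k0 (X n w)) <= Ex P (fun w => f (X n w)).
  apply: le_Ex => [||w]; last exact: (lower_env_le fM).
  - by split; [exact: mX|have [[M' H] _] := lb k0; exists M' => w; exact: H].
  - exact: rvX.
move: Hk; rewrite !ler_norml; move: (Ex _ _) (Ex _ _) (Ex _ _) (Ex _ _).
by move=> a b c0 c1; lra.
Qed.

Let sk_bcN (f : (R -> R) -> R) : sk_bounded_continuous f -> sk_bounded_continuous (fun x => - f x).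
Proof.
move=> [[M fM] fc]; split; first by exists M => x cx; rewrite normrN; exact: fM.
move=> x cx e e0; have [delta d0 H] := fc _ cx _ e0.
by exists delta => // y cy xy; rewrite -opprD normrN; exact: H.
Qed.

Lemma sk_conv_dist_bounded_lip : sk_conv_dist P P' X Y.
Proof.
move=> f cf.
rewrite (_ : (fun n => _) = (fun n => (Ex P (fun w => f (X n w)))%:E)); last first.
  by apply/funext => n; rewrite Ex_EFin//; exact: rvX.
rewrite Ex_EFin; last exact: rvY.
apply: cvg_EFin; first exact: nearW.
apply/cvg_seqP => e e0.
have [n1 H1] := half cf e0; have [n2 H2] := half (sk_bcN cf) e0.
exists (maxn n1 n2) => n; rewrite geq_max => /andP[/H1 h1 /H2].
rewrite !ExN; [|exact: rvX|exact: rvY].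
by move: h1 => + h2; rewrite ler_norml /=; lra.
Qed.

End ReductionToLipschitz.

(** * Smooth test functions *)

Section SmoothFunctions.
Context {R : realType}.
Implicit Types (g : R -> R) (x h B C : R).

Definition lipf B g : Prop := forall x y, `|g x - g y| <= B * `|x - y|.

Lemma lipf_lip_coords B g : 0 <= B -> lipf B g ->
  lip_coords 1 B (fun s : nat -> R => g (s 0%N)).
Proof. by move=> B0 lg; split => // x y; rewrite big_ord1. Qed.

Lemma measurable_lipf B g d (T : measurableType d) (S : T -> R) :
  0 <= B -> lipf B g -> measurable_fun setT S ->
  measurable_fun setT (fun w => g (S w)).
Proof.
by move=> B0 /(lipf_lip_coords B0) lg mS; apply: (measurable_lip lg (S := fun=> S)).
Qed.

(* [g1] and [g2] play the part of the first two derivatives of [g]. *)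
Definition smooth3 B g g1 g2 : Prop :=
  [/\ 0 <= B,
      forall x, [/\ `|g x| <= B, `|g1 x| <= B & `|g2 x| <= B],
      [/\ lipf B g, lipf B g1 & lipf B g2] &
      forall x h, `|g (x + h) - g x - g1 x * h - g2 x * h ^+ 2 / 2|
                  <= B * `|h| ^+ 3].

(** Increments of length at most 1 are controlled by the expansion, longer ones by boundedness. *)
Lemma lipf_first_order B C g g1 : 0 <= C ->
  (forall x, `|g x| <= B) -> (forall x, `|g1 x| <= B) ->
  (forall x h, `|g (x + h) - g x - g1 x * h| <= C * h ^+ 2) ->
  lipf (2 * B + C) g.
Proof.
move=> C0 gB g1B H x y.
have B0 : 0 <= B := le_trans (normr_ge0 _) (gB 0).
have [xy1|xy1] := leP `|x - y| 1.
  have := H y (x - y); rewrite subrKC => Hy.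
  rewrite -[X in `|X|](subrK (g1 y * (x - y))).
  rewrite (le_trans (ler_normD _ _))// [2 * B + C]addrC mulrDl lerD//.
    rewrite (le_trans Hy)// ler_wpM2l// -real_normK ?num_real// expr2.
    by rewrite ler_piMl.
  rewrite normrM ler_wpM2r// (le_trans (g1B y))//; lra.
rewrite (@le_trans _ _ (2 * B))//.
  by rewrite (le_trans (ler_normB _ _))//; have := gB x; have := gB y; lra.
rewrite (@le_trans _ _ ((2 * B + C) * 1))//; first by lra.
by rewrite ler_wpM2l ?(ltW xy1)//; lra.
Qed.

(** Cut [[x, y]] into [n + 1] equal steps: the losses [C h^2] add up to [C (y - x)^2 / (n + 1)].
    This replaces the mean value theorem, as [g1] is known only through the expansion. *)
Lemma nondecreasing_first_order C g g1 :
  (forall x, 0 <= g1 x) ->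
  (forall x h, `|g (x + h) - g x - g1 x * h| <= C * h ^+ 2) ->
  forall x y, x <= y -> g x <= g y.
Proof.
move=> g10 H x y xy.
have C0 : 0 <= C by have := le_trans (normr_ge0 _) (H 0 1); rewrite expr1n mulr1.
have step h : 0 <= h -> forall k, g x - k%:R * (C * h ^+ 2) <= g (x + k%:R * h).
  move=> h0; elim => [|k IH]; first by rewrite !mul0r addr0 subr0.
  have := H (x + k%:R * h) h; rewrite ler_norml => /andP[h1 _].
  have h2 : 0 <= g1 (x + k%:R * h) * h by rewrite mulr_ge0.
  rewrite -natr1 mulrDl mul1r [in leRHS]mulrDl mul1r addrA.
  by move: (C * h ^+ 2) h1 h2 IH => u; lra.
rewrite -subr_le0; apply: (@archimedean_le0 _ _ (C * (y - x) ^+ 2)).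
  by rewrite mulr_ge0// sqr_ge0.
move=> n; have n0 : n.+1%:R != 0 :> R by rewrite pnatr_eq0.
have := @step ((y - x) / n.+1%:R) _ n.+1.
rewrite divr_ge0 ?subr_ge0// => /(_ isT).
rewrite (_ : x + n.+1%:R * ((y - x) / n.+1%:R) = y); last by field.
move=> h.
rewrite lerBlDr -lerBlDl (le_trans _ h)// lerD2l lerN2.
by rewrite le_eqVlt; apply/orP; left; apply/eqP; field.
Qed.

Definition pos_part x : R := Num.max 0 x.

(** The remainder is exactly [h^3] while both points stay nonnegative; a crossing of 0 only makes it
    smaller. *)
Lemma pos_part_cube x h :
  `|pos_part (x + h) ^+ 3 - pos_part x ^+ 3 - 3 * pos_part x ^+ 2 * h
    - 3 * pos_part x * h ^+ 2| <= `|h| ^+ 3.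
Proof.
rewrite /pos_part; case: (leP 0 x) => x0; case: (leP 0 (x + h)) => xh.
- by rewrite -normrX le_eqVlt; apply/orP; left; apply/eqP; congr `|_|; ring.
- rewrite (_ : _ - _ = - ((- h) ^+ 3 - (- (x + h)) ^+ 3)); last by ring.
  have hE : `|h| = - h by rewrite ler0_norm//; lra.
  rewrite normrN hE ger0_norm ?gerBl ?exprn_ge0//; first by lra.
  by rewrite subr_ge0 lerXn2r ?nnegrE//; lra.
- rewrite ger0_norm; last first.
    by rewrite !expr0n/= !mulr0 !mul0r !subr0 exprn_ge0.
  by rewrite !expr0n/= !mulr0 !mul0r !subr0 ger0_norm ?lerXn2r ?nnegrE//; lra.
- by rewrite !expr0n/= !mulr0 !mul0r !subr0 normr0 exprn_ge0.
Qed.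

Lemma pos_part_sqr x h :
  `|pos_part (x + h) ^+ 2 - pos_part x ^+ 2 - 2 * pos_part x * h| <= h ^+ 2.
Proof.
rewrite /pos_part; case: (leP 0 x) => x0; case: (leP 0 (x + h)) => xh.
- by rewrite ler_norml; apply/andP; split; nra.
- by rewrite ler_norml; apply/andP; split; nra.
- by rewrite ler_norml; apply/andP; split; nra.
- by rewrite !expr0n/= !mulr0 !mul0r !subr0 normr0 sqr_ge0.
Qed.

Lemma pos_part_lip : lipf 1 pos_part.
Proof.
move=> x y; rewrite mul1r /pos_part.
case: (leP 0 x) => x0; case: (leP 0 y) => y0 //.
- by rewrite subr0 !ger0_norm; lra.
- by rewrite sub0r normrN distrC !ger0_norm; lra.
- by rewrite subrr normr0.
Qed.

(* The cubic spline rising from 0 to 1 on [0, 3]: third finite difference of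
   the truncated cube. *)
Definition sstep x : R :=
  (pos_part x ^+ 3 - 3 * pos_part (x - 1) ^+ 3 + 3 * pos_part (x - 2) ^+ 3
   - pos_part (x - 3) ^+ 3) / 6.
Definition sstep1 x : R :=
  (pos_part x ^+ 2 - 3 * pos_part (x - 1) ^+ 2 + 3 * pos_part (x - 2) ^+ 2
   - pos_part (x - 3) ^+ 2) / 2.
Definition sstep2 x : R :=
  pos_part x - 3 * pos_part (x - 1) + 3 * pos_part (x - 2) - pos_part (x - 3).

(** The coefficients of the four truncated cubes give [(1 + 3 + 3 + 1) / 6 <= 2], and [8 / 2 = 4]
    for the squares in [sstep1_taylor2]. *)
Lemma sstep_taylor3 x h :
  `|sstep (x + h) - sstep x - sstep1 x * h - sstep2 x * h ^+ 2 / 2| <= 2 * `|h| ^+ 3.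
Proof.
rewrite /sstep /sstep1 /sstep2 ![x + h - _]addrAC.
have := pos_part_cube x h; have := pos_part_cube (x - 1) h.
have := pos_part_cube (x - 2) h; have := pos_part_cube (x - 3) h.
move: (pos_part (x + h)) (pos_part (x - 1 + h)) (pos_part (x - 2 + h))
  (pos_part (x - 3 + h)) (pos_part x) (pos_part (x - 1)) (pos_part (x - 2))
  (pos_part (x - 3)) (`|h| ^+ 3) => a b c e a' b' c' e' u.
rewrite !ler_norml => /andP[h1 h2] /andP[h3 h4] /andP[h5 h6] /andP[h7 h8].
by apply/andP; split; lra.
Qed.

Lemma sstep1_taylor2 x h :
  `|sstep1 (x + h) - sstep1 x - sstep2 x * h| <= 4 * h ^+ 2.
Proof.
rewrite /sstep1 /sstep2 ![x + h - _]addrAC.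
have := pos_part_sqr x h; have := pos_part_sqr (x - 1) h.
have := pos_part_sqr (x - 2) h; have := pos_part_sqr (x - 3) h.
move: (pos_part (x + h)) (pos_part (x - 1 + h)) (pos_part (x - 2 + h))
  (pos_part (x - 3 + h)) (pos_part x) (pos_part (x - 1)) (pos_part (x - 2))
  (pos_part (x - 3)) => a b c e a' b' c' e'.
move: (h ^+ 2) => u.
rewrite !ler_norml => /andP[h1 h2] /andP[h3 h4] /andP[h5 h6] /andP[h7 h8].
by apply/andP; split; lra.
Qed.

Lemma sstep_eq0 x : x <= 0 -> sstep x = 0.
Proof.
by move=> x0; rewrite /sstep /pos_part !max_l; [rewrite !expr0n/=; lra|lra..].
Qed.

Lemma sstep_eq1 x : 3 <= x -> sstep x = 1.
Proof.
by move=> x3; rewrite /sstep /pos_part !max_r; [field|lra..].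
Qed.

Lemma sstep2_bound x : `|sstep2 x| <= 1.
Proof.
rewrite /sstep2 /pos_part ler_norml.
by case: (leP 0 x); case: (leP 0 (x - 1)); case: (leP 0 (x - 2));
  case: (leP 0 (x - 3)) => *; lra.
Qed.

Lemma sstep1_ge0 x : 0 <= sstep1 x.
Proof.
rewrite /sstep1 /pos_part.
by case: (leP 0 x); case: (leP 0 (x - 1)); case: (leP 0 (x - 2));
  case: (leP 0 (x - 3)) => *; nra.
Qed.

Lemma sstep1_bound x : `|sstep1 x| <= 1.
Proof.
rewrite ger0_norm ?sstep1_ge0// /sstep1 /pos_part.
by case: (leP 0 x); case: (leP 0 (x - 1)); case: (leP 0 (x - 2));
  case: (leP 0 (x - 3)) => *; nra.
Qed.

Lemma sstep_bound x : `|sstep x| <= 1.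
Proof.
have cube (y : R) : 0 <= y -> y <= 1 -> 0 <= y ^+ 3 <= y ^+ 2.
  by move=> y0 y1; rewrite exprn_ge0//= exprS ler_piMl// sqr_ge0.
have [x0|x0] := leP x 0; first by rewrite sstep_eq0// normr0.
have [x3|x3] := leP 3 x; first by rewrite sstep_eq1// normr1.
rewrite /sstep /pos_part ler_norml (@max_r _ _ _ x) ?(ltW x0)//.
rewrite (@max_l _ _ _ (x - 3)); last lra.
have [x1|x1] := leP x 1.
  rewrite !max_l; [|lra..]; have /andP[? ?] := cube x (ltW x0) x1.
  by rewrite expr0n/=; apply/andP; split; nra.
rewrite (@max_r _ _ _ (x - 1)); last lra.
have [x2|x2] := leP x 2.
  rewrite !max_l; [|lra..]; rewrite -[x in x ^+ 3](subrK 1).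
  have y0 : 0 <= x - 1 by lra. have y1 : x - 1 <= 1 by lra.
  have := cube _ y0 y1; move: (x - 1) y0 y1 => y y0 y1 /andP[? ?].
  by rewrite expr0n/=; apply/andP; split; nra.
rewrite max_r; last lra.
have y0 : 0 <= 3 - x by lra. have y1 : 3 - x <= 1 by lra.
have /andP[? ?] := cube _ y0 y1; rewrite (_ : _ - _ = 6 - (3 - x) ^+ 3); last ring.
have ? : (3 - x) ^+ 3 <= 1 by rewrite exprn_ile1.
by apply/andP; split; lra.
Qed.

Lemma sstep_taylor2 x h : `|sstep (x + h) - sstep x - sstep1 x * h| <= 3 * h ^+ 2.
Proof.
have [h1|h1] := leP `|h| 1.
  rewrite -[X in `|X|](subrK (sstep2 x * h ^+ 2 / 2)).
  rewrite (le_trans (ler_normD _ _))//.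
  have t3 := sstep_taylor3 x h; have b2 := sstep2_bound x.
  have e3 : `|h| ^+ 3 <= h ^+ 2.
    by rewrite exprS -(real_normK (num_real h)) ler_piMl// sqr_ge0.
  have : `|sstep2 x * h ^+ 2 / 2| <= h ^+ 2.
    move: b2 (sqr_ge0 h); move: (h ^+ 2) (sstep2 x) => v u.
    by rewrite !ler_norml => /andP[? ?] v0; apply/andP; split; nra.
  by move: t3 e3; lra.
have H : forall u, `|sstep u| <= 1; last first.
  have h2 : `|h| <= h ^+ 2.
    by rewrite -(real_normK (num_real h)) expr2 ler_peMl// ltW.
  rewrite (le_trans (ler_normB _ _))// normrM.
  rewrite (le_trans (lerD (ler_normB _ _) (lexx _)))//.
  have := sstep1_bound x; have := H x; have := H (x + h).
  by move: `|sstep1 x| (normr_ge0 (sstep1 x)) => u u0; nra.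
exact: sstep_bound.
Qed.

Lemma sstep_le x y : x <= y -> sstep x <= sstep y.
Proof. exact: nondecreasing_first_order sstep1_ge0 sstep_taylor2 _ _. Qed.

Lemma sstep_ge0 x : 0 <= sstep x.
Proof.
have [x0|x0] := leP x 0; first by rewrite sstep_eq0.
by rewrite -(@sstep_eq0 0)// sstep_le// ltW.
Qed.

Lemma sstep_le1 x : sstep x <= 1.
Proof.
have [x3|x3] := leP 3 x; first by rewrite sstep_eq1.
by rewrite -(@sstep_eq1 3)// sstep_le// ltW.
Qed.

Lemma sstep_smooth : smooth3 10 sstep sstep1 sstep2.
Proof.
have b x : [/\ `|sstep x| <= 1, `|sstep1 x| <= 1 & `|sstep2 x| <= 1].
  by split; [rewrite ger0_norm ?sstep_ge0 ?sstep_le1| exact: sstep1_bound|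
     exact: sstep2_bound].
have l C g : C <= 10 -> lipf C g -> lipf 10 g.
  by move=> C10 lg x y; rewrite (le_trans (lg x y))// ler_wpM2r.
split => //.
- by move=> x; have [? ? ?] := b x; split; lra.
- split.
  + apply: (l (2 * 1 + 3)); first lra.
    by apply: lipf_first_order sstep_taylor2 => // x; have [] := b x.
  + apply: (l (2 * 1 + 4)); first lra.
    by apply: lipf_first_order sstep1_taylor2 => // x; have [] := b x.
  + apply: (l (2 * 1 + 6)) => [|x y]; first lra.
    have := pos_part_lip x y; have := pos_part_lip (x - 1) (y - 1).
    have := pos_part_lip (x - 2) (y - 2); have := pos_part_lip (x - 3) (y - 3).
    have e (u v w : R) : (u - w) - (v - w) = u - v by ring.
    rewrite !e /sstep2 !mul1r.
    move: (pos_part x) (pos_part (x - 1)) (pos_part (x - 2)) (pos_part (x - 3)).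
    move: (pos_part y) (pos_part (y - 1)) (pos_part (y - 2)) (pos_part (y - 3)).
    move: `|x - y| => u a0 a1 a2 a3 b0 b1 b2 b3.
    rewrite !ler_norml => /andP[? ?] /andP[? ?] /andP[? ?] /andP[? ?].
    by apply/andP; split; lra.
- move=> x h; rewrite (le_trans (sstep_taylor3 x h))// ler_wpM2r ?exprn_ge0//.
  by lra.
Qed.

Lemma smooth3_affine B g g1 g2 (k a : R) : 0 <= k -> smooth3 B g g1 g2 ->
  exists B', smooth3 B' (fun y => g (k * (y - a))) (fun y => k * g1 (k * (y - a)))
    (fun y => k ^+ 2 * g2 (k * (y - a))).
Proof.
move=> k0 [B0 bg [lg lg1 lg2] tg]; exists (B * (1 + k) ^+ 3).
have k1 : 1 <= (1 + k) ^+ 3 by rewrite exprn_ege1// lerDl.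
have kk : k <= (1 + k) ^+ 3 by nra.
have kk2 : k ^+ 2 <= (1 + k) ^+ 3 by nra.
have kk3 : k ^+ 3 <= (1 + k) ^+ 3 by rewrite lerXn2r ?nnegrE//; lra.
have B1 : 0 <= B * (1 + k) ^+ 3 by rewrite mulr_ge0// exprn_ge0//; lra.
have e (u v : R) : k * (u - a) - k * (v - a) = k * (u - v) by ring.
have nM (u v : R) : 0 <= u -> `|u * v| = u * `|v|.
  by move=> u0; rewrite normrM ger0_norm.
have k20 : 0 <= k ^+ 2 by rewrite exprn_ge0.
split => //.
- move=> x; have [h h1 h2] := bg (k * (x - a)); rewrite (nM k)// (nM (k ^+ 2))//.
  split; first by rewrite (le_trans h)// ler_peMr.
  + by rewrite mulrC ler_pM.
  + by rewrite mulrC ler_pM.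
- split => x y.
  + rewrite (le_trans (lg _ _))// e nM// mulrA.
    by rewrite ler_wpM2r// ler_wpM2l.
  + rewrite -mulrBr nM// (le_trans (ler_wpM2l k0 (lg1 _ _)))// e nM//.
    rewrite (_ : k * (B * (k * `|x - y|)) = B * k ^+ 2 * `|x - y|); last ring.
    by rewrite ler_wpM2r// ler_wpM2l.
  + rewrite -mulrBr nM// (le_trans (ler_wpM2l k20 (lg2 _ _)))// e nM//.
    rewrite (_ : k ^+ 2 * (B * (k * `|x - y|)) = B * k ^+ 3 * `|x - y|); last ring.
    by rewrite ler_wpM2r// ler_wpM2l.
- move=> x h; have := tg (k * (x - a)) (k * h).
  rewrite nM// [(k * `|h|) ^+ 3]exprMn.
  rewrite (_ : k * (x - a) + k * h = k * (x + h - a)); last ring.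
  set U := g _; set V := g _; set U1 := g1 _; set U2 := g2 _.
  rewrite (_ : U - V - U1 * (k * h) - U2 * (k * h) ^+ 2 / 2 =
    U - V - k * U1 * h - k ^+ 2 * U2 * h ^+ 2 / 2); last ring.
  move=> /le_trans; apply.
  by rewrite mulrA ler_wpM2r ?exprn_ge0// ler_wpM2l.
Qed.

Lemma sstep_affine_smooth (a e : R) : 0 < e -> exists B g1 g2,
  smooth3 B (fun y => sstep ((y - a) / e)) g1 g2.
Proof.
move=> e0; have e1 : 0 <= e^-1 by rewrite invr_ge0 ltW.
have [B H] := smooth3_affine a e1 sstep_smooth.
exists B; do 2 eexists.
by under [X in smooth3 _ X]funext do rewrite mulrC; exact: H.
Qed.

End SmoothFunctions.

(** * Convergence of finite-dimensional laws *)

Lemma cvg_seq_sum (R : realType) (J : Type) (s : seq J) (u : nat -> J -> R) (l : J -> R) :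
  (forall j, u ^~ j @ \oo --> l j) ->
  (fun n => \sum_(j <- s) u n j) @ \oo --> \sum_(j <- s) l j.
Proof.
move=> ul; elim: s => [|a s IH].
  by rewrite big_nil; under eq_fun do rewrite big_nil; exact: cvg_cst.
rewrite big_cons; under eq_fun do rewrite big_cons; exact: cvg_seqD.
Qed.

Section FiniteDimensional.
Context {R : realType} {d d' : measure_display}.
Context {Omega : measurableType d} {Omega' : measurableType d'}.
Variables (P : probability Omega R) (P' : probability Omega' R).
Implicit Types (M L a h e : R) (G : (nat -> R) -> R).
Variables (S : nat -> nat -> Omega -> R) (S' : nat -> Omega' -> R).

Hypothesis mS : forall n j, measurable_fun setT (S n j).
Hypothesis mS' : forall j, measurable_fun setT (S' j).

(** The only functions in which a new coordinate is tested: smooth enough for the Lindeberg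
    replacement, while their differences at neighbouring nodes form partitions of unity. *)
Definition ramp (a h y : R) : R := sstep ((y - a) / h).

Hypothesis cvgS : forall j G M L a h, (forall x, `|G x| <= M) ->
  lip_coords j L G -> 0 < h ->
  (fun n => Ex P (fun w => G (S n ^~ w) * ramp a h (S n j w)) -
    Ex P (fun w => G (S n ^~ w)) * Ex P' (fun w => ramp a h (S' j w)))
  @ \oo --> (0 : R).
Hypothesis indepS' : forall j G M L a h, (forall x, `|G x| <= M) ->
  lip_coords j L G -> 0 < h ->
  Ex P' (fun w => G (S' ^~ w) * ramp a h (S' j w)) =
  Ex P' (fun w => G (S' ^~ w)) * Ex P' (fun w => ramp a h (S' j w)).

Lemma ramp_bound a h y : `|ramp a h y| <= 1.
Proof. exact: sstep_bound. Qed.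

Lemma bounded_rv_ramp d0 (T : measurableType d0) a h (U : T -> R) : 0 < h ->
  measurable_fun setT U -> bounded_rv (fun w => ramp a h (U w)).
Proof.
move=> h0 mU; split; last by exists 1 => w; exact: ramp_bound.
have [B [g1 [g2 [B0 _ [lg _ _] _]]]] := sstep_affine_smooth a h0.
exact: measurable_lipf B0 lg mU.
Qed.

Lemma bounded_rv_lip d0 (T : measurableType d0) m L M G (U : nat -> T -> R) :
  (forall x, `|G x| <= M) -> lip_coords m L G ->
  (forall j, measurable_fun setT (U j)) ->
  bounded_rv (fun w => G (U ^~ w)).
Proof.
move=> GM lG mU; split; last by exists M => w; exact: GM.
by apply: (measurable_lip lG) => j _; exact: mU.
Qed.

(** Bumps on a mesh of width [h]; they telescope to [tot], a plateau of height 1 over a range that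
    grows with [K]. *)
Let node (h : R) (K k : nat) : R := (k%:R - K%:R) * h.
Let bump h K k y : R := ramp (node h K k) h y - ramp (node h K k.+1) h y.
Let tot h K y : R := ramp (node h K 0) h y - ramp (node h K (K + K)) h y.

Let sum_bump h K y : \sum_(k < K + K) bump h K k y = tot h K y.
Proof.
rewrite -(big_mkord xpredT (fun k => bump h K k y)).
have H m : \sum_(0 <= k < m) bump h K k y =
    ramp (node h K 0) h y - ramp (node h K m) h y.
  elim: m => [|m IH]; first by rewrite big_geq// subrr.
  by rewrite big_nat_recr//= IH /bump addrA subrK.
exact: H.
Qed.

Let nodeS h K k : node h K k.+1 = node h K k + h.
Proof. by rewrite /node -natr1; ring. Qed.

Let bump_ge0 h K k y : 0 < h -> 0 <= bump h K k y.
Proof.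
move=> h0; rewrite subr_ge0 /ramp sstep_le// ler_pM2r ?invr_gt0// lerB// nodeS.
by rewrite lerDl ltW.
Qed.

(** A ramp takes the length [3 h] to rise, and the next one starts [h] later. *)
Let bump_support h K k y : 0 < h -> bump h K k y != 0 ->
  `|y - node h K k| <= 4 * h.
Proof.
move=> h0; apply: contraNle; rewrite ltr_normr => /orP[H|H]; apply/eqP.
  rewrite /bump /ramp nodeS.
  by rewrite !sstep_eq1 ?subrr// ler_pdivlMr//; lra.
rewrite /bump /ramp nodeS.
by rewrite !sstep_eq0 ?subrr// pmulr_lle0 ?invr_gt0//; lra.
Qed.

Let tot_ge0 h K y : 0 < h -> 0 <= tot h K y.
Proof. by move=> h0; rewrite -sum_bump sumr_ge0// => k _; exact: bump_ge0. Qed.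

Let tot_le1 h K y : tot h K y <= 1.
Proof.
rewrite lerBlDr (le_trans (sstep_le1 _))// lerDl; exact: sstep_ge0.
Qed.

Let approx m G M L h K x : (forall x, `|G x| <= M) -> lip_coords m.+1 L G ->
  0 < h ->
  `|G x - \sum_(k < K + K) fix_coord m G (node h K k) x * bump h K k (x m)|
    <= 4 * L * h + M * (1 - tot h K (x m)).
Proof.
move=> GM lG h0; have [L0 _] := lG.
have -> : G x = \sum_(k < K + K) G x * bump h K k (x m) + G x * (1 - tot h K (x m)).
  by rewrite -mulr_sumr sum_bump; ring.
rewrite addrAC -sumrB (le_trans (ler_normD _ _))// lerD//; last first.
  by rewrite normrM ler_pM// ger0_norm ?subr_ge0.
rewrite (le_trans (ler_norm_sum _ _ _))//.
rewrite (@le_trans _ _ (\sum_(k < K + K) 4 * L * h * bump h K k (x m)))//.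
  apply: ler_sum => k _; rewrite -mulrBl normrM (ger0_norm (bump_ge0 _ _ _ h0)).
  have [->|b0] := eqVneq (bump h K k (x m)) 0; first by rewrite !mulr0.
  rewrite ler_wpM2r ?bump_ge0// (le_trans (lip_fix_coord_dist _ _ lG))//.
  rewrite (_ : 4 * L * h = L * (4 * h)); last by ring.
  by rewrite ler_wpM2l// bump_support.
rewrite -mulr_sumr sum_bump ler_piMr//.
by rewrite !mulr_ge0// ltW.
Qed.

Let cvg_ramp j G M L a h : (forall x, `|G x| <= M) -> lip_coords j L G -> 0 < h ->
  (fun n => Ex P (fun w => G (S n ^~ w))) @ \oo --> Ex P' (fun w => G (S' ^~ w)) ->
  (fun n => Ex P (fun w => G (S n ^~ w) * ramp a h (S n j w))) @ \oo -->
  Ex P' (fun w => G (S' ^~ w) * ramp a h (S' j w)).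
Proof.
move=> GM lG h0 cG; rewrite (indepS' _ GM lG h0).
set e := Ex P' (fun w => ramp a h (S' j w)).
apply: cvg_sub0 (cvgS a GM lG h0) _.
exact: cvgMl.
Qed.

Let Ex_bump d0 (T : measurableType d0) (Q : probability T R) (U V : T -> R)
  h K k : 0 < h -> bounded_rv U -> measurable_fun setT V ->
  Ex Q (fun w => U w * bump h K k (V w)) =
  Ex Q (fun w => U w * ramp (node h K k) h (V w)) -
  Ex Q (fun w => U w * ramp (node h K k.+1) h (V w)).
Proof.
move=> h0 bU mV; rewrite -ExB; [|by apply: bounded_rvM => //; exact: bounded_rv_ramp..].
by apply: Ex_ext => w; rewrite mulrBr.
Qed.

Let bounded_rv_bump d0 (T : measurableType d0) (V : T -> R) h K k : 0 < h ->
  measurable_fun setT V -> bounded_rv (fun w => bump h K k (V w)).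
Proof. by move=> h0 mV; apply: bounded_rvB; exact: bounded_rv_ramp. Qed.

Let approx_Ex d0 (T : measurableType d0) (Q : probability T R) (U : nat -> T -> R)
   m G M L h K : (forall j, measurable_fun setT (U j)) ->
  (forall x, `|G x| <= M) -> lip_coords m.+1 L G -> 0 < h ->
  `|Ex Q (fun w => G (U ^~ w)) - \sum_(k < K + K)
      Ex Q (fun w => fix_coord m G (node h K k) (U ^~ w) * bump h K k (U m w))|
    <= 4 * L * h + M * (1 - Ex Q (fun w => tot h K (U m w))).
Proof.
move=> mU GM lG h0.
have bG := bounded_rv_lip GM lG mU.
have bk (k : 'I_(K + K)) : bounded_rv (fun w =>
    fix_coord m G (node h K k) (U ^~ w) * bump h K k (U m w)).
  apply: bounded_rvM; last exact: bounded_rv_bump.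
  by apply: bounded_rv_lip (lip_fix_coord _ lG) mU => x; exact: GM.
have bt : bounded_rv (fun w => tot h K (U m w)).
  by apply: bounded_rvB; exact: bounded_rv_ramp.
rewrite -Ex_sum// -ExB//; last exact: bounded_rv_sum.
rewrite (le_trans (normr_Ex _ _))//; first by apply: bounded_rvB => //; exact: bounded_rv_sum.
have b1 : bounded_rv (fun w => 1 - tot h K (U m w)).
  by apply: bounded_rvB => //; exact: bounded_rv_cst.
rewrite (@le_trans _ _ (Ex Q (fun w => 4 * L * h + M * (1 - tot h K (U m w)))))//.
  apply: le_Ex.
  - by apply: bounded_rv_norm; apply: bounded_rvB => //; exact: bounded_rv_sum.
  - by apply: bounded_rvD; [exact: bounded_rv_cst | exact: bounded_rvZ].
  - by move=> w; apply: (approx _ (U ^~ w) GM lG).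
rewrite ExD; [|exact: bounded_rv_cst|exact: bounded_rvZ].
by rewrite Ex_cst ExZ// ExB ?Ex_cst//; exact: bounded_rv_cst.
Qed.

Let tot_cvg1 j h : 0 < h ->
  Ex P' (fun w => tot h K (S' j w)) @[K --> \oo] --> (1 : R).
Proof.
move=> h0; rewrite -[X in _ --> X](Ex_cst P').
apply: (@Ex_cvg _ _ _ _ _ _ 1) => [K|K w|w].
- by apply: (proj1 (_ : bounded_rv _)); apply: bounded_rvB; exact: bounded_rv_ramp.
- by rewrite ger0_norm ?tot_ge0.
- apply/cvg_seqP => e e0.
  have [K0 HK0] := archimedean_bound (`|S' j w| / h + 3).
  exists K0 => K K0K.
  have HK : `|S' j w| / h + 3 <= K%:R by rewrite (le_trans HK0)// ler_nat.
  have : `|S' j w| + 3 * h <= K%:R * h.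
    by rewrite -ler_pdivrMr// mulrDl mulfK// gt_eqF.
  move=> H; have := ler_norm (S' j w); have := ler_norm (- S' j w).
  rewrite normrN => n1 n2.
  rewrite /tot /ramp (@sstep_eq1 _ _ _) ?sstep_eq0 ?subr0 ?subrr ?normr0 ?(ltW e0)//.
    rewrite pmulr_lle0 ?invr_gt0// /node natrD addrK; lra.
  by rewrite ler_pdivlMr// /node sub0r mulNr; lra.
Qed.

(** Induction on the dimension. Freezing the last coordinate at the nodes writes [G], up to a small
    error, as a sum of products of a function of the earlier coordinates and a bump; [cvgS] and
    [indepS'] separate the two factors. No tightness is assumed: the mass of [S n m] off the plateau
    is controlled by the convergence of the mean of [tot] itself. *)
Lemma finite_dimensional_cvg m G M L : (forall x, `|G x| <= M) ->
  lip_coords m L G ->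
  (fun n => Ex P (fun w => G (S n ^~ w))) @ \oo --> Ex P' (fun w => G (S' ^~ w)).
Proof.
elim: m G M L => [|m IH] G M L GM lG.
  have GE x : G x = G (fun=> 0).
    apply/eqP; rewrite -subr_eq0 -normr_le0.
    by have [_ /(_ x (fun=> 0))] := lG; rewrite big_ord0 mulr0.
  apply: (@cvg_seq_eq _ _ (fun=> G (fun=> 0)) _ (G (fun=> 0))) => [n||].
  - by rewrite -[RHS](Ex_cst P); apply: Ex_ext => w; exact: GE.
  - by rewrite -[RHS](Ex_cst P'); apply: Ex_ext => w; exact: GE.
  - exact: cvg_cst.
have [L0 _] := lG; have M0 : 0 <= M := le_trans (normr_ge0 _) (GM (fun=> 0)).
(* Six shares: the approximation costs [e6 + 2 e6] under [P] and [e6 + e6] under [P'], and the two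
   sums differ by [e6]. *)
apply/cvg_seqP => e e0; pose e6 := e / 6.
have e60 : 0 < e6 by rewrite divr_gt0.
pose h := e6 / (4 * L + 1).
have h0 : 0 < h by rewrite divr_gt0// ltr_wpDl// mulr_ge0.
have Lh : 4 * L * h <= e6.
  rewrite /h mulrCA ler_piMr ?(ltW e60)// ler_pdivrMr; last by rewrite ltr_wpDl// mulr_ge0.
  by rewrite mul1r lerDl.
have M1 : 0 < M + 1 by rewrite ltr_wpDl.
have eM0 : 0 < e6 / (M + 1) by rewrite divr_gt0.
have small u : `|u| <= e6 / (M + 1) -> M * u <= e6.
  move=> hu; rewrite (@le_trans _ _ (M * (e6 / (M + 1))))//.
    by rewrite ler_wpM2l// (le_trans (ler_norm _) hu).
  rewrite mulrCA ler_piMr ?(ltW e60)// ler_pdivrMr// mul1r lerDl//.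
have /cvg_seqP/(_ _ eM0)[K /(_ K (leqnn _)) HK] := tot_cvg1 m h0.
have cramp a : (fun n => Ex P (fun w => ramp a h (S n m w))) @ \oo -->
    Ex P' (fun w => ramp a h (S' m w)).
  (* The constant function 1 turns [cvg_ramp] into convergence of the marginal. *)
  have := @cvg_ramp m (fun=> 1) 1 0 a h _ _ h0.
  rewrite normr1 => /(_ (fun=> lexx _)) /(_ _ _)/cvg_seq_eq; apply.
  - by move=> n; apply: Ex_ext => w; rewrite mul1r.
  - by apply: Ex_ext => w; rewrite mul1r.
  - by split => // x y; rewrite subrr normr0 mul0r.
  - by rewrite !Ex_cst; exact: cvg_cst.
have ctot : (fun n => Ex P (fun w => tot h K (S n m w))) @ \oo -->
    Ex P' (fun w => tot h K (S' m w)).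
  have := cvg_seqB (cramp (node h K 0)) (cramp (node h K (K + K))).
  apply: cvg_seq_eq => [n|]; rewrite /tot.
    by rewrite (@ExB _ _ _ P (fun w => ramp _ _ _) (fun w => ramp _ _ _));
      [|exact: bounded_rv_ramp..].
  by rewrite (@ExB _ _ _ P' (fun w => ramp _ _ _) (fun w => ramp _ _ _));
      [|exact: bounded_rv_ramp..].
have cA : (fun n => \sum_(k < K + K) Ex P (fun w => fix_coord m G (node h K k)
      (S n ^~ w) * bump h K k (S n m w))) @ \oo -->
    \sum_(k < K + K) Ex P' (fun w => fix_coord m G (node h K k)
      (S' ^~ w) * bump h K k (S' m w)).
  apply: cvg_seq_sum => k.
  have fM x : `|fix_coord m G (node h K k) x| <= M by exact: GM.
  have lf := lip_fix_coord (node h K k) lG.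
  have cf := IH _ _ _ fM lf.
  have := cvg_seqB (cvg_ramp (a := node h K k) fM lf h0 cf)
               (cvg_ramp (a := node h K k.+1) fM lf h0 cf).
  apply: cvg_seq_eq => [n|].
    by apply: Ex_bump => //; exact: bounded_rv_lip fM lf (mS _).
  by apply: Ex_bump => //; exact: bounded_rv_lip fM lf mS'.
have /cvg_seqP/(_ _ eM0)[n1 Hn1] := ctot.
have /cvg_seqP/(_ _ e60)[n2 Hn2] := cA.
exists (maxn n1 n2) => n; rewrite geq_max => /andP[/Hn1 h1 /Hn2 h2].
have a1 := approx_Ex P K (mS n) GM lG h0.
have a2 := approx_Ex P' K mS' GM lG h0.
set A := \sum_(k < K + K) _ in h2 a1; set A' := \sum_(k < K + K) _ in h2 a2.
set t := Ex P _ in h1 a1; set t' := Ex P' _ in h1 a2 HK.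
have b1 : M * (1 - t') <= e6 by apply: small; rewrite distrC.
have b2 : M * (t' - t) <= e6 by apply: small; rewrite distrC.
move: a1 a2 h2; rewrite !ler_norml => /andP[? ?] /andP[? ?] /andP[? ?].
have eE : e = 6 * e6 by rewrite /e6 mulrCA divff// mulr1.
have b3 : M * (1 - t) <= 2 * e6 by rewrite (_ : 1 - t = (1 - t') + (t' - t)); [lra|ring].
by rewrite eE; apply/andP; split; lra.
Qed.

End FiniteDimensional.

(** * Gaussian smoothing *)

Section NormalMoments.
Context {R : realType}.
Variable sigma : R.
Hypothesis s0 : 0 < sigma.
Local Notation mu := (@lebesgue_measure R).
Local Notation phi := (normal_pdf 0 sigma).
Implicit Types (x : R) (f : R -> R).

Let sn0 : sigma != 0. Proof. by rewrite gt_eqF. Qed.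

(** Exponential tilts of the density, quadratic here and linear in [normal_pdf_shift], are again
    multiples of Gaussian densities, whose integral is known. The moments below follow from this and
    elementary lower bounds of [expR], without integration by parts. *)
Lemma normal_pdf_scale (k : R) x : 0 < k ->
  phi x * expR ((1 - k ^- 2) / (2 * sigma ^+ 2) * x ^+ 2) =
  k * normal_pdf 0 (k * sigma) x.
Proof.
move=> k0; have kn0 : k != 0 by rewrite gt_eqF.
rewrite !normal_pdfE ?mulf_neq0// /normal_fun /normal_peak !subr0.
rewrite -[LHS]mulrA -expRD [RHS]mulrA; congr (_ * expR _).
- have -> : (k * sigma) ^+ 2 * pi *+ 2 = k ^+ 2 * (sigma ^+ 2 * pi *+ 2).
    by move: pi => p; ring.
  rewrite sqrtrM ?sqr_ge0// sqrtr_sqr gtr0_norm// invfM mulrA divff//.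
  by rewrite mul1r.
- by field; rewrite ?kn0 ?sn0.
Qed.

Lemma normal_pdf_shift (m : R) x :
  phi x * expR (m * x / sigma ^+ 2 - m ^+ 2 / (2 * sigma ^+ 2)) =
  normal_pdf m sigma x.
Proof.
rewrite !normal_pdfE// /normal_fun -[LHS]mulrA -expRD; congr (_ * expR _).
by field; rewrite ?sn0.
Qed.

Let phi_ge0 x : 0 <= phi x. Proof. exact: normal_pdf_ge0. Qed.

Definition nint (f : R -> R) : R := Rintegral mu setT (fun x => f x * phi x).
Definition nintegrable (f : R -> R) : Prop :=
  mu.-integrable setT (fun x => (f x * phi x)%:E).

Lemma nintegrable_le (f : R -> R) (a b : R) : measurable_fun setT f ->
  (forall x, `|f x| * phi x <= a * phi x + b * normal_pdf 0 (2 * sigma) x) ->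
  nintegrable f.
Proof.
move=> mf H; rewrite /nintegrable.
have ig : mu.-integrable setT
    (fun x => (a * phi x + b * normal_pdf 0 (2 * sigma) x)%:E).
  under eq_fun do rewrite EFinD.
  apply: integrableD => //; under eq_fun do rewrite EFinM;
    by apply: integrableZl => //; exact: integrable_normal_pdf.
apply: le_integrable ig => //.
- apply/measurable_EFinP; apply: measurable_funM => //.
  exact: measurable_normal_pdf.
- move=> x _ /=; rewrite lee_fin normrM (ger0_norm (phi_ge0 x)).
  by rewrite (le_trans (H x))// ler_norm.
Qed.

Lemma nint_le f (a b : R) : nintegrable f ->
  (forall x, f x * phi x <= a * phi x + b * normal_pdf 0 (2 * sigma) x) ->
  nint f <= a + b.
Proof.
move=> nf H.
have ia : mu.-integrable setT (fun x => (a * phi x)%:E).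
  by under eq_fun do rewrite EFinM; apply: integrableZl => //; exact: integrable_normal_pdf.
have ib : mu.-integrable setT (fun x => (b * normal_pdf 0 (2 * sigma) x)%:E).
  by under eq_fun do rewrite EFinM; apply: integrableZl => //; exact: integrable_normal_pdf.
apply: (@le_trans _ _ (Rintegral mu setT
    (fun x => a * phi x + b * normal_pdf 0 (2 * sigma) x))).
  apply: le_Rintegral => //.
  by under [X in _.-integrable _ X]eq_fun do rewrite /= EFinD; exact: integrableD.
have i1 s : Rintegral mu setT (normal_pdf 0 s) = 1.
  by rewrite /Rintegral integral_normal_pdf.
rewrite RintegralD// !RintegralZl ?i1 ?mulr1//; exact: integrable_normal_pdf.
Qed.

Lemma nintegrableD f g : nintegrable f -> nintegrable g ->
  nintegrable (fun x => f x + g x).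
Proof.
move=> nf ng; rewrite /nintegrable; under eq_fun do rewrite mulrDl EFinD.
exact: integrableD.
Qed.

Lemma nintegrableZ (c : R) f : nintegrable f -> nintegrable (fun x => c * f x).
Proof.
move=> nf; rewrite /nintegrable; under eq_fun do rewrite -mulrA EFinM.
exact: integrableZl.
Qed.

Lemma nintD f g : nintegrable f -> nintegrable g ->
  nint (fun x => f x + g x) = nint f + nint g.
Proof.
move=> nf ng; rewrite /nint -RintegralD//.
by congr Rintegral; apply/funext => x; rewrite mulrDl.
Qed.

Lemma nintZ (c : R) f : nintegrable f -> nint (fun x => c * f x) = c * nint f.
Proof.
move=> nf; rewrite /nint -RintegralZl//.
by congr Rintegral; apply/funext => x; rewrite mulrA.
Qed.

Lemma nintegrable_cst (c : R) : nintegrable (fun=> c).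
Proof.
apply: (@nintegrable_le _ `|c| 0) => // x.
by rewrite mul0r addr0.
Qed.

Lemma nint_cst (c : R) : nint (fun=> c) = c.
Proof.
rewrite -[c in LHS]mulr1 nintZ; last exact: nintegrable_cst.
rewrite /nint /Rintegral; under eq_integral do rewrite mul1r.
by rewrite integral_normal_pdf mulr1.
Qed.

Lemma expR_ge_sqr (y : R) : 0 <= y -> y ^+ 2 / 4 <= expR y.
Proof.
move=> y0; have -> : expR y = expR (y / 2) ^+ 2.
  by rewrite expr2 -expRD; congr expR; lra.
have := expR_ge1Dx (y / 2) => h.
have : (1 + y / 2) ^+ 2 <= expR (y / 2) ^+ 2 by rewrite lerXn2r ?nnegrE ?expR_ge0//; lra.
by apply: le_trans; nra.
Qed.

Let gap : (1 - 2 ^- 2) / (2 * sigma ^+ 2) = 3 / (8 * sigma ^+ 2).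
Proof. by field. Qed.

(** With [k = 2] in [normal_pdf_scale], [y = 3 x^2 / (8 sigma^2)] and [y <= expR y], the constant is
    [2 * 8 / 3 <= 6]. *)
Let dom1 x : x ^+ 2 * phi x <= 0 * phi x + (6 * sigma ^+ 2) * normal_pdf 0 (2 * sigma) x.
Proof.
have H := normal_pdf_scale x (ltr0n R 2); rewrite gap in H.
set y := _ * x ^+ 2 in H.
have y0 : 0 <= y by rewrite mulr_ge0 ?sqr_ge0// divr_ge0// mulr_ge0// sqr_ge0.
have xE : x ^+ 2 = 8 * sigma ^+ 2 / 3 * y by rewrite /y; field.
have h : x ^+ 2 <= 8 * sigma ^+ 2 / 3 * expR y.
  rewrite {1}xE ler_wpM2l//; first by rewrite divr_ge0// mulr_ge0// sqr_ge0.
  by rewrite (le_trans _ (expR_ge1Dx y))// lerDr.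
rewrite mul0r add0r (le_trans (ler_wpM2r (phi_ge0 x) h))//.
rewrite -[leLHS]mulrA [expR y * _]mulrC H.
have := normal_pdf_ge0 0 (2 * sigma) x; move: (normal_pdf _ _ _) => z z0.
by have := sqr_ge0 sigma; move: (sigma ^+ 2) => v v0; nra.
Qed.

(** [y^2 / 4 <= expR y] bounds [x^4] by [29 sigma^4 expR y], as [4 * 64 / 9 <= 29]. The cube is at
    most [sigma^3 + x^4 / sigma], and the factor [k = 2] of the tilt doubles 29. *)
Let dom4 x : `|x| ^+ 3 * phi x <= sigma ^+ 3 * phi x +
   (58 * sigma ^+ 3) * normal_pdf 0 (2 * sigma) x.
Proof.
have H := normal_pdf_scale x (ltr0n R 2); rewrite gap in H.
set y := _ * x ^+ 2 in H.
have y0 : 0 <= y by rewrite mulr_ge0 ?sqr_ge0// divr_ge0// mulr_ge0// sqr_ge0.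
have xE : x ^+ 4 = 64 * sigma ^+ 4 / 9 * y ^+ 2 by rewrite /y; field.
have h : x ^+ 4 <= 29 * sigma ^+ 4 * expR y.
  have s4 : 0 <= sigma ^+ 4 by rewrite exprn_ge0// ltW.
  have := expR_ge_sqr y0; rewrite {1}xE; move: (expR y) => z hz.
  have : sigma ^+ 4 * (y ^+ 2 / 4) <= sigma ^+ 4 * z by rewrite ler_wpM2l.
  have : 0 <= sigma ^+ 4 * (y ^+ 2 / 4) by rewrite mulr_ge0// divr_ge0// sqr_ge0.
  by lra.
have h3 : `|x| ^+ 3 <= sigma ^+ 3 + x ^+ 4 / sigma.
  have x4 : x ^+ 4 = `|x| ^+ 4 by rewrite -normrX ger0_norm// exprn_even_ge0.
  rewrite x4; have [xs|xs] := leP `|x| sigma.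
    rewrite (@le_trans _ _ (sigma ^+ 3)) ?lerXn2r ?nnegrE ?(ltW s0)// lerDl.
    by rewrite divr_ge0 ?exprn_ge0 ?(ltW s0).
  rewrite (@le_trans _ _ (`|x| ^+ 4 / sigma))//; last first.
    by rewrite lerDr exprn_ge0// ltW.
  by rewrite ler_pdivlMr// [in leRHS]exprSr ler_wpM2l ?exprn_ge0 ?(ltW xs).
rewrite (le_trans (ler_wpM2r (phi_ge0 x) h3))// mulrDl lerD2l.
have h4 : x ^+ 4 / sigma <= 29 * sigma ^+ 3 * expR y.
  rewrite ler_pdivrMr// (le_trans h)// le_eqVlt; apply/orP; left; apply/eqP.
  by ring.
rewrite (le_trans (ler_wpM2r (phi_ge0 x) h4))//.
rewrite -[leLHS]mulrA [expR y * _]mulrC H.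
by rewrite le_eqVlt; apply/orP; left; apply/eqP; ring.
Qed.

Let mX n : measurable_fun setT (fun x : R => x ^+ n).
Proof. exact: measurable_funX. Qed.

Lemma nintegrable_sqr : nintegrable (fun x => x ^+ 2).
Proof.
apply: nintegrable_le (mX 2) _ => x; rewrite ger0_norm ?sqr_ge0//; exact: dom1.
Qed.

Lemma nintegrable_cube : nintegrable (fun x => `|x| ^+ 3).
Proof.
apply: (@nintegrable_le _ (sigma ^+ 3) (58 * sigma ^+ 3)).
  by apply: measurable_funX => //; exact: measurableT_comp.
by move=> x; rewrite ger0_norm ?exprn_ge0//; exact: dom4.
Qed.

Lemma nintegrable_id : nintegrable id.
Proof.
apply: (@nintegrable_le _ 1 (6 * sigma ^+ 2)) => // x.
rewrite (@le_trans _ _ ((1 + x ^+ 2) * phi x))//.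
  rewrite ler_wpM2r//= -(real_normK (num_real x)).
  by have := normr_ge0 x; move: `|x| => y y0; nra.
by rewrite mulrDl !mul1r lerD2l; have := dom1 x; rewrite mul0r add0r.
Qed.

(** Comparison of [phi] with its shift by [m] gives [m nint id <= m^2 / 2] for every real [m]; small
    [m] of both signs leave only 0. *)
Lemma nint_id : nint id = 0.
Proof.
have key (m : R) : m * nint id <= m ^+ 2 / 2.
  have s20 : 0 < sigma ^+ 2 by rewrite exprn_gt0.
  pose f x := (1 - m ^+ 2 / (2 * sigma ^+ 2)) + m / sigma ^+ 2 * x.
  have nf : nintegrable f.
    apply: nintegrableD; first exact: nintegrable_cst.
    by apply: nintegrableZ; exact: nintegrable_id.
  have : nint f <= 1.
    rewrite (_ : 1 = Rintegral mu setT (normal_pdf m sigma)); last first.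
      by rewrite /Rintegral integral_normal_pdf.
    apply: le_Rintegral => //; first exact: integrable_normal_pdf.
    move=> x _; rewrite -[leRHS]/(normal_pdf m sigma x) -(normal_pdf_shift m).
    rewrite [f x * _]mulrC ler_wpM2l//.
    rewrite (le_trans _ (expR_ge1Dx _))// /f le_eqVlt; apply/orP; left; apply/eqP.
    by ring.
  rewrite /f nintD; [|exact: nintegrable_cst|by apply: nintegrableZ; exact: nintegrable_id].
  rewrite nint_cst (nintZ _ nintegrable_id) => h.
  have : m / sigma ^+ 2 * nint id <= m ^+ 2 / (2 * sigma ^+ 2) by lra.
  rewrite -(ler_pM2r s20) => /le_trans h'; rewrite -[leLHS](mulfK (lt0r_neq0 s20)).
  rewrite mulrAC [m * _ / _]mulrAC h'//.
  by rewrite le_eqVlt; apply/orP; left; apply/eqP; field.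
apply/eqP; rewrite eq_le; apply/andP; split.
  apply: (@archimedean_le0 _ _ 2^-1) => // n.
  have n0 : 0 < (n.+1%:R^-1 : R) by rewrite invr_gt0 ltr0n.
  by have := key n.+1%:R^-1; rewrite expr2 -mulrA ler_pM2l.
rewrite -oppr_le0; apply: (@archimedean_le0 _ _ 2^-1) => // n.
have n0 : 0 < (n.+1%:R^-1 : R) by rewrite invr_gt0 ltr0n.
by have := key (- n.+1%:R^-1); rewrite sqrrN expr2 mulNr -mulrN -mulrA ler_pM2l.
Qed.

(** Comparison with the density scaled by [k] gives [(k^2 - 1) z <= 2 k^2 (k - 1)] for the
    normalised moment [z]; division by [k - 1] on either side of 1, with [k] close to 1, forces
    [z = 1]. *)
Lemma nint_sqr : nint (fun x => x ^+ 2) = sigma ^+ 2.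
Proof.
have s20 : 0 < sigma ^+ 2 by rewrite exprn_gt0.
pose z := nint (fun x => x ^+ 2) / sigma ^+ 2.
have z_E : nint (fun x => x ^+ 2) = z * sigma ^+ 2 by rewrite /z divfK// gt_eqF.
have z0 : 0 <= z.
  rewrite divr_ge0 ?(ltW s20)//; apply: Rintegral_ge0 => x _.
  by rewrite mulr_ge0// sqr_ge0.
have key (k : R) : 0 < k -> (k ^+ 2 - 1) * z <= 2 * k ^+ 2 * (k - 1).
  move=> k0; pose s := (1 - k ^- 2) / (2 * sigma ^+ 2).
  have nf : nintegrable (fun x => 1 + s * x ^+ 2).
    apply: nintegrableD; first exact: nintegrable_cst.
    by apply: nintegrableZ; exact: nintegrable_sqr.
  have : nint (fun x => 1 + s * x ^+ 2) <= k.
    have ip := @integrable_normal_pdf R 0 (k * sigma).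
    have kE : k = Rintegral mu setT (fun x => k * normal_pdf 0 (k * sigma) x).
      rewrite RintegralZl//.
      by rewrite /Rintegral integral_normal_pdf mulr1.
    have ik : mu.-integrable setT (fun x => (k * normal_pdf 0 (k * sigma) x)%:E).
      by under eq_fun do rewrite EFinM; exact: integrableZl.
    rewrite [leRHS]kE; apply: le_Rintegral => //.
    move=> x _; rewrite -[leRHS]/(k * normal_pdf 0 (k * sigma) x) -normal_pdf_scale//.
    rewrite [leLHS]mulrC ler_wpM2l//.
    exact: expR_ge1Dx.
  rewrite nintD; [|exact: nintegrable_cst|by apply: nintegrableZ; exact: nintegrable_sqr].
  rewrite nint_cst (nintZ _ nintegrable_sqr) z_E => h.
  have k20 : 0 < 2 * k ^+ 2 by rewrite mulr_gt0// exprn_gt0.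
  have : s * (z * sigma ^+ 2) <= k - 1 by lra.
  rewrite -(ler_pM2l k20) => /(le_trans _); apply.
  rewrite le_eqVlt; apply/orP; left; apply/eqP; rewrite /s.
  by field; rewrite ?(gt_eqF k0) ?sn0.
suff z1 : z = 1 by rewrite z_E z1 mul1r.
clearbody z.
have n0 (n : nat) : 0 < (n.+1%:R^-1 : R) by rewrite invr_gt0 ltr0n.
have n1 (n : nat) : (n.+1%:R^-1 : R) <= 1 by rewrite invf_le1 ?ltr0n// ler1n.
apply/eqP; rewrite eq_le; apply/andP; split; rewrite -subr_le0.
  apply: (@archimedean_le0 _ _ 2) => // n; move: (n0 n) (n1 n).
  move: (_^-1) => h h0 h1; have := key (1 + h); rewrite addr_gt0// => /(_ isT).
  rewrite (_ : (1 + h) ^+ 2 - 1 = h * (2 + h)); last ring.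
  rewrite (_ : 2 * (1 + h) ^+ 2 * (1 + h - 1) = h * (2 * (1 + h) ^+ 2)); last ring.
  by rewrite -mulrA ler_pM2l//; nra.
apply: (@archimedean_le0 _ _ 4) => // n; move: (n0 n) (n1 n).
move: (_^-1) => h h0 h1; have := key (1 - h / 2).
have h2 : 0 < 1 - h / 2 by lra.
move=> /(_ h2).
rewrite (_ : (1 - h / 2) ^+ 2 - 1 = - (h / 2 * (2 - h / 2))); last ring.
rewrite (_ : 2 * (1 - h / 2) ^+ 2 * (1 - h / 2 - 1) =
   - (h / 2 * (2 * (1 - h / 2) ^+ 2))); last ring.
have h20 : 0 < h / 2 by rewrite divr_gt0.
by rewrite mulNr lerN2 -[h / 2 * (2 - _) * z]mulrA ler_pM2l//; nra.
Qed.

Lemma nint_cube : nint (fun x => `|x| ^+ 3) <= 59 * sigma ^+ 3.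
Proof.
rewrite (le_trans (nint_le nintegrable_cube dom4))//.
by rewrite le_eqVlt; apply/orP; left; apply/eqP; ring.
Qed.

Lemma normr_nint f g : nintegrable f -> nintegrable g ->
  (forall x, `|f x| <= g x) -> `|nint f| <= nint g.
Proof.
move=> nf ng fg; rewrite (le_trans (le_normr_Rintegral _ _))//.
apply: le_Rintegral => //.
  by apply: (integrable_norm nf).
by move=> x _; rewrite normrM (ger0_norm (phi_ge0 x)) ler_wpM2r.
Qed.

(** The first two moments evaluate the Taylor polynomial, the third absolute one bounds the
    remainder. *)
Lemma nint_taylor B g g1 g2 y : smooth3 B g g1 g2 ->
  `|nint (fun x => g (y + x)) - g y - sigma ^+ 2 * g2 y / 2|
    <= 59 * B * sigma ^+ 3.
Proof.
move=> [B0 bg [lg lg1 lg2] tg].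
have mg : measurable_fun setT (fun x : R => g (y + x)).
  by apply: measurable_lipf B0 lg _; exact: measurable_funD.
have ng : nintegrable (fun x => g (y + x)).
  apply: (@nintegrable_le _ B 0) => // x; rewrite mul0r addr0 ler_wpM2r//.
  by have [] := bg (y + x).
pose f x := g (y + x) + (- g y) + (- g1 y) * x + (- (g2 y / 2)) * x ^+ 2.
have n1 := nintegrable_cst (- g y).
have n2 := nintegrableZ (- g1 y) nintegrable_id.
have n3 := nintegrableZ (- (g2 y / 2)) nintegrable_sqr.
have nf : nintegrable f by do 3 (apply: nintegrableD => //).
have fE : nint f = nint (fun x => g (y + x)) - g y - sigma ^+ 2 * g2 y / 2.
  rewrite /f (nintD (nintegrableD (nintegrableD ng n1) n2) n3).
  rewrite (nintD (nintegrableD ng n1) n2) (nintD ng n1).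
  by rewrite nint_cst (nintZ _ nintegrable_id) nint_id (nintZ _ nintegrable_sqr)
     nint_sqr; ring.
rewrite -fE (@le_trans _ _ (nint (fun x => B * `|x| ^+ 3)))//.
  apply: normr_nint => //; first by apply: nintegrableZ; exact: nintegrable_cube.
  move=> x; have := tg y x; congr (`|_| <= _); rewrite /f; ring.
rewrite (nintZ _ nintegrable_cube).
rewrite (le_trans (ler_wpM2l B0 nint_cube))//.
by rewrite le_eqVlt; apply/orP; left; apply/eqP; ring.
Qed.

Lemma integral_normal_prob (f : R -> R) (M : R) : measurable_fun setT f ->
  (forall x, `|f x| <= M) ->
  (\int[normal_prob 0 sigma]_x (f x)%:E)%E = (nint f)%:E.
Proof.
move=> mf fM.
have nf : nintegrable f.
  by apply: (@nintegrable_le _ M 0) => // x; rewrite mul0r addr0 ler_wpM2r.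
have dom := normal_prob_dominates 0 sigma.
have intf : (normal_prob 0 sigma).-integrable setT (fun x => (f x)%:E).
  by apply: (@bounded_rv_integrable _ _ _ (normal_prob 0 sigma) f); split => //; exists M.
rewrite -(Radon_Nikodym_change_of_variables dom)//=.
rewrite /nint /Rintegral fineK; last exact: (integrable_fin_num measurableT nf).
apply: ae_eq_integral => //.
- by apply: emeasurable_funM => //; exact/measurable_EFinP.
- by case/integrableP: nf.
- under [X in ae_eq _ _ _ X]eq_fun do rewrite EFinM.
  apply: ae_eqe_mul2l => /=.
  rewrite Radon_NikodymE//=.
  case: cid => /= h [h1 h2 h3].
  apply: integral_ae_eq => //=.
  + by apply/measurable_EFinP; exact: measurable_normal_pdf.
  + by move=> E _ mE; rewrite -h3.
Qed.

End NormalMoments.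

(** * Integrals of functions of variables with a given law *)

Section LawTransfer.
Context {R : realType} {d d1 : measure_display}.
Context {T : measurableType d} {T1 : measurableType d1}.
Variable P : probability T R.
Variables (X : T -> T1) (nu : {measure set T1 -> \bar R}).
Hypothesis mX : measurable_fun setT X.
Hypothesis Xnu : forall B, measurable B -> P (X @^-1` B) = nu B.

Lemma integral_law (F : T1 -> \bar R) : measurable_fun setT F ->
  (forall x, 0 <= F x)%E -> (\int[P]_w F (X w) = \int[nu]_x F x)%E.
Proof.
move=> mF F0.
transitivity (\int[pushforward P X]_(x in setT) F x)%E.
  by rewrite (ge0_integral_pushforward mX P measurableT mF)// => x _.
by apply: eq_measure_integral => B mB _; exact: Xnu.
Qed.

End LawTransfer.

Section ProductLawTransfer.
Context {R : realType} {d d1 d2 : measure_display}.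
Context {T : measurableType d} {T1 : measurableType d1} {T2 : measurableType d2}.
Variable P : probability T R.
Variables (X1 : T -> T1) (X2 : T -> T2).
Variables (nu1 : probability T1 R) (nu2 : probability T2 R).
Hypothesis mX1 : measurable_fun setT X1.
Hypothesis mX2 : measurable_fun setT X2.
Hypothesis law : forall A D, measurable A -> measurable D ->
  P (X1 @^-1` A `&` X2 @^-1` D) = (nu1 A * nu2 D)%E.

Lemma integral_product_law (F : T1 * T2 -> \bar R) : measurable_fun setT F ->
  (forall x, 0 <= F x)%E ->
  (\int[P]_w F (X1 w, X2 w) = \int[nu1]_x \int[nu2]_z F (x, z))%E.
Proof.
move=> mF F0.
pose X : T -> T1 * T2 := fun w => (X1 w, X2 w).
have mX : measurable_fun setT X by apply/measurable_fun_pairP; split.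
rewrite (_ : (\int[nu1]_x _)%E = (\int[nu1 \x nu2]_z F z)%E); last first.
  by rewrite (fubini_tonelli1 (m1 := nu1) (m2 := nu2)).
apply: (integral_law mX) => // C mC.
pose mX_mixin := isMeasurableFun.Build _ _ _ _ _ mX.
pose X' : {mfun T >-> _} := HB.pack X mX_mixin.
apply/esym; apply: (product_measure_unique (m' := pushforward P X')) => //.
Qed.

End ProductLawTransfer.

(** * Brownian motion and its heat semigroup *)

Section BrownianMotion.
Context {R : realType} {d : measure_display} {Omega : measurableType d}.
Variables (P : probability Omega R) (W : R -> Omega -> R).
Hypothesis bm : brownian_motion P W.
Implicit Types (a b s t tau y B : R) (g : R -> R).

Lemma brownian_measurable t : measurable_fun setT (W t).
Proof. by case: bm. Qed.

Lemma brownian0 w : W 0 w = 0.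
Proof. by case: bm => _ []. Qed.

Lemma brownian_increments (T : nat -> R) k (C : nat -> set R) :
  0 <= T 0%N -> (forall j, T j < T j.+1) -> (forall j, measurable (C j)) ->
  P [set w | forall j, (j < k)%N -> C j (W (T j.+1) w - W (T j) w)] =
  (\prod_(j < k) normal_prob 0 (Num.sqrt (T j.+1 - T j)) (C j))%E.
Proof.
move=> T0 Ti mC; have [_ [_ [_ H]]] := bm.
have := H k (fun j => T j) (fun j => C j) T0 (fun j => Ti j) (fun j => mC j).
move=> <-; congr (P _); apply/seteqP; split => w /= Hw.
- by move=> j; apply/mem_set; exact: Hw.
- by move=> j jk; apply/set_mem; exact: (Hw (Ordinal jk)).
Qed.

Lemma brownian_law s t C : 0 <= s -> s < t -> measurable C ->
  P ((fun w => W t w - W s w) @^-1` C) = normal_prob 0 (Num.sqrt (t - s)) C.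
Proof.
move=> s0 st mC.
(* [brownian_increments] wants an infinite increasing sequence of times; only the first two are
   used. *)
pose T (j : nat) : R := s + j%:R * (t - s).
have T1 : T 1%N = t by rewrite /T mul1r subrKC.
have T0 : T 0%N = s by rewrite /T mul0r addr0.
have := @brownian_increments T 1 (fun=> C); rewrite big_ord1 T0 T1 => <- //.
- congr (P _); apply/seteqP; split => w /=; last by move/(_ 0%N isT); rewrite T0 T1.
  by move=> H [|j]//; rewrite T0 T1.
- by move=> j; rewrite /T ltrD2l ltr_pM2r ?subr_gt0// ltr_nat.
Qed.

(** The average is taken through [W tau] rather than a density, so that [tau = 0] needs no separate
    definition. *)
Definition heat tau g y : R := Ex P (fun w => g (y + W tau w)).

Lemma bounded_rv_lipf d' (T : measurableType d') B M g (S : T -> R) :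
  0 <= B -> lipf B g -> (forall x, `|g x| <= M) -> measurable_fun setT S ->
  bounded_rv (fun w => g (S w)).
Proof.
move=> B0 lg gM mS; split; last by exists M => w; exact: gM.
exact: measurable_lipf B0 lg mS.
Qed.

Lemma heat0 g y : heat 0 g y = g y.
Proof. by rewrite -[RHS](Ex_cst P); apply: Ex_ext => w; rewrite brownian0 addr0. Qed.

Section BoundedLipschitz.
Variables (B M : R) (g : R -> R).
Hypotheses (B0 : 0 <= B) (lg : lipf B g) (gM : forall x, `|g x| <= M).

Let brv t y : bounded_rv (fun w => g (y + W t w)).
Proof.
apply: bounded_rv_lipf B0 lg gM _; apply: measurable_funD => //.
exact: brownian_measurable.
Qed.

Lemma heat_bound tau y : `|heat tau g y| <= M.
Proof. by apply: normr_Ex_le => // w. Qed.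

Lemma heat_lipf tau : lipf B (heat tau g).
Proof.
move=> x y; rewrite /heat -ExB//; apply: normr_Ex_le; first exact: bounded_rvB.
move=> w; rewrite (le_trans (lg _ _))// ler_wpM2l//.
by rewrite opprD addrACA subrr addr0.
Qed.

Let gM_ge0 x : 0 <= g x + M.
Proof. by have := gM x; rewrite ler_norml => /andP[]; lra. Qed.

(** The shift by [M] makes the integrand nonnegative, as the transfer of laws demands; it is
    cancelled wherever the lemma is applied. *)
Lemma heat_law_ge0 s t y : 0 <= s -> s < t ->
  (\int[P]_w (g (y + (W t w - W s w)) + M)%:E =
   \int[normal_prob 0 (Num.sqrt (t - s))]_x (g (y + x) + M)%:E)%E.
Proof.
move=> s0 st.
have mX : measurable_fun setT (fun w => W t w - W s w).
  by apply: measurable_funB; exact: brownian_measurable.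
have law C : measurable C -> P ((fun w => W t w - W s w) @^-1` C) =
    normal_prob 0 (Num.sqrt (t - s)) C by move=> mC; exact: brownian_law.
have mF : measurable_fun setT (fun x : R => (g (y + x) + M)%:E).
  apply/measurable_EFinP; apply: measurable_funD => //.
  by apply: measurable_lipf B0 lg _; exact: measurable_funD.
have F0 (x : R) : (0 <= (g (y + x) + M)%:E)%E by rewrite lee_fin gM_ge0.
exact: (@integral_law R d _ Omega (measurableTypeR R) P _
  (normal_prob 0 (Num.sqrt (t - s))) mX law _ mF F0).
Qed.

Let brvM (S : Omega -> R) : measurable_fun setT S ->
  bounded_rv (fun w => g (S w) + M).
Proof.
move=> mS; apply: bounded_rvD; last exact: bounded_rv_cst.
exact: bounded_rv_lipf B0 lg gM mS.
Qed.

Lemma heat_increment s t y : 0 <= s -> s <= t ->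
  Ex P (fun w => g (y + (W t w - W s w))) = heat (t - s) g y.
Proof.
move=> s0; rewrite le_eqVlt => /predU1P[<-|st].
  rewrite subrr heat0 -[RHS](Ex_cst P); apply: Ex_ext => w.
  by rewrite subrr addr0.
have mi : measurable_fun setT (fun w => y + (W t w - W s w)).
  by apply: measurable_funD => //; apply: measurable_funB; exact: brownian_measurable.
have mi0 : measurable_fun setT (fun w => y + (W (t - s) w - W 0 w)).
  by apply: measurable_funD => //; apply: measurable_funB; exact: brownian_measurable.
have h1 := heat_law_ge0 y s0 st.
have := @heat_law_ge0 0 (t - s) y (lexx _); rewrite subr_gt0 subr0 => /(_ st).
rewrite -h1 Ex_EFin; last exact: brvM.
rewrite Ex_EFin; last exact: brvM.
rewrite !ExD; [|by [exact: (bounded_rv_lipf B0 lg gM)|exact: bounded_rv_cst]..].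
rewrite !Ex_cst => -[] /addIr <-; apply: Ex_ext => w.
by rewrite brownian0 subr0.
Qed.

Lemma heat_taylor g1 g2 tau y : 0 <= tau -> smooth3 B g g1 g2 ->
  `|heat tau g y - g y - tau * g2 y / 2| <= 59 * B * Num.sqrt tau ^+ 3.
Proof.
rewrite le_eqVlt => /predU1P[<-|t0] sg.
  by rewrite heat0 subrr !mul0r subr0 normr0 mulr_ge0// ?mulr_ge0.
have st0 : 0 < Num.sqrt tau by rewrite sqrtr_gt0.
have hE : heat tau g y = nint (Num.sqrt tau) (fun x => g (y + x)).
  apply/EFin_inj; rewrite -(@integral_normal_prob _ (Num.sqrt tau) _ M)//; last first.
    by apply: measurable_lipf B0 lg _; exact: measurable_funD.
  have bN : bounded_rv (fun x : R => g (y + x)).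
    by apply: (bounded_rv_lipf B0 lg gM); exact: measurable_funD.
  rewrite (Ex_EFin (normal_prob 0 (Num.sqrt tau)) bN); congr EFin.
  apply: (addIr M); rewrite -[in LHS](Ex_cst P M) -[in RHS](Ex_cst (normal_prob 0 (Num.sqrt tau)) M).
  rewrite -!ExD//; try exact: bounded_rv_cst.
  apply/EFin_inj; rewrite -!Ex_EFin.
  - have := @heat_law_ge0 0 tau y (lexx _) t0; rewrite subr0 => <-.
    by apply: eq_integral => w _; rewrite brownian0 subr0.
  - by apply: bounded_rvD => //; exact: bounded_rv_cst.
  - by apply: bounded_rvD => //; exact: bounded_rv_cst.
rewrite hE; have := nint_taylor st0 y sg.
by rewrite sqr_sqrtr// ltW.
Qed.

(** [W (a + b)] is [W a] plus an independent increment with the law of [W b]; the joint law on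
    rectangles determines the product measure, and the double integral is iterated. *)
Lemma heat_semigroup a b y : 0 <= a -> 0 <= b ->
  heat (a + b) g y = heat a (heat b g) y.
Proof.
rewrite le_eqVlt => /predU1P[<-|a0]; first by rewrite add0r heat0.
rewrite le_eqVlt => /predU1P[<-|b0].
  by rewrite addr0; apply: Ex_ext => w; rewrite heat0.
pose Na := normal_prob 0 (Num.sqrt a); pose Nb := normal_prob 0 (Num.sqrt b).
have mi : measurable_fun setT (fun w => W (a + b) w - W a w).
  by apply: measurable_funB; exact: brownian_measurable.
have XN A D : measurable A -> measurable D ->
    P (W a @^-1` A `&` (fun w => W (a + b) w - W a w) @^-1` D) = (Na A * Nb D)%E.
  move=> mA mD.
  pose T (j : nat) : R := if j is j'.+1 then a + j'%:R * b else 0.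
  have := @brownian_increments T 2 (fun j => if j is 0%N then A else D).
  rewrite big_ord_recr big_ord1/= !mul0r !mul1r !addr0 subr0 => H.
  transitivity (P [set w | forall j, (j < 2)%N ->
     (if j is 0%N then A else D) (W (T j.+1) w - W (T j) w)]).
    congr (P _); apply/seteqP; split => w /=.
      move=> [wA wD] [|[|j]]//= _; rewrite ?mul0r ?addr0 ?mul1r//.
      by rewrite brownian0 subr0.
    move=> Hw; split.
      by have := Hw 0%N isT; rewrite /= mul0r addr0 brownian0 subr0.
    by have := Hw 1%N isT; rewrite /= mul0r addr0 mul1r.
  have T_lt j : T j < a + j%:R * b.
    by case: j => [|j]/=; rewrite ?mul0r ?addr0// ltrD2l ltr_pM2r// ltr_nat.
  have mAD j : measurable (match j with 0%N => A | _.+1 => D end) by case: j.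
  have ab : a + b - a = b by ring.
  by rewrite ab in H; exact: (H (lexx _) T_lt mAD).
have mF : measurable_fun setT (fun z : R * R => (g (y + z.1 + z.2) + M)%:E).
  apply/measurable_EFinP; apply: measurable_funD => //.
  apply: measurable_lipf B0 lg _; apply: measurable_funD => //.
  by apply: measurable_funD.
have Eab : (\int[P]_w (g (y + W a w + (W (a + b) w - W a w)) + M)%:E =
    \int[Na]_x \int[Nb]_z (g (y + x + z) + M)%:E)%E.
  have F0 (z : R * R) : (0 <= (g (y + z.1 + z.2) + M)%:E)%E by rewrite lee_fin gM_ge0.
  exact: (@integral_product_law R d _ _ Omega (measurableTypeR R) (measurableTypeR R)
    P (W a) (fun w => W (a + b) w - W a w) Na Nb (brownian_measurable a) mi XN
    (fun z => (g (y + z.1 + z.2) + M)%:E) mF F0).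
have Eb x : (\int[Nb]_z (g (x + z) + M)%:E)%E = (heat b g x + M)%:E.
  have := @heat_law_ge0 0 b x (lexx _) b0; rewrite subr0 -/Nb => <-.
  rewrite Ex_EFin; last first.
    apply: brvM; apply: measurable_funD => //.
    by apply: measurable_funB; exact: brownian_measurable.
  rewrite ExD ?Ex_cst; [| |exact: bounded_rv_cst]; last first.
    apply: (bounded_rv_lipf B0 lg gM); apply: measurable_funD => //.
    by apply: measurable_funB; exact: brownian_measurable.
  by congr (_ + _)%:E; apply: Ex_ext => w; rewrite brownian0 subr0.
have mab : measurable_fun setT (fun w => y + W a w + (W (a + b) w - W a w)).
  apply: measurable_funD; first by apply: measurable_funD => //; exact: brownian_measurable.
  by apply: measurable_funB; exact: brownian_measurable.
apply: (addIr M); rewrite -[in LHS](Ex_cst P M) -ExD//; last exact: bounded_rv_cst.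
apply/EFin_inj; transitivity (\int[P]_w (g (y + W a w + (W (a + b) w - W a w)) + M)%:E)%E.
  rewrite Ex_EFin; last exact: brvM.
  by congr EFin; apply: Ex_ext => w; rewrite -addrA subrKC.
rewrite Eab; under eq_integral do rewrite Eb.
have hM := heat_bound b; have hl := heat_lipf b.
transitivity (\int[P]_w (heat b g (y + W a w) + M)%:E)%E; last first.
  rewrite Ex_EFin; last first.
    apply: bounded_rvD; last exact: bounded_rv_cst.
    apply: (bounded_rv_lipf B0 hl hM); apply: measurable_funD => //.
    exact: brownian_measurable.
  rewrite ExD ?Ex_cst//; last exact: bounded_rv_cst.
  apply: (bounded_rv_lipf B0 hl hM); apply: measurable_funD => //.
  exact: brownian_measurable.
apply/esym; apply: (@integral_law R d _ Omega (measurableTypeR R) P (W a) Na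
   _ _ (fun x => (heat b g (y + x) + M)%:E)).
- exact: brownian_measurable.
- move=> C mC; have := @brownian_law 0 a C (lexx _) a0 mC; rewrite subr0 => h.
  transitivity (P ((fun w => W a w - W 0 w) @^-1` C)); last exact: h.
  by congr (P _); apply/seteqP; split => w /=; rewrite brownian0 subr0.
- apply/measurable_EFinP; apply: measurable_funD => //.
  by apply: measurable_lipf B0 hl _; exact: measurable_funD.
- move=> x; rewrite lee_fin; have := hM (y + x); rewrite ler_norml => /andP[].
  by lra.
Qed.

End BoundedLipschitz.

(** The Taylor estimate is averaged over translates, so the constant [B] survives. This keeps the
    error per exchanged increment uniform along the induction in [lindeberg]. *)
Lemma heat_smooth3 B g g1 g2 tau : smooth3 B g g1 g2 ->
  smooth3 B (heat tau g) (heat tau g1) (heat tau g2).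
Proof.
move=> [B0 bg [lg lg1 lg2] tg].
have b0 x : `|g x| <= B by have [] := bg x.
have b1 x : `|g1 x| <= B by have [] := bg x.
have b2 x : `|g2 x| <= B by have [] := bg x.
have mW y : measurable_fun setT (fun w => y + W tau w).
  by apply: measurable_funD => //; exact: brownian_measurable.
have r0 y := bounded_rv_lipf B0 lg b0 (mW y).
have r1 y := bounded_rv_lipf B0 lg1 b1 (mW y).
have r2 y := bounded_rv_lipf B0 lg2 b2 (mW y).
split => //.
- move=> x; split; [exact: heat_bound B0 lg b0 _ _|exact: heat_bound B0 lg1 b1 _ _|].
  exact: heat_bound B0 lg2 b2 _ _.
- split; [exact: heat_lipf B0 lg b0 _|exact: heat_lipf B0 lg1 b1 _|].
  exact: heat_lipf B0 lg2 b2 _.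
- move=> x h.
  rewrite (_ : heat tau g (x + h) - heat tau g x - heat tau g1 x * h -
      heat tau g2 x * h ^+ 2 / 2 = Ex P (fun w => g (x + h + W tau w)
        - g (x + W tau w) - h * g1 (x + W tau w) - h ^+ 2 / 2 * g2 (x + W tau w))).
    apply: normr_Ex_le.
      by do 3 (apply: bounded_rvB => //; try exact: bounded_rvZ).
    move=> w; have := tg (x + W tau w) h; congr (`|_| <= _).
    by rewrite [x + h + _]addrAC; ring.
  have z1 := bounded_rvZ h (r1 x); have z2 := bounded_rvZ (h ^+ 2 / 2) (r2 x).
  have s1 := bounded_rvB (r0 (x + h)) (r0 x); have s2 := bounded_rvB s1 z1.
  rewrite (ExB P s2 z2) (ExB P s1 z1) (ExB P (r0 (x + h)) (r0 x)).
  by rewrite (ExZ _ _ (r1 x)) (ExZ _ _ (r2 x)) /heat; ring.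
Qed.

(** By the semigroup property the difference is an average of [heat b g - g], to which the expansion
    in [b] applies. It turns convergence of variances into convergence of Gaussian means. *)
Lemma heat_time_continuous B g g1 g2 a b y : smooth3 B g g1 g2 ->
  0 <= a -> 0 <= b ->
  `|heat (a + b) g y - heat a g y| <= B * b + 59 * B * Num.sqrt b ^+ 3.
Proof.
move=> sg a0 b0; have [B0 bg [lg _ _] _] := sg.
have gB x : `|g x| <= B by have [] := bg x.
have mW : measurable_fun setT (fun w => y + W a w).
  by apply: measurable_funD => //; exact: brownian_measurable.
have hl := heat_lipf B0 lg gB b; have hb := heat_bound B0 lg gB b.
have r0 := bounded_rv_lipf B0 lg gB mW.
have r1 := bounded_rv_lipf B0 hl hb mW.
rewrite (heat_semigroup B0 lg gB)// /heat -/(heat _ _ _) -ExB//.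
apply: normr_Ex_le; first exact: bounded_rvB.
move=> w; rewrite -/(heat b g (y + W a w)).
have := heat_taylor B0 lg gB (y + W a w) b0 sg.
have : `|b * g2 (y + W a w) / 2| <= B * b.
  have [_ _ h2] := bg (y + W a w).
  move: h2; rewrite !ler_norml => /andP[? ?]; apply/andP; split; nra.
move: (59 * B * _) => c.
rewrite !ler_norml => /andP[? ?] /andP[? ?]; apply/andP; split; lra.
Qed.

(** * Independence of Brownian increments *)

Section IndependentIncrements.
Variable T : nat -> R.
Hypotheses (T0 : 0 <= T 0%N) (Tlt : forall j, T j < T j.+1).

Let S j w := W (T j.+1) w - W (T j) w.

Let mS j : measurable_fun setT (S j).
Proof. by apply: measurable_funB; exact: brownian_measurable. Qed.

Let Tge0 j : 0 <= T j.
Proof. by elim: j => // j IH; rewrite (le_trans IH)// ltW. Qed.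

Let mSC j C : measurable C -> measurable (S j @^-1` C).
Proof. by move=> mC; rewrite -[X in measurable X]setTI; exact: mS. Qed.

Let boxes j : set (set Omega) := [set A | exists2 C : nat -> set R,
  (forall i, measurable (C i)) &
  A = [set w | forall i, (i < j)%N -> C i (S i w)]].

Let boxes_measurable j : boxes j `<=` measurable.
Proof.
move=> _ [C mC ->].
rewrite (_ : [set w | _] = \big[setI/setT]_(i < j) (S i @^-1` C i)).
  by apply: bigsetI_measurable => i _; exact: mSC.
rewrite -(bigcap_mkord j (fun i => S i @^-1` C i)); apply/seteqP; split => w /= Hw i; exact: Hw.
Qed.

Let box_indep j A D : boxes j A -> measurable D ->
  P (A `&` S j @^-1` D) = (P A * P (S j @^-1` D))%E.
Proof.
move=> [C mC ->] mD.
rewrite [in RHS](brownian_increments _ T0 Tlt mC).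
rewrite (brownian_law (Tge0 j) (Tlt j) mD).
pose C' i := if (i < j)%N then C i else D.
have mC' i : measurable (C' i) by rewrite /C'; case: ifP.
have := brownian_increments j.+1 T0 Tlt mC'.
rewrite big_ord_recr/= {3}/C' ltnn.
rewrite (eq_bigr (fun i : 'I_j => normal_prob 0 (Num.sqrt (T i.+1 - T i)) (C i)));
  last by move=> i _; rewrite /C' ltn_ord.
move=> <-; congr (P _); apply/seteqP; split => w /=.
  move=> [wC wD] i; rewrite ltnS leq_eqVlt /C' => /predU1P[->|ij].
    by rewrite ltnn.
  by rewrite ij; exact: wC.
move=> Hw; split => [i ij|].
  by have := Hw i (ltnW ij); rewrite /C' ij.
by have := Hw j (leqnn _); rewrite /C' ltnn.
Qed.

(** Both sides are finite measures in [A] that agree on the boxes, a class stable under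
    intersection. *)
Let sigma_indep j A D : <<s boxes j >> A -> measurable D ->
  P (A `&` S j @^-1` D) = (P A * P (S j @^-1` D))%E.
Proof.
move=> sA mD.
have mE := mSC j mD.
have p0 : (0 <= fine (P (S j @^-1` D)))%R by rewrite fine_ge0.
rewrite (muleC (P A)) -[P (S j @^-1` D)]fineK; last by rewrite fin_num_measure.
pose c := NngNum p0.
rewrite -[LHS]/(mrestr P mE A) -[RHS]/(mscale c P A).
apply: (g_sigma_algebra_measure_unique (boxes j) (@boxes_measurable j) (fun=> setT))
  => //.
- by move=> _; exists (fun=> setT) => //; apply/seteqP; split.
- by apply/seteqP; split => // w _; exists 0%N.
- move=> _ _ [C mC ->] [C' mC' ->]; exists (fun i => C i `&` C' i).
    by move=> i; exact: measurableI.
  apply/seteqP; split => w /=; first by move=> [h h'] i ij; split; [exact: h|exact: h'].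
  by move=> h; split => i ij; have [] := h i ij.
- move=> B bB; rewrite /= /mrestr /mscale/= box_indep// muleC fineK//.
  by rewrite fin_num_measure.
- move=> _; rewrite /= /mrestr setTI.
  by rewrite (le_lt_trans (probability_le1 P mE))// ltry.
Qed.

(** Two passes of [Ex_orth]: the first replaces events of [U] by [U] itself against events of the
    increment [S j], the second replaces those events by the ramp. *)
Lemma brownian_indep j G (M L a h : R) : (forall x, `|G x| <= M) ->
  lip_coords j L G -> 0 < h ->
  Ex P (fun w => G (S ^~ w) * ramp a h (S j w)) =
  Ex P (fun w => G (S ^~ w)) * Ex P (fun w => ramp a h (S j w)).
Proof.
move=> GM lG h0.
pose U w := G (S ^~ w); pose V w := ramp a h (S j w).
have bU : bounded_rv U by exact: bounded_rv_lip GM lG mS.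
have bV : bounded_rv V by exact: bounded_rv_ramp.
have sU (B : set R) : measurable B -> <<s boxes j >> (U @^-1` B).
  move=> mB.
  have H : measurable_fun setT (fun w : g_sigma_algebraType (boxes j) => G (S ^~ w)).
    apply: (measurable_lip lG) => i ij _ C mC; rewrite setTI.
    apply: sub_sigma_algebra; exists (fun k => if k == i then C else setT).
      by move=> k; case: ifP.
    apply/seteqP; split => w /=; first by move=> wC k _; case: eqP => // ->.
    by move/(_ i ij); rewrite eqxx.
  by have := H measurableT B mB; rewrite setTI.
have mU (B : set R) : measurable B -> measurable (U @^-1` B).
  by move=> mB; rewrite -[X in measurable X]setTI; apply: (proj1 bU).
have UD D : measurable D -> Ex P (fun w => U w * \1_(S j @^-1` D) w) =
    Ex P U * fine (P (S j @^-1` D)).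
  move=> mD; set c := fine _; have mE := mSC j mD.
  have bD := bounded_rv_indic mE.
  have : Ex P (fun w => U w * (\1_(S j @^-1` D) w - c)) = 0.
    apply: Ex_orth => //; first by apply: bounded_rvB => //; exact: bounded_rv_cst.
    move=> B mB; have mUB := mU _ mB; have bB := bounded_rv_indic mUB.
    transitivity (Ex P (fun w => \1_(U @^-1` B `&` S j @^-1` D) w
        - c * \1_(U @^-1` B) w)).
      by apply: Ex_ext => w; rewrite indicI mulrBr [_ * c]mulrC.
    rewrite ExB; [|exact: bounded_rv_indic (measurableI _ _ (mU _ mB) mE)|exact: bounded_rvZ].
    rewrite ExZ// !Ex_indic//; last exact: measurableI.
    rewrite (sigma_indep (sU _ mB) mD) fineM ?fin_num_measure//.
    by rewrite mulrC subrr.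
  rewrite (Ex_ext P (g := fun w => U w * \1_(S j @^-1` D) w - c * U w)); last first.
    by move=> w; rewrite mulrBr [U w * c]mulrC.
  rewrite ExB; [|exact: bounded_rvM|exact: bounded_rvZ].
  by rewrite ExZ// => /eqP; rewrite subr_eq0 => /eqP ->; rewrite mulrC.
have : Ex P (fun w => V w * (U w - Ex P U)) = 0.
  apply: Ex_orth => //; first by apply: bounded_rvB => //; exact: bounded_rv_cst.
  move=> B mB.
  pose D := ramp a h @^-1` B.
  have mD : measurable D.
    have := proj1 (bounded_rv_ramp a h0 (@measurable_id _ R setT)).
    by move=> /(_ measurableT B mB); rewrite setTI.
  have mE := mSC j mD; have bD := bounded_rv_indic mE.
  transitivity (Ex P (fun w => U w * \1_(S j @^-1` D) w - Ex P U * \1_(S j @^-1` D) w)).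
    by apply: Ex_ext => w; rewrite mulrC mulrBl.
  rewrite ExB; [|exact: bounded_rvM|exact: bounded_rvZ].
  by rewrite ExZ// Ex_indic// UD// subrr.
rewrite (Ex_ext P (g := fun w => U w * V w - Ex P U * V w)); last first.
  by move=> w; rewrite mulrBr mulrC [V w * _]mulrC.
rewrite ExB; [|exact: bounded_rvM|exact: bounded_rvZ].
by rewrite ExZ// => /eqP; rewrite subr_eq0 => /eqP.
Qed.

End IndependentIncrements.

End BrownianMotion.

(** * Martingales with deterministically bounded increments *)

Section Adapted.
Context {R : realType} {d : measure_display} {Omega : measurableType d}.
Variable gen : nat -> set (set Omega).

(** Adaptedness is [bounded_rv] over the space that carries the generated sigma-algebra, so the
    closure lemmas for [bounded_rv] apply to it verbatim. *)
Definition badapted (k : nat) (U : Omega -> R) : Prop :=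
  @bounded_rv R _ (g_sigma_algebraType (gen k)) U.

Hypothesis genS : forall k, gen k `<=` gen k.+1.
Hypothesis genM : forall k, gen k `<=` measurable.

Lemma badapted_rv k U : badapted k U -> bounded_rv U.
Proof.
move=> [mU bU]; split => // _ B mB; rewrite setTI.
have : <<s gen k >> (U @^-1` B) by have := mU measurableT B mB; rewrite setTI.
by apply: smallest_sub; [exact: sigma_algebra_measurable|exact: genM].
Qed.

Lemma badapted_le k l U : (k <= l)%N -> badapted k U -> badapted l U.
Proof.
move=> kl [mU bU]; split => // _ B mB; rewrite setTI.
have : <<s gen k >> (U @^-1` B) by have := mU measurableT B mB; rewrite setTI.
apply: sub_smallest2r; first exact: smallest_sigma_algebra.
rewrite -(subnK kl); elim: (l - k)%N => [|n IH]; first by rewrite add0n.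
by rewrite addSn => A /IH; exact: genS.
Qed.

Lemma badapted_indic k (U : Omega -> R) (B : set R) : badapted k U ->
  measurable B -> badapted k (fun w => \1_B (U w)).
Proof.
move=> [mU bU] mB; split; last first.
  by exists 1 => w; rewrite indicE; case: (_ \in _); rewrite ?normr1 ?normr0.
exact: (measurableT_comp (measurable_indic mB) mU).
Qed.

Lemma badapted_lipf k (U : Omega -> R) (B M : R) (g : R -> R) : 0 <= B ->
  lipf B g -> (forall x, `|g x| <= M) -> badapted k U ->
  badapted k (fun w => g (U w)).
Proof. by move=> B0 lg gM [mU _]; exact: bounded_rv_lipf B0 lg gM mU. Qed.

End Adapted.

(** * Fourth moments and a maximal inequality *)

Section MartingaleIncrements.
Context {R : realType} {d : measure_display} {Omega : measurableType d}.
Variables (P : probability Omega R) (gen : nat -> set (set Omega)).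
Hypothesis genS : forall k, gen k `<=` gen k.+1.
Hypothesis genM : forall k, gen k `<=` measurable.
Variables (z : nat -> Omega -> R) (s : nat -> R).
Hypothesis s_ge0 : forall k, 0 <= s k.
Hypothesis z_adapted : forall k, badapted gen k.+1 (z k).
Hypothesis z_bound : forall k w, `|z k w| <= 2 * s k.
Hypothesis z_mart : forall k U, badapted gen k U -> Ex P (fun w => U w * z k w) = 0.
Implicit Types (k K : nat).

Definition psum k0 K w : R := \sum_(k0 <= k < K) z k w.

Lemma psumS k0 K w : (k0 <= K)%N -> psum k0 K.+1 w = psum k0 K w + z K w.
Proof. by move=> k0K; rewrite /psum big_nat_recr. Qed.

Lemma psum_adapted k0 K : badapted gen K (psum k0 K).
Proof.
have [Kk0|k0K] := leqP K k0.
  rewrite (_ : psum k0 K = fun=> 0); first exact: bounded_rv_cst.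
  by apply/funext => w; rewrite /psum big_geq.
move: k0K; elim: K => // K IH; rewrite ltnS leq_eqVlt => /predU1P[->|k0K].
  rewrite (_ : psum K K.+1 = z K) //.
  by apply/funext => w; rewrite /psum big_nat1.
rewrite (_ : psum k0 K.+1 = fun w => psum k0 K w + z K w).
  apply: bounded_rvD; last exact: z_adapted.
  exact: (badapted_le genS (leqnSn K) (IH k0K)).
by apply/funext => w; rewrite psumS// ltnW.
Qed.

Section Transform.
Variables (theta : nat -> Omega -> R) (k0 : nat).
Hypothesis theta_adapted : forall k, (k0 <= k)%N -> badapted gen k (theta k).
Hypothesis theta_bound : forall k w, `|theta k w| <= 1.

Let tsum n w : R := \sum_(i < n) theta (k0 + i)%N w * z (k0 + i)%N w.
Let e n : R := 4 * s (k0 + n)%N ^+ 2.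
Let v n : R := \sum_(i < n) e i.

Let e_ge0 n : 0 <= e n. Proof. by rewrite mulr_ge0// sqr_ge0. Qed.
Let v_ge0 n : 0 <= v n. Proof. by apply: sumr_ge0 => i _. Qed.

Let tsum_adapted n : badapted gen (k0 + n) (tsum n).
Proof.
elim: n => [|n IH].
  rewrite (_ : tsum 0 = fun=> 0); first exact: bounded_rv_cst.
  by apply/funext => w; rewrite /tsum big_ord0.
rewrite (_ : tsum n.+1 = fun w => tsum n w + theta (k0 + n)%N w * z (k0 + n)%N w).
  rewrite addnS; apply: bounded_rvD; first exact: (badapted_le genS (leqnSn _) IH).
  apply: bounded_rvM; last exact: z_adapted.
  by apply: (badapted_le genS (leqnSn _)); apply: theta_adapted; rewrite leq_addr.
by apply/funext => w; rewrite /tsum big_ord_recr.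
Qed.

Let x n w := theta (k0 + n)%N w * z (k0 + n)%N w.

Let x2 n w : x n w ^+ 2 <= e n.
Proof.
rewrite /e -(real_normK (num_real (x n w))) /x normrM.
rewrite (_ : 4 * s (k0 + n)%N ^+ 2 = (1 * (2 * s (k0 + n)%N)) ^+ 2); last by ring.
by rewrite lerXn2r ?nnegrE ?mulr_ge0// ler_pM.
Qed.

Let thetaK n : badapted gen (k0 + n) (theta (k0 + n)%N).
Proof. by apply: theta_adapted; rewrite leq_addr. Qed.

Let x_mart n U : badapted gen (k0 + n) U -> Ex P (fun w => U w * x n w) = 0.
Proof.
move=> aU; rewrite -(z_mart (bounded_rvM aU (thetaK n))).
by apply: Ex_ext => w; rewrite /x mulrA.
Qed.

Let tsumS n w : tsum n.+1 w = tsum n w + x n w.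
Proof. by rewrite /tsum big_ord_recr. Qed.

Let rv n : bounded_rv (tsum n). Proof. exact: (badapted_rv genM (tsum_adapted n)). Qed.
Let rx n : bounded_rv (x n).
Proof.
apply: bounded_rvM; first exact: (badapted_rv genM (thetaK n)).
exact: (badapted_rv genM (z_adapted _)).
Qed.

Let second n : Ex P (fun w => tsum n w ^+ 2) <= v n.
Proof.
elim: n => [|n IH].
  rewrite /v big_ord0 (_ : Ex _ _ = 0)// -[RHS](Ex_cst P).
  by apply: Ex_ext => w; rewrite /tsum big_ord0 expr0n.
have b1 := bounded_rvX 2 (rv n); have b2 := bounded_rvM (rv n) (rx n).
rewrite (@le_trans _ _ (Ex P (fun w => tsum n w ^+ 2 + 2 * (tsum n w * x n w) + e n)))//.
  apply: le_Ex; first exact: bounded_rvX.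
    apply: bounded_rvD; last exact: bounded_rv_cst.
    by apply: bounded_rvD => //; exact: bounded_rvZ.
  by move=> w; rewrite tsumS; have := x2 n w; move: (tsum n w) (x n w) (e n) => a b c; nra.
rewrite ExD; [|by apply: bounded_rvD => //; exact: bounded_rvZ|exact: bounded_rv_cst].
rewrite ExD//; last exact: bounded_rvZ.
rewrite ExZ// Ex_cst (x_mart (tsum_adapted n)) mulr0 addr0.
by rewrite /v big_ord_recr/= lerD2r.
Qed.

(** In the expansion of [(a + b)^4] the term [a^3 b] has mean 0, and [4 a b^3 <= 2 a^2 b^2 + 2 b^4].
    With [b^2 <= e] the bound [4 v^2] grows by at most [8 e v + 3 e^2], which is below
    [4 (v + e)^2 - 4 v^2]. *)
Lemma martingale_fourth_moment n :
  Ex P (fun w => (\sum_(i < n) theta (k0 + i)%N w * z (k0 + i)%N w) ^+ 4) <=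
  4 * (\sum_(i < n) 4 * s (k0 + i)%N ^+ 2) ^+ 2.
Proof.
change (Ex P (fun w => tsum n w ^+ 4) <= 4 * v n ^+ 2).
elim: n => [|n IH].
  rewrite /v big_ord0 expr0n mulr0 (_ : Ex _ _ = 0)// -[RHS](Ex_cst P).
  by apply: Ex_ext => w; rewrite /tsum big_ord0 expr0n.
have b4 := bounded_rvX 4 (rv n); have b2 := bounded_rvX 2 (rv n).
have a3 : badapted gen (k0 + n) (fun w => tsum n w ^+ 3).
  exact: (bounded_rvX 3 (tsum_adapted n)).
have b3 := bounded_rvM (badapted_rv genM a3) (rx n).
pose h w := tsum n w ^+ 4 + 4 * (tsum n w ^+ 3 * x n w)
   + 8 * e n * tsum n w ^+ 2 + 3 * e n ^+ 2.
have bh1 := bounded_rvD b4 (bounded_rvZ 4 b3).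
have bh2 := bounded_rvD bh1 (bounded_rvZ (8 * e n) b2).
have bh3 := bounded_rvD bh2 (bounded_rv_cst (3 * e n ^+ 2)).
rewrite (@le_trans _ _ (Ex P h))//.
  apply: le_Ex bh3 _; first exact: (bounded_rvX 4 (rv n.+1)).
  move=> w; rewrite tsumS; have := x2 n w; have := e_ge0 n.
  move: (tsum n w) (x n w) (e n) => a b c c0 bc.
  have h1 : b ^+ 2 * a ^+ 2 <= c * a ^+ 2 by rewrite ler_wpM2r// sqr_ge0.
  have h2 : b ^+ 4 <= c ^+ 2.
    by rewrite (_ : b ^+ 4 = (b ^+ 2) ^+ 2) ?lerXn2r ?nnegrE ?sqr_ge0// -exprM.
  have h3 : 4 * a * b ^+ 3 <= 2 * (a ^+ 2 * b ^+ 2) + 2 * b ^+ 4.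
    have := sqr_ge0 (a * b - b ^+ 2); nra.
  rewrite (_ : (a + b) ^+ 4 = a ^+ 4 + 4 * (a ^+ 3 * b) + 6 * (b ^+ 2 * a ^+ 2)
    + 4 * a * b ^+ 3 + b ^+ 4); last by ring.
  by nra.
rewrite /h (ExD P bh2 (bounded_rv_cst _)) (ExD P bh1 (bounded_rvZ _ b2)).
rewrite Ex_cst (ExD P b4 (bounded_rvZ _ b3)) (ExZ _ _ b3) (ExZ _ _ b2).
rewrite (x_mart a3) mulr0 addr0.
have := second n; have := e_ge0 n; have := v_ge0 n.
have -> : v n.+1 = v n + e n by rewrite /v big_ord_recr.
move: IH; move: (Ex P _) (Ex P _) (v n) (e n) => a b c f ac f0 c0 bc.
by nra.
Qed.

End Transform.

(** The predictable weights [theta] freeze the martingale once a partial sum reaches [lam]; a large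
    partial sum anywhere then leaves a large final value, and the Markov inequality for fourth
    powers applies. The bound is quadratic in the variance, so it stays small after summation over
    many short blocks. *)
Lemma martingale_maximal k0 n (lam : R) : 0 < lam -> exists A : set Omega,
  [/\ measurable A,
      fine (P A) <= 4 * (\sum_(i < n) 4 * s (k0 + i)%N ^+ 2) ^+ 2 / lam ^+ 4 &
      forall w, ~ A w -> forall i, (i <= n)%N -> `|psum k0 (k0 + i) w| < lam].
Proof.
move=> lam0.
pose B : set R := `]- lam, lam[%classic.
have mB : measurable B by exact: measurable_itv.
pose theta k w : R := \prod_(i < (k - k0).+1) \1_B (psum k0 (k0 + i) w).
have atheta k : (k0 <= k)%N -> badapted gen k (theta k).
  move=> k0k; rewrite /theta; rewrite -{1}(subnKC k0k).
  elim: (k - k0)%N => [|j IH].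
    under [X in badapted _ _ X]funext do rewrite big_ord1.
    by apply: badapted_indic => //; exact: psum_adapted.
  under [X in badapted _ _ X]funext do rewrite big_ord_recr.
  apply: bounded_rvM; last by apply: badapted_indic => //; exact: psum_adapted.
  by rewrite addnS; exact: (badapted_le genS (leqnSn _) IH).
have indB x : \1_B x = (`|x| < lam)%R%:R :> R.
  rewrite indicE; congr (_%:R); congr nat_of_bool; rewrite ltr_norml.
  by apply/idP/idP => [/set_mem|H]; [|apply/mem_set]; rewrite /B/= in_itv.
have theta01 k w : 0 <= theta k w <= 1.
  rewrite /theta; elim: (k - k0).+1 => [|j /andP[IH1 IH2]].
    by rewrite big_ord0 ler01 lexx.
  rewrite big_ord_recr/= indB; case: (_ < _) => /=; rewrite ?mulr1 ?mulr0 ?IH1//.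
  by rewrite lexx ler01.
have btheta k w : `|theta k w| <= 1.
  by have /andP[? ?] := theta01 k w; rewrite ger0_norm.
have thetaS j w : theta (k0 + j.+1)%N w =
    theta (k0 + j)%N w * (`|psum k0 (k0 + j.+1) w| < lam)%R%:R.
  by rewrite /theta !addKn big_ord_recr/= indB.
pose tsum j w : R := \sum_(i < j) theta (k0 + i)%N w * z (k0 + i)%N w.
(* Either no sum up to [j] has reached [lam] and the transform is still the original sum, or the
   transform is frozen at a value of modulus at least [lam]. *)
have dich j w : (theta (k0 + j)%N w = 1 /\ tsum j w = psum k0 (k0 + j) w) \/
    (theta (k0 + j)%N w = 0 /\ lam <= `|tsum j w|).
  elim: j => [|j [[th1 tj]|[th0 tj]]].
  - left; rewrite /theta addKn big_ord1 /tsum big_ord0 !addn0 /psum big_geq// indB.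
    by rewrite normr0 lam0.
  - have tS : tsum j.+1 w = psum k0 (k0 + j.+1) w.
      rewrite /tsum big_ord_recr/= -/(tsum j w) th1 mul1r tj addnS psumS//.
      exact: leq_addr.
    rewrite thetaS th1 mul1r tS; case: ltP => h; [by left|by right].
  - right; rewrite thetaS th0 mul0r; split => //.
    by rewrite /tsum big_ord_recr/= -/(tsum j w) th0 mul0r addr0.
have rv_t : bounded_rv (tsum n).
  apply: bounded_rv_sum => i; apply: bounded_rvM.
    by apply: (badapted_rv genM (k := (k0 + i)%N)); apply: atheta; rewrite leq_addr.
  exact: (badapted_rv genM (z_adapted _)).
pose A := [set w | lam <= `|tsum n w|].
have mA : measurable A.
  have [mn _] := bounded_rv_norm rv_t.
  have -> : A = (fun w => `|tsum n w|) @^-1` `[lam, +oo[%classic.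
    by apply/seteqP; split => w /=; rewrite in_itv/= andbT.
  by rewrite -[X in measurable X]setTI; exact: mn.
exists A; split => //.
  have l4 : 0 < lam ^+ 4 by rewrite exprn_gt0.
  rewrite ler_pdivlMr// mulrC -Ex_indic// -ExZ; last exact: bounded_rv_indic.
  have := martingale_fourth_moment atheta btheta n; apply: le_trans.
  apply: le_Ex.
  - by apply: bounded_rvZ; exact: bounded_rv_indic.
  - exact: bounded_rvX.
  move=> w; rewrite indicE; case: (boolP (w \in A)) => [/set_mem wA|_].
    rewrite mulr1 -[X in _ <= X]ger0_norm ?exprn_even_ge0// normrX.
    by rewrite lerXn2r ?nnegrE// ltW.
  by rewrite mulr0 exprn_even_ge0.
move=> w wA.
have th1 : theta (k0 + n)%N w = 1.
  by have [[]//|[_ h]] := dich n w; case: wA.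
suff H j : theta (k0 + j)%N w = 1 -> forall i, (i <= j)%N ->
    `|psum k0 (k0 + i) w| < lam by exact: H th1.
elim: j => [|j IH].
  move=> _ i; rewrite leqn0 => /eqP ->.
  by rewrite addn0 /psum big_geq// normr0.
rewrite thetaS => h i; rewrite leq_eqVlt => /predU1P[->|ij].
  by move: h; case: ltP => //; rewrite mulr0 => _ /eqP; rewrite eq_sym oner_eq0.
apply: IH => //; move: h; case: ltP; first by rewrite mulr1.
by rewrite mulr0 => _ /eqP; rewrite eq_sym oner_eq0.
Qed.

(** * Lindeberg replacement *)

Section Lindeberg.
Context {d' : measure_display} {Omega' : measurableType d'}.
Variables (P' : probability Omega' R) (W : R -> Omega' -> R).
Hypothesis bm : brownian_motion P' W.
Variables (om : nat -> Omega -> R) (omega : R).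
Hypothesis omega01 : 0 <= omega <= 1.
Hypothesis om_adapted : forall k, badapted gen k (om k).
Hypothesis z_var : forall k U, badapted gen k U ->
  Ex P (fun w => U w * z k w ^+ 2) = Ex P (fun w => U w * (s k ^+ 2 * om k w)).

Definition om_err k : R := Ex P (fun w => `|om k w - omega|).

(* Exchange of one martingale increment for a Gaussian of the same variance. *)
Lemma lindeberg_step k (f : R) (U S : Omega -> R) (MU B : R) g g1 g2 : 0 <= f ->
  badapted gen k U -> (forall w, `|U w| <= MU) -> badapted gen k S ->
  smooth3 B g g1 g2 ->
  `|Ex P (fun w => U w * g (S w + f * z k w)) -
    Ex P (fun w => U w * heat P' W ((f * s k) ^+ 2 * omega) g (S w))|
  <= MU * B * (67 * (f * s k) ^+ 3 + (f * s k) ^+ 2 * om_err k).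
Proof.
move=> f0 aU UM aS sg; have [B0 bg [lg lg1 lg2] tg] := sg.
have b0 y : `|g y| <= B by have [] := bg y.
have b1 y : `|g1 y| <= B by have [] := bg y.
have b2 y : `|g2 y| <= B by have [] := bg y.
have /andP[om0 om1] := omega01.
set c := f * s k; have c0 : 0 <= c by rewrite mulr_ge0.
have MU0 : 0 <= MU := le_trans (normr_ge0 _) (UM point).
set tau := c ^+ 2 * omega; have tau0 : 0 <= tau by rewrite mulr_ge0 ?sqr_ge0.
have stau : Num.sqrt tau ^+ 3 <= c ^+ 3.
  rewrite lerXn2r ?nnegrE ?sqrtr_ge0// -[leRHS]ger0_norm// -sqrtr_sqr.
  by apply: ler_wsqrtr; rewrite /tau ler_piMr ?sqr_ge0.
have zk := badapted_rv genM (z_adapted k).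
have rU := badapted_rv genM aU; have rS := badapted_rv genM aS.
have rSz : bounded_rv (fun w => S w + f * z k w).
  by apply: bounded_rvD => //; exact: bounded_rvZ.
have a1 : badapted gen k (fun w => U w * g1 (S w)).
  by apply: bounded_rvM => //; exact: badapted_lipf B0 lg1 b1 aS.
have a2 : badapted gen k (fun w => U w * g2 (S w)).
  by apply: bounded_rvM => //; exact: badapted_lipf B0 lg2 b2 aS.
have r1 := badapted_rv genM a1; have r2 := badapted_rv genM a2.
have rg : bounded_rv (fun w => U w * g (S w)).
  by apply: bounded_rvM => //; exact: bounded_rv_lipf B0 lg b0 (proj1 rS).
have rgz : bounded_rv (fun w => U w * g (S w + f * z k w)).
  by apply: bounded_rvM => //; exact: bounded_rv_lipf B0 lg b0 (proj1 rSz).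
have hl := heat_lipf bm B0 lg b0 tau; have hb := heat_bound bm B0 lg b0 tau.
have rh : bounded_rv (fun w => U w * heat P' W tau g (S w)).
  by apply: bounded_rvM => //; exact: bounded_rv_lipf B0 hl hb (proj1 rS).
have rom := badapted_rv genM (om_adapted k).
have rom' : bounded_rv (fun w => om k w - omega).
  by apply: bounded_rvB => //; exact: bounded_rv_cst.
have rz2 := bounded_rvX 2 zk.
pose T1 w := U w * g1 (S w) * z k w.
pose T2 w := U w * g2 (S w) * z k w ^+ 2.
pose T3 w := U w * g2 (S w) * om k w.
have rT1 : bounded_rv T1 by exact: bounded_rvM.
have rT2 : bounded_rv T2 by exact: bounded_rvM.
have rT3 : bounded_rv T3 by exact: bounded_rvM.
have E1 : Ex P T1 = 0 by exact: z_mart.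
have E2 : Ex P T2 = s k ^+ 2 * Ex P T3.
  rewrite /T2 (z_var a2) -ExZ//; apply: Ex_ext => w.
  by rewrite /T3; ring.
(* In the mean the last three terms contribute nothing: [T1] by [z_mart], [T2] against [T3] by
   [z_var]. Pointwise they turn the difference into Taylor remainders plus the error in the
   variance. *)
pose D w := U w * g (S w + f * z k w) - U w * heat P' W tau g (S w)
   - f * T1 w - f ^+ 2 / 2 * T2 w + c ^+ 2 / 2 * T3 w.
have q1 := bounded_rvB rgz rh; have q2 := bounded_rvB q1 (bounded_rvZ f rT1).
have q3 := bounded_rvB q2 (bounded_rvZ (f ^+ 2 / 2) rT2).
have rD : bounded_rv D by exact: (bounded_rvD q3 (bounded_rvZ (c ^+ 2 / 2) rT3)).
have ED : Ex P D = Ex P (fun w => U w * g (S w + f * z k w)) -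
    Ex P (fun w => U w * heat P' W tau g (S w)).
  rewrite /D (ExD P q3 (bounded_rvZ _ rT3)) (ExB P q2 (bounded_rvZ _ rT2)).
  rewrite (ExB P q1 (bounded_rvZ _ rT1)) (ExB P rgz rh) !ExZ// E1 E2 /c.
  by rewrite exprMn; ring.
rewrite -ED (le_trans (normr_Ex P rD))//.
have rE := bounded_rvZ (c ^+ 2) (bounded_rv_norm rom').
rewrite (@le_trans _ _ (Ex P (fun w => MU * B * (67 * c ^+ 3 + c ^+ 2 * `|om k w - omega|))))//.
  apply: le_Ex; first exact: bounded_rv_norm.
    by apply: bounded_rvZ; apply: bounded_rvD => //; exact: bounded_rv_cst.
  move=> w.
  have DE : D w = U w * ((g (S w + f * z k w) - g (S w) - g1 (S w) * (f * z k w)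
      - g2 (S w) * (f * z k w) ^+ 2 / 2)
    - (heat P' W tau g (S w) - g (S w) - tau * g2 (S w) / 2)
    + c ^+ 2 / 2 * g2 (S w) * (om k w - omega)).
    by rewrite /D /T1 /T2 /T3 /tau; field.
  rewrite DE normrM -[leRHS]mulrA ler_pM//.
  have t1 := tg (S w) (f * z k w).
  have t2 := heat_taylor bm B0 lg b0 (S w) tau0 sg.
  have fz : `|f * z k w| ^+ 3 <= 8 * c ^+ 3.
    rewrite (_ : 8 * c ^+ 3 = (f * (2 * s k)) ^+ 3); last by rewrite /c; ring.
    rewrite lerXn2r ?nnegrE ?mulr_ge0// normrM (ger0_norm f0).
    by rewrite ler_wpM2l// z_bound.
  have t3 : `|c ^+ 2 / 2 * g2 (S w) * (om k w - omega)| <=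
      B * (c ^+ 2 * `|om k w - omega|).
    rewrite normrM mulrA ler_wpM2r// normrM mulrC ler_pM//.
    by rewrite ger0_norm ?divr_ge0 ?sqr_ge0// ler_pdivrMr// ler_peMr ?sqr_ge0// ler1n.
  rewrite [leRHS]mulrDr (le_trans (ler_normD _ _))// lerD//.
  rewrite (le_trans (ler_normB _ _))//.
  have u1 : B * `|f * z k w| ^+ 3 <= B * (8 * c ^+ 3) by rewrite ler_wpM2l.
  have u2 : 59 * B * Num.sqrt tau ^+ 3 <= 59 * B * c ^+ 3 by rewrite ler_wpM2l// mulr_ge0.
  (* 67 is 8, from the cube of [|f z_k| <= 2 f s_k], plus 59 from [heat_taylor]. *)
  rewrite (_ : B * (67 * c ^+ 3) = B * (8 * c ^+ 3) + 59 * B * c ^+ 3); last by ring.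
  by rewrite lerD// ?(le_trans t1) ?(le_trans t2).
rewrite ExZ; last by apply: bounded_rvD => //; exact: bounded_rv_cst.
rewrite (ExD P (bounded_rv_cst _) rE) Ex_cst ExZ//.
exact: bounded_rv_norm.
Qed.

(** The last increment is exchanged first: this turns [g] into its heat average, which is smooth
    with the same constant, and the induction hypothesis applies to that. The factor [U], known at
    time [k0], makes the estimate one of approximate independence from the past. *)
Lemma lindeberg k0 n (f : R) (U : Omega -> R) (MU B : R) g g1 g2 : 0 <= f ->
  badapted gen k0 U -> (forall w, `|U w| <= MU) -> smooth3 B g g1 g2 ->
  `|Ex P (fun w => U w * g (f * psum k0 (k0 + n) w)) -
    Ex P U * heat P' W (\sum_(i < n) (f * s (k0 + i)%N) ^+ 2 * omega) g 0|
  <= MU * B * \sum_(i < n) (67 * (f * s (k0 + i)%N) ^+ 3 +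
                 (f * s (k0 + i)%N) ^+ 2 * om_err (k0 + i)%N).
Proof.
move=> f0 aU UM; have rU := badapted_rv genM aU.
elim: n g g1 g2 => [|n IH] g g1 g2 sg.
  rewrite !big_ord0 mulr0 (heat0 bm) addn0.
  rewrite (Ex_ext P (g := fun w => g 0 * U w)); last first.
    by move=> w; rewrite /psum big_geq// mulr0 mulrC.
  by rewrite ExZ// mulrC subrr normr0.
have [B0 bg [lg _ _] _] := sg; have b0 y : `|g y| <= B by have [] := bg y.
have /andP[om0 om1] := omega01.
rewrite !big_ord_recr/=; set tau := (f * s (k0 + n)%N) ^+ 2 * omega.
have tau0 : 0 <= tau by rewrite mulr_ge0 ?sqr_ge0.
have sum0 : 0 <= \sum_(i < n) (f * s (k0 + i)%N) ^+ 2 * omega.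
  by apply: sumr_ge0 => i _; rewrite mulr_ge0 ?sqr_ge0.
rewrite (heat_semigroup bm B0 lg b0)//.
have IHn := IH _ _ _ (heat_smooth3 bm tau sg).
have aU' : badapted gen (k0 + n) U by exact: (badapted_le genS (leq_addr _ _) aU).
have aS : badapted gen (k0 + n) (fun w => f * psum k0 (k0 + n) w).
  by apply: bounded_rvZ; exact: psum_adapted.
have := lindeberg_step f0 aU' UM aS sg; rewrite -/tau => step.
have -> : Ex P (fun w => U w * g (f * psum k0 (k0 + n.+1) w)) =
    Ex P (fun w => U w * g (f * psum k0 (k0 + n) w + f * z (k0 + n)%N w)).
  by apply: Ex_ext => w; rewrite addnS psumS ?leq_addr// mulrDr.
rewrite [leRHS]mulrDr addrC.
move: step IHn; set X1 := Ex P _; set X2 := Ex P _; set X3 := _ * heat _ _ _ _ _.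
move=> h1 h2; rewrite [- X3 + _]addrC -[X1 - X3](subrKA X2) [leRHS]addrC.
by rewrite (le_trans (ler_normD _ _))// lerD.
Qed.

End Lindeberg.

End MartingaleIncrements.

(** * Uniform continuity of continuous paths *)

Section UniformContinuity.
Context {R : realType}.

Lemma cvg_seq_dist0 (u : nat -> R) (l : R) : u @ \oo --> l ->
  (fun n => `|u n - l|) @ \oo --> (0 : R).
Proof.
move=> /cvg_seqP ul; apply/cvg_seqP => e e0; have [n0 H] := ul _ e0.
by exists n0 => n n0n; rewrite subr0 normr_id; exact: H.
Qed.

Lemma within_continuous_dist (y : R -> R) (x e : R) :
  {within `[0, +oo[%classic, continuous y} -> 0 <= x -> 0 < e ->
  exists2 eta : R, 0 < eta & forall t : R, 0 <= t -> `|x - t| < eta ->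
    `|y x - y t| <= e.
Proof.
move=> /subspace_continuousP cy x0 e0.
have xin : `[0, +oo[%classic x by rewrite /= in_itv/= x0.
have /cvgrPdist_le/(_ _ e0) [eta eta0 H] := cy x xin.
exists eta => // t t0 xt; apply: H => //=.
by rewrite in_itv/= t0.
Qed.

Lemma heine (y : R -> R) (b e : R) :
  {within `[0, +oo[%classic, continuous y} -> 0 < e ->
  exists2 delta : R, 0 < delta & forall s t : R, 0 <= s <= b -> 0 <= t ->
    `|s - t| < delta -> `|y s - y t| <= e.
Proof.
move=> cy e0.
have /compact_near_coveringP H := @segment_compact R 0 b.
pose Q (delta x : R) := 0 <= x -> forall t : R, 0 <= t -> `|x - t| < delta ->
  `|y x - y t| <= e.
have := H R (0^'+) Q _; case.
  move=> x /=; rewrite in_itv/= => /andP[x0 xb].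
  have e20 : 0 < e / 2 by rewrite divr_gt0.
  have [eta eta0 Heta] := within_continuous_dist cy x0 e20.
  have h20 : 0 < eta / 2 by rewrite divr_gt0.
  near=> x' delta => /= x'0 t t0 x't.
  have xx' : `|x - x'| < eta / 2.
    near: x'; apply/nbhs_ballP; exists (eta / 2) => //.
  have de : delta < eta / 2 by near: delta; exact: nbhs_right_lt.
  have h1 := Heta x' x'0; have h2 := Heta t t0.
  have xt : `|x - t| < eta.
    rewrite (le_lt_trans (ler_distD x' _ _))//.
    by move: xx' x't de; lra.
  have {}h1 := h1 _; have {}h2 := h2 xt.
  rewrite (le_trans (ler_distD (y x) _ _))// distrC.
  have : `|y x - y x'| <= e / 2 by apply: h1; lra.
  by move: h2; lra.
move=> delta /= delta0 Hd.
exists (delta / 2); first by rewrite divr_gt0.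
move=> s t /andP[s0 sb] t0 st.
have := Hd (delta / 2).
rewrite /= sub0r normrN gtr0_norm ?divr_gt0// => /(_ _ _ s _ s0 t t0 st); apply.
- by lra.
- by [].
- by rewrite /= in_itv/= s0.
Unshelve. all: by end_near.
Qed.

End UniformContinuity.

(** * Functional central limit theorem *)

Section FunctionalCLT.
Context {R : realType} {d d' : measure_display}.
Context {Omega : measurableType d} {Omega' : measurableType d'}.
Variables (P : probability Omega R) (gen : nat -> set (set Omega)).
Hypothesis genS : forall k, gen k `<=` gen k.+1.
Hypothesis genM : forall k, gen k `<=` measurable.
Variables (z : nat -> Omega -> R) (s : nat -> R).
Hypothesis s_ge0 : forall k, 0 <= s k.
Hypothesis z_adapted : forall k, badapted gen k.+1 (z k).
Hypothesis z_bound : forall k w, `|z k w| <= 2 * s k.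
Hypothesis z_mart : forall k U, badapted gen k U -> Ex P (fun w => U w * z k w) = 0.
Variables (P' : probability Omega' R) (W : R -> Omega' -> R).
Hypothesis bm : brownian_motion P' W.
Variables (om : nat -> Omega -> R) (omega : R).
Hypothesis omega01 : 0 <= omega <= 1.
Hypothesis om_adapted : forall k, badapted gen k (om k).
Hypothesis z_var : forall k U, badapted gen k U ->
  Ex P (fun w => U w * z k w ^+ 2) = Ex P (fun w => U w * (s k ^+ 2 * om k w)).
Hypothesis om_err_le : forall k, om_err P om omega k <= 2.
Hypothesis om_err_cvg : (fun k => om_err P om omega k) @ \oo --> (0 : R).

Variables (f : nat -> R) (m : nat -> R -> nat) (v : R -> R).
Variable X : nat -> Omega -> R -> R.
Hypothesis f_ge0 : forall n, 0 <= f n.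
Hypothesis m_mono : forall n (a b : R), 0 <= a -> a <= b -> (m n a <= m n b)%N.
Hypothesis var_cvg : forall t : R, 0 <= t ->
  (fun n => \sum_(0 <= k < m n t) (f n * s k) ^+ 2) @ \oo --> v t.
Hypothesis max_cvg : forall T e : R, 0 <= T -> 0 < e -> exists n0, forall n,
  (n0 <= n)%N -> forall k, (k < m n T)%N -> f n * s k <= e.
Hypothesis X_approx : forall T lam e : R, 0 <= T -> 0 < lam -> 0 < e ->
  exists n0, forall n, (n0 <= n)%N -> forall w,
  (forall k, (k <= m n T)%N -> `|f n * psum z 0 k w| <= lam) ->
  forall t, 0 <= t -> t <= T -> `|X n w t - f n * psum z 0 (m n t) w| <= e.
Hypothesis v_modulus : forall T e : R, 0 <= T -> 0 < e -> exists2 delta : R,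
  0 < delta & forall a b : R, 0 <= a -> a <= b -> b <= T -> b - a <= delta ->
    v b - v a <= e.
Hypothesis V_cases : (forall t : R, 0 <= t -> omega * v t = 0) \/
  (0 < omega * v 0 /\ forall a b : R, 0 <= a -> a < b -> omega * v a < omega * v b).

Implicit Types (t a b e lam : R).

Let omega_ge0 : 0 <= omega. Proof. by have /andP[] := omega01. Qed.

Let qvar n k K : R := \sum_(k <= i < K) (f n * s i) ^+ 2.

Let qvar_ge0 n k K : 0 <= qvar n k K.
Proof. by apply: sumr_ge0 => i _; exact: sqr_ge0. Qed.

Let qvar_cat n k l K : (k <= l)%N -> (l <= K)%N ->
  qvar n k K = qvar n k l + qvar n l K.
Proof. by move=> kl lK; rewrite /qvar (big_cat_nat kl lK). Qed.

Let v_mono a b : 0 <= a -> a <= b -> v a <= v b.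
Proof.
move=> a0 ab; have b0 := le_trans a0 ab.
apply: ler_cvg_to (var_cvg a0) (var_cvg b0) _; apply: nearW => n.
rewrite -/(qvar n 0 (m n a)) -/(qvar n 0 (m n b)).
by rewrite (qvar_cat n (leq0n _) (m_mono n a0 ab)) lerDl.
Qed.

Let v_ge0 t : 0 <= t -> 0 <= v t.
Proof.
move=> t0; have /cvg_lim <-// := var_cvg t0.
apply: limr_ge; first by apply/cvg_ex; exists (v t); exact: var_cvg.
by apply: nearW => n; exact: qvar_ge0.
Qed.

Let qvar_cvg a b : 0 <= a -> a <= b ->
  (fun n => qvar n (m n a) (m n b)) @ \oo --> v b - v a.
Proof.
move=> a0 ab; have b0 := le_trans a0 ab.
apply: (cvg_seq_eq _ _ (cvg_seqB (var_cvg b0) (var_cvg a0))) => // n.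
rewrite -/(qvar n 0 (m n a)) -/(qvar n 0 (m n b)).
by rewrite (qvar_cat n (leq0n _) (m_mono n a0 ab)) addrAC subrr add0r.
Qed.

Let sum_shift (F : nat -> R) k n :
  \sum_(i < n) F (k + i)%N = \sum_(k <= i < k + n) F i.
Proof.
elim: n => [|n IH]; first by rewrite big_ord0 addn0 big_geq.
by rewrite big_ord_recr/= IH addnS big_nat_recr//= leq_addr.
Qed.

(** 64 is [4 * 4^2] from [martingale_maximal]. The level there is [lam / f n], whence the separate
    case [f n = 0]. *)
Lemma scaled_maximal n k0 k1 lam : (k0 <= k1)%N -> 0 < lam ->
  exists A : set Omega,
  [/\ measurable A, fine (P A) <= 64 * qvar n k0 k1 ^+ 2 / lam ^+ 4 &
      forall w, ~ A w -> forall k, (k0 <= k)%N -> (k <= k1)%N ->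
        `|f n * psum z k0 k w| <= lam].
Proof.
move=> k01 lam0; have := f_ge0 n; rewrite le_eqVlt => /predU1P[f0|f0].
  exists set0; split => //.
    by rewrite measure0/= divr_ge0 ?mulr_ge0 ?exprn_ge0 ?(ltW lam0)// sqr_ge0.
  by move=> w _ k _ _; rewrite -f0 mul0r normr0 ltW.
have lf : 0 < lam / f n by rewrite divr_gt0.
have [A [mA PA HA]] := martingale_maximal genS genM s_ge0 z_adapted z_bound z_mart
  k0 (k1 - k0)%N lf.
exists A; split => //.
  rewrite (le_trans PA)// le_eqVlt; apply/orP; left; apply/eqP.
  rewrite (sum_shift (fun i => 4 * s i ^+ 2)) subnKC//.
  rewrite -mulr_sumr /qvar.
  have -> : \sum_(k0 <= i < k1) (f n * s i) ^+ 2 = f n ^+ 2 * \sum_(k0 <= i < k1) s i ^+ 2.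
    by rewrite mulr_sumr; apply: eq_bigr => i _; rewrite exprMn.
  by field; rewrite ?gt_eqF.
move=> w wA k k0k kk1; have := HA w wA (k - k0)%N.
rewrite subnKC// leq_sub2r// => /(_ isT) h.
by rewrite normrM gtr0_norm// mulrC -ler_pdivlMr// ltW.
Qed.

Let rem n k K : R := \sum_(k <= i < K) (67 * (f n * s i) ^+ 3 +
   (f n * s i) ^+ 2 * om_err P om omega i).

Let om_err_ge0 k : 0 <= om_err P om omega k.
Proof. by apply: Ex_ge0 => w. Qed.

Let fs_ge0 n k : 0 <= f n * s k. Proof. by rewrite mulr_ge0. Qed.

Let rem_term_ge0 n i : 0 <= 67 * (f n * s i) ^+ 3 +
   (f n * s i) ^+ 2 * om_err P om omega i.
Proof. by rewrite addr_ge0// mulr_ge0// ?exprn_ge0// sqr_ge0. Qed.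

Let rem_le n k K K' : (k <= K)%N -> (K <= K')%N -> rem n k K <= rem n 0 K'.
Proof.
move=> kK KK'; rewrite /rem [leRHS](@big_cat_nat _ _ _ K)//=.
rewrite [X in _ <= X + _](@big_cat_nat _ _ _ k)//=.
rewrite (@le_trans _ _ (\sum_(0 <= i < k) (67 * (f n * s i) ^+ 3 +
   (f n * s i) ^+ 2 * om_err P om omega i) + rem n k K))//.
  by rewrite lerDr sumr_ge0.
by rewrite lerDl sumr_ge0.
Qed.

Let rem_ge0 n k K : 0 <= rem n k K.
Proof. by apply: sumr_ge0. Qed.

(** The cubes are at most the largest [f n s_k] times the variance. In the other terms [om_err] is
    small from some [k0] on, and the [k0] early ones vanish because each [f n s_k] does. *)
Let rem_cvg t : 0 <= t -> (fun n => rem n 0 (m n t)) @ \oo --> (0 : R).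
Proof.
move=> t0; apply/cvg_seqP => e e0.
pose C := v t + 1; have C0 : 0 < C by rewrite ltr_wpDl// v_ge0.
pose e1 := e / (3 * C); have e10 : 0 < e1 by rewrite divr_gt0// mulr_gt0.
have /cvg_seqP/(_ _ e10)[k0 Hk0] := om_err_cvg.
(* The entry 1 keeps squares below [e2], [e1 / 67] treats the cubes, and the last entry bounds the
   extra [2 e2] of each of the [k0] early terms by [e / 3] in total. *)
pose e2 := Num.min 1 (Num.min (e1 / 67) (e / (6 * k0.+1%:R))).
have e20 : 0 < e2.
  by rewrite !lt_min ltr01/= !divr_gt0// mulr_gt0// ltr0n.
have [n1 Hn1] := max_cvg t0 e20.
have /cvg_seqP/(_ _ ltr01)[n2 Hn2] := var_cvg t0.
exists (maxn n1 n2) => n; rewrite geq_max => /andP[n1n n2n].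
rewrite subr0 ger0_norm//.
have qC : qvar n 0 (m n t) <= C.
  by have := Hn2 _ n2n; rewrite ler_norml => /andP[_]; rewrite /qvar /C; lra.
have e2_1 : e2 <= 1 by rewrite ge_min lexx.
have e2_2 : 67 * e2 <= e1.
  have : e2 <= e1 / 67 by rewrite !ge_min lexx !orbT.
  by rewrite ler_pdivlMr// mulrC.
have e2_3 : e2 <= e / (6 * k0.+1%:R) by rewrite !ge_min lexx !orbT.
have term i : (i < m n t)%N -> 67 * (f n * s i) ^+ 3 +
    (f n * s i) ^+ 2 * om_err P om omega i <=
    2 * e1 * (f n * s i) ^+ 2 + (if (i < k0)%N then 2 * e2 else 0).
  move=> im; have h := Hn1 _ n1n _ im; have h0 := fs_ge0 n i.
  have q0 := sqr_ge0 (f n * s i).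
  have c3 : 67 * (f n * s i) ^+ 3 <= e1 * (f n * s i) ^+ 2.
    rewrite exprS mulrA ler_wpM2r//.
    by rewrite (le_trans _ e2_2)// ler_wpM2l.
  case: ltnP => ik0.
    have : (f n * s i) ^+ 2 <= e2.
      by rewrite expr2 (le_trans (ler_piMl h0 (le_trans h e2_1))).
    have := om_err_le i; have := om_err_ge0 i.
    move: c3 q0 e10; move: (om_err _ _ _ _) ((f n * s i) ^+ 2) ((f n * s i) ^+ 3).
    by move=> x y u c3 q0 e10 x0 x2 ye; nra.
  have := Hk0 _ ik0; rewrite subr0 ger0_norm// => he.
  have : (f n * s i) ^+ 2 * om_err P om omega i <= (f n * s i) ^+ 2 * e1.
    by rewrite ler_wpM2l.
  by move: c3; lra.
rewrite /rem big_nat (le_trans (ler_sum _ (fun i (hi : (0 <= i < m n t)%N) => term i _)))//.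
rewrite -big_nat big_split/= -mulr_sumr -/(qvar n 0 (m n t)).
have cnt : \sum_(0 <= i < m n t) (if (i < k0)%N then 2 * e2 else 0) <= 2 * e2 * k0%:R.
  rewrite -big_mkcond/=.
  rewrite (@le_trans _ _ (\sum_(0 <= i < k0) 2 * e2))//; last first.
    by rewrite big_const_nat subn0 iter_addr_0 mulr_natr.
  have e2p : 0 <= 2 * e2 by rewrite mulr_ge0// ltW.
  have [mk|km] := leqP (m n t) k0.
    rewrite [leRHS](@big_cat_nat _ _ _ (m n t))//= big_mkcond/=.
    rewrite -[leLHS]addr0 lerD//; last by apply: sumr_ge0.
    by apply: ler_sum => i _; case: ifP.
  rewrite (@big_cat_nat _ _ _ k0)//=; last exact: ltnW.
  rewrite [X in _ + X]big_nat_cond [X in _ + X]big1 ?addr0; last first.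
    by move=> i /andP[/andP[k0i _]]; rewrite ltnNge k0i.
  by rewrite big_mkcond/=; apply: ler_sum => i _; case: ifP.
have c1 : 2 * e1 * qvar n 0 (m n t) <= 2 * (e / 3).
  rewrite -mulrA ler_wpM2l// (@le_trans _ _ (e1 * C))//; first by rewrite ler_wpM2l// ltW.
  rewrite le_eqVlt; apply/orP; left; apply/eqP; rewrite /e1.
  by field; rewrite ?gt_eqF.
have c2 : 2 * e2 * k0%:R <= e / 3.
  rewrite (@le_trans _ _ (2 * (e / (6 * k0.+1%:R)) * k0.+1%:R))//.
    rewrite ler_pM// ?mulr_ge0// ?(ltW e20)//; last by rewrite ler_nat.
    by rewrite ler_wpM2l.
  rewrite le_eqVlt; apply/orP; left; apply/eqP.
  have : k0.+1%:R != 0 :> R by rewrite pnatr_eq0.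
  by move: (k0.+1%:R) => q q0; field.
by move: cnt; lra.
Qed.

(** * Approximation on a time grid *)

Section Grid.
Variable K : nat.

Let tau (j : nat) : R := j%:R / K.+1%:R.
(** The cap ends the grid of mesh [1 / (K + 1)] at time [K + 1], so that a grid path has finitely
    many coordinates. *)
Let cut (t : R) : nat := minn (Num.truncn (t * K.+1%:R)) (K.+1 * K.+1).

Definition grid_path (x : nat -> R) (t : R) : R := \sum_(j < (cut t).+1) x j.

(** Coordinate 0 is the whole history up to [m n 0]: the martingale need not vanish at rescaled time
    0, and its value there produces the variance [v 0]. Accordingly [grid_time] starts at 0 and is
    shifted by one. *)
Definition grid_incr n (j : nat) (w : Omega) : R :=
  if j is j'.+1 then f n * psum z (m n (tau j')) (m n (tau j)) w
  else f n * psum z 0 (m n 0) w.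

Definition grid_time (j : nat) : R := if j is j'.+1 then omega * v (tau j') else 0.

Definition grid_brown (j : nat) (w : Omega') : R :=
  W (grid_time j.+1) w - W (grid_time j) w.

Let K0 : 0 < (K.+1%:R : R). Proof. by rewrite ltr0n. Qed.

Let tau_ge0 j : 0 <= tau j. Proof. by rewrite divr_ge0. Qed.
Let tauS j : tau j <= tau j.+1.
Proof. by rewrite ler_pM2r ?invr_gt0// ler_nat. Qed.
Let tau0 : tau 0 = 0. Proof. by rewrite /tau mul0r. Qed.

Lemma grid_path_lip x y : ldist (grid_path x) (grid_path y) <=
  \sum_(j < (K.+1 * K.+1).+1) `|x j - y j|.
Proof.
apply: ldist_lip => [|t t0]; first by apply: sumr_ge0.
rewrite /grid_path -sumrB (le_trans (ler_norm_sum _ _ _))//.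
rewrite -!(big_mkord xpredT (fun j => `|x j - y j|)).
rewrite [leRHS](@big_cat_nat _ _ _ (cut t).+1)//= ?lerDl ?sumr_ge0//.
by rewrite ltnS geq_minr.
Qed.

Lemma grid_path_incr n w t : grid_path (grid_incr n ^~ w) t =
  f n * psum z 0 (m n (tau (cut t))) w.
Proof.
rewrite /grid_path; elim: (cut t) => [|j IH]; first by rewrite big_ord1 tau0.
rewrite big_ord_recr/= IH -mulrDr; congr (_ * _); rewrite /psum.
by rewrite -big_cat_nat//; exact: m_mono.
Qed.

Lemma grid_path_brown w t : grid_path (grid_brown ^~ w) t =
  W (omega * v (tau (cut t))) w.
Proof.
rewrite /grid_path /grid_brown; elim: (cut t) => [|j IH].
  by rewrite big_ord1/= (brownian0 bm) subr0.
by rewrite big_ord_recr/= IH subrKC.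
Qed.

Lemma measurable_grid_incr n j : measurable_fun setT (grid_incr n j).
Proof.
case: j => [|j]; apply: measurable_funM => //;
 exact: (proj1 (badapted_rv genM (psum_adapted genS z_adapted _ _))).
Qed.

Lemma measurable_grid_brown j : measurable_fun setT (grid_brown j).
Proof. by apply: measurable_funB; exact: (brownian_measurable bm). Qed.

Let start n (j : nat) : nat := if j is j'.+1 then m n (tau j') else 0%N.
Let stop n (j : nat) : nat := m n (tau j).

Let start_stop n j : (start n j <= stop n j)%N.
Proof. by case: j => // j; apply: m_mono. Qed.

Let grid_incrE n j w : grid_incr n j w = f n * psum z (start n j) (stop n j) w.
Proof. by case: j => //=; rewrite /stop tau0. Qed.

Let grid_qvar j : (fun n => qvar n (start n j) (stop n j) * omega) @ \oo -->
  grid_time j.+1 - grid_time j.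
Proof.
case: j => [|j] /=.
  rewrite subr0 tau0 mulrC; apply: cvgMl; rewrite /stop tau0; exact: var_cvg.
by rewrite -mulrBr mulrC; apply: cvgMl; apply: qvar_cvg.
Qed.

Let grid_time_le j : grid_time j <= grid_time j.+1.
Proof.
case: j => [|j]/=; first by rewrite mulr_ge0// v_ge0.
by rewrite ler_wpM2l// v_mono.
Qed.

Let grid_time_ge0 j : 0 <= grid_time j.
Proof. by case: j => //= j; rewrite mulr_ge0// v_ge0. Qed.

Let cvg_heat B g g1 g2 (u : nat -> R) (l : R) : smooth3 B g g1 g2 ->
  (forall n, 0 <= u n) -> 0 <= l -> u @ \oo --> l ->
  (fun n => heat P' W (u n) g 0) @ \oo --> heat P' W l g 0.
Proof.
move=> sg u0 l0 ul; have [B0 _ _ _] := sg.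
apply: (@cvg_seq_dominated _ _
  (fun n => B * `|u n - l| + 59 * B * Num.sqrt `|u n - l| ^+ 3)).
  have a0 := cvg_seq_dist0 ul.
  rewrite -[X in _ --> X]addr0; apply: cvg_seqD.
    by rewrite -[X in _ --> X](mulr0 B); apply: cvgMr.
  rewrite -[X in _ --> X](mulr0 (59 * B)); apply: cvgMr.
  have sq0 : (fun n => Num.sqrt `|u n - l|) @ \oo --> (0 : R).
    rewrite -[X in _ --> X](sqrtr0 R).
    by apply: continuous_cvg => //; exact: sqrt_continuous.
  have : (fun n => Num.sqrt `|u n - l| * (Num.sqrt `|u n - l| * Num.sqrt `|u n - l|))
      @ \oo --> (0 * (0 * 0) : R) by do 2 (apply: cvg_seqM => //).
  by apply: cvg_seq_eq => [n|]; rewrite ?mul0r// exprS expr2.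
move=> n; have [un|un] := leP (u n) l.
  have h := heat_time_continuous bm 0 sg (u0 n) (_ : 0 <= l - u n).
  rewrite distrC; rewrite subrKC in h; rewrite (le_trans (h _))// ?subr_ge0//.
  by rewrite ler0_norm ?subr_le0// opprB.
have h := heat_time_continuous bm 0 sg l0 (_ : 0 <= u n - l).
rewrite subrKC in h; rewrite (le_trans (h _))// ?subr_ge0 ?(ltW un)//.
by rewrite ger0_norm// subr_ge0 ltW.
Qed.

(** [lindeberg] on the block of coordinate [j], with [U] the function of the earlier increments,
    known when the block starts. Two errors remain: [rem], and the passage from the variance of the
    block to its limit. *)
Lemma grid_incr_cvg j G (M L a h : R) : (forall x, `|G x| <= M) ->
  lip_coords j L G -> 0 < h ->
  (fun n => Ex P (fun w => G (grid_incr n ^~ w) * ramp a h (grid_incr n j w)) -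
    Ex P (fun w => G (grid_incr n ^~ w)) * Ex P' (fun w => ramp a h (grid_brown j w)))
  @ \oo --> (0 : R).
Proof.
move=> GM lG h0; have M0 : 0 <= M := le_trans (normr_ge0 _) (GM (fun=> 0)).
have [B [g1 [g2 sg]]] := sstep_affine_smooth a h0.
have [B0 bg [lg _ _] _] := sg.
have gB x : `|ramp a h x| <= B by have [] := bg x.
set g := ramp a h in gB.
have -> : Ex P' (fun w => g (grid_brown j w)) =
    heat P' W (grid_time j.+1 - grid_time j) g 0.
  rewrite -(heat_increment bm B0 lg gB)//.
  by apply: Ex_ext => w; rewrite add0r.
have c1 := cvg_heat sg (fun n => mulr_ge0 (qvar_ge0 n (start n j) (stop n j)) omega_ge0)
  (_ : 0 <= grid_time j.+1 - grid_time j) (grid_qvar (j := j)).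
have {}c1 := c1 _; rewrite subr_ge0 in c1; have {}c1 := c1 (grid_time_le j).
set hl := heat P' W (grid_time j.+1 - grid_time j) g 0 in c1 *.
apply: (@cvg_seq_dominated _ _ (fun n => M * B * rem n 0 (stop n j) +
   M * `|heat P' W (qvar n (start n j) (stop n j) * omega) g 0 - hl|)).
  rewrite -[X in _ --> X]addr0; apply: cvg_seqD.
    by rewrite -[X in _ --> X](mulr0 (M * B)); apply: cvgMr; apply: rem_cvg.
  rewrite -[X in _ --> X](mulr0 M); apply: cvgMr.
  exact: cvg_seq_dist0.
move=> n; rewrite subr0.
have aG : badapted gen (start n j) (fun w => G (grid_incr n ^~ w)).
  split; last by exists M => w; exact: GM.
  apply: (measurable_lip (T := g_sigma_algebraType (gen (start n j))) lG) => i ij.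
  have : badapted gen (start n j) (grid_incr n i).
    rewrite (_ : grid_incr n i = fun w => f n * psum z (start n i) (stop n i) w).
      apply: bounded_rvZ; apply: (badapted_le genS _ (psum_adapted genS z_adapted _ _)).
      case: j ij {lG c1 hl} => // j; rewrite ltnS => ij /=; apply: m_mono => //.
      by rewrite ler_pM2r ?invr_gt0// ler_nat.
    by apply/funext => w; exact: grid_incrE.
  by case.
have rG := badapted_rv genM aG.
have := lindeberg genS genM s_ge0 z_adapted z_bound z_mart bm omega01 om_adapted z_var
  (stop n j - start n j)%N (f_ge0 n) aG (fun w => GM _) sg.
rewrite (sum_shift (fun i => (f n * s i) ^+ 2 * omega)).
rewrite (sum_shift (fun i => 67 * (f n * s i) ^+ 3 +
   (f n * s i) ^+ 2 * om_err P om omega i)) subnKC// -mulr_suml.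
rewrite -/(qvar n (start n j) (stop n j)) -/(rem n (start n j) (stop n j)).
have -> : Ex P (fun w => G (grid_incr n ^~ w) *
    sstep ((f n * psum z (start n j) (stop n j) w - a) / h)) =
    Ex P (fun w => G (grid_incr n ^~ w) * g (grid_incr n j w)).
  by apply: Ex_ext => w; rewrite grid_incrE.
set E1 := Ex P _; set E2 := Ex P _; set h1 := heat _ _ _ _ _ => HL.
rewrite -[E1 - E2 * hl](subrKA (E2 * h1)) (le_trans (ler_normD _ _))// lerD//.
  rewrite (le_trans HL)// ler_wpM2l ?mulr_ge0//.
  exact: rem_le.
rewrite -mulrBr normrM ler_wpM2r//.
exact: normr_Ex_le.
Qed.

(** The finite-dimensional laws of [W] are given for strictly increasing times only. Either the
    clock is constantly 0 and all increments vanish, or it increases strictly from a positive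
    value. *)
Lemma grid_brown_indep j G (M L a h : R) : (forall x, `|G x| <= M) ->
  lip_coords j L G -> 0 < h ->
  Ex P' (fun w => G (grid_brown ^~ w) * ramp a h (grid_brown j w)) =
  Ex P' (fun w => G (grid_brown ^~ w)) * Ex P' (fun w => ramp a h (grid_brown j w)).
Proof.
move=> GM lG h0; case: V_cases => [V0|[V0 Vlt]].
  have gt0 i : grid_time i = 0 by case: i => //= i; exact: V0.
  have gb i w : grid_brown i w = 0.
    by rewrite /grid_brown !gt0 subrr.
  have rG := bounded_rv_lip GM lG measurable_grid_brown.
  under Ex_ext do rewrite gb mulrC.
  rewrite ExZ// mulrC; congr (_ * _).
  by rewrite -[LHS](Ex_cst P'); apply: Ex_ext => w; rewrite gb.
have glt i : grid_time i < grid_time i.+1.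
  case: i => [|i]/=; first by rewrite tau0.
  by apply: Vlt => //; rewrite ltr_pM2r ?invr_gt0// ltr_nat.
exact: (brownian_indep bm (lexx (grid_time 0)) glt a GM lG h0).
Qed.

Lemma grid_path_lip_coords g (L : R) : 0 <= L ->
  (forall x y, `|g x - g y| <= L * ldist x y) ->
  lip_coords (K.+1 * K.+1).+1 L (fun x => g (grid_path x)).
Proof.
move=> L0 lg; split => // x y; rewrite (le_trans (lg _ _))//.
by rewrite ler_wpM2l// grid_path_lip.
Qed.

Lemma grid_cvg g : bounded_lip g ->
  (fun n => Ex P (fun w => g (grid_path (grid_incr n ^~ w)))) @ \oo -->
  Ex P' (fun w => g (grid_path (grid_brown ^~ w))).
Proof.
move=> [[M gM] [L L0 lg]].
apply: (@finite_dimensional_cvg _ _ _ _ _ P P' grid_incr grid_brown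
  measurable_grid_incr measurable_grid_brown grid_incr_cvg grid_brown_indep
  _ (fun x => g (grid_path x)) M L) => //.
exact: grid_path_lip_coords.
Qed.

(** For [t <= N <= K + 1] the cap in [cut] is inactive. *)
Lemma cutE (N : nat) t : 0 <= t -> t <= N%:R -> (N <= K.+1)%N ->
  [/\ (cut t < N.+1 * K.+1)%N, tau (cut t) <= t & t <= tau (cut t).+1].
Proof.
move=> t0 tN NK; have tK : 0 <= t * K.+1%:R by rewrite mulr_ge0.
have /andP[h1 h2] := truncn_itv tK.
have cE : cut t = Num.truncn (t * K.+1%:R).
  apply/minn_idPl; rewrite -(ler_nat R) (le_trans h1)// natrM ler_wpM2r//.
  by rewrite (le_trans tN)// ler_nat.
split.
- rewrite cE -(ltr_nat R) (le_lt_trans h1)// natrM ltr_pM2r//.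
  by rewrite (le_lt_trans tN)// ltr_nat.
- by rewrite cE /tau ler_pdivrMr.
- by rewrite cE /tau ler_pdivlMr// ltW.
Qed.

End Grid.


Definition limit_path (w : Omega') (t : R) : R := W (omega * v t) w.

Let W_continuous w : {within `[0, +oo[%classic, continuous (fun t => W t w)}.
Proof. by case: bm => _ [_ []]. Qed.

Lemma grid_path_limit g w : bounded_lip g ->
  (fun K => g (grid_path K (grid_brown K ^~ w))) @ \oo --> g (limit_path w).
Proof.
move=> [_ [L L0 lg]]; apply/cvg_seqP => e e0.
pose e1 := e / (2 * (L + 1)).
have L1 : 0 < L + 1 by rewrite ltr_wpDl.
have e10 : 0 < e1 by rewrite divr_gt0// mulr_gt0.
have [N HN] := archimedean_bound e1^-1.
have N0 : 0 < (N%:R : R) by rewrite (lt_le_trans _ HN)// invr_gt0.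
have eN : expR (- N%:R) <= e1.
  by rewrite (le_trans (expRN_le_inv N0))// invf_ple ?posrE.
(* Up to time [N] the clock stays in [[0, omega v N]], where the path of [W] is uniformly
   continuous. *)
have [del1 d10 H1] := heine (omega * v N%:R) (@W_continuous w) e10.
have [del2 d20 H2] := v_modulus (ler0n R N) (divr_gt0 d10 (ltr0n R 2)).
have [k Hk] := archimedean_inv d20.
exists (maxn k N) => K; rewrite geq_max => /andP[kK NK].
rewrite (le_trans (lg _ _))//.
have dE : ldist (grid_path K (grid_brown K ^~ w)) (limit_path w) <= e1 + expR (- N%:R).
  apply: ldist_local => [|t t0 tN]; first exact: ltW.
  rewrite grid_path_brown /limit_path.
  have [_ c1 c2] := cutE t0 tN (leqW NK).
  set u := _ / _ in c1 *; set u1 := _.+1%:R / _ in c2.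
  have u0 : 0 <= u by rewrite divr_ge0.
  have uN : v u <= v N%:R by apply: v_mono => //; exact: le_trans c1 tN.
  have tN' : v t <= v N%:R by exact: v_mono.
  have uu1 : u1 - u = K.+1%:R^-1 by rewrite /u1 /u -mulrBl -natr1 addrAC subrr add0r mul1r.
  apply: H1.
  - by rewrite mulr_ge0 ?v_ge0//= ler_wpM2l.
  - by rewrite mulr_ge0// v_ge0.
  have ut : v u <= v t by exact: v_mono.
  rewrite -mulrBr normrM (ger0_norm omega_ge0) distrC ger0_norm ?subr_ge0//.
  have hv : v t - v u <= del1 / 2.
    apply: H2 => //; rewrite (le_trans _ Hk)//.
    rewrite (@le_trans _ _ K.+1%:R^-1)//; first by rewrite -uu1 lerD2r.
    by rewrite lef_pV2 ?posrE ?ltr0n// ler_nat.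
  have /andP[_ om1] := omega01.
  rewrite (@le_lt_trans _ _ (1 * (del1 / 2)))//; first by rewrite ler_pM// subr_ge0.
  by rewrite mul1r ltr_pdivrMr// ltr_pMr// ltr1n.
rewrite (@le_trans _ _ ((L + 1) * (e1 + e1)))//.
  rewrite ler_pM ?ldist_ge0//; first by rewrite lerDl.
  by rewrite (le_trans dE)// lerD2l.
by rewrite le_eqVlt; apply/orP; left; apply/eqP; rewrite /e1; field; rewrite gt_eqF.
Qed.

Lemma measurable_limit_path g : bounded_lip g ->
  measurable_fun setT (fun w => g (limit_path w)).
Proof.
move=> bg; have [[M gM] [L L0 lg]] := bg.
apply: (@measurable_fun_cvg _ _ _ _
  (fun K w => g (grid_path K (grid_brown K ^~ w)))) => [K|w _].
  apply: (measurable_lip (grid_path_lip_coords K L0 lg)) => j _.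
  exact: measurable_grid_brown.
exact: grid_path_limit.
Qed.

Let bigcup_prob (J : nat) (A : nat -> set Omega) (c : R) :
  (forall j, measurable (A j)) -> (\sum_(j < J) fine (P (A j)) <= c) ->
  exists B, [/\ measurable B, fine (P B) <= c & forall w, ~ B w ->
     forall j, (j < J)%N -> ~ A j w].
Proof.
move=> mA Hc; exists (\big[setU/set0]_(j < J) A j); split.
- by apply: bigsetU_measurable.
- rewrite (le_trans _ Hc)//; elim: J {Hc} => [|J IH].
    by rewrite !big_ord0 measure0.
  rewrite !big_ord_recr/=.
  have mB : measurable (\big[setU/set0]_(j < J) A j) by apply: bigsetU_measurable.
  rewrite (@le_trans _ _ (fine (P (\big[setU/set0]_(j < J) A j)) + fine (P (A J))))//.
    rewrite -fineD ?fin_num_measure// fine_le ?fin_numD ?fin_num_measure//.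
      exact: measurableU.
    exact: measureU2.
  by rewrite lerD2r.
- move=> w wB j jJ wA; apply: wB.
  by rewrite -bigcup_mkord; exists j.
Qed.

(** Off a bad event the path is within [3 e1] of its grid version: one [e1] each for [X_approx], for
    the oscillation within blocks and for times after [N]. A block goes bad with a probability of
    the order of its squared variance; as blocks are short, these add up to a small multiple of the
    total variance. *)
Lemma grid_path_approx g : bounded_lip g ->
  (forall n, measurable_fun setT (fun w => g (X n w))) ->
  forall e, 0 < e -> exists K0, forall K, (K0 <= K)%N -> exists n0, forall n,
  (n0 <= n)%N -> `|Ex P (fun w => g (X n w)) -
     Ex P (fun w => g (grid_path K (grid_incr K n ^~ w)))| <= e.
Proof.
move=> [[M gM] [L L0 lg]] mX e e0.
have M0 : 0 <= M := le_trans (normr_ge0 _) (gM (fun=> 0)).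
(* Shares: [3 L e1 <= e / 2] off the bad event; with [eta] below, the bad event has probability at
   most [2 eta] and costs [2 M] times that, again at most [e / 2]. *)
pose e1 := e / (6 * (L + 1)).
have L1 : 0 < L + 1 by rewrite ltr_wpDl.
have M1 : 0 < M + 1 by rewrite ltr_wpDl.
have e10 : 0 < e1 by rewrite divr_gt0// mulr_gt0.
pose eta := e / (8 * (M + 1)).
have eta0 : 0 < eta by rewrite divr_gt0// mulr_gt0.
have [N HN] := archimedean_bound e1^-1.
have N0 : 0 < (N%:R : R) by rewrite (lt_le_trans _ HN)// invr_gt0.
have eN : expR (- N%:R) <= e1.
  by rewrite (le_trans (expRN_le_inv N0))// invf_ple ?posrE.
pose C := v N.+1%:R + 1.
have C0 : 0 < C by rewrite ltr_wpDl// v_ge0.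
have C1 : 1 <= C by rewrite lerDr v_ge0.
(* level exceeded by the whole path with small probability *)
pose lam := 64 * C ^+ 2 / eta + 1.
have lam1 : 1 <= lam by rewrite lerDr divr_ge0// ?(ltW eta0)// mulr_ge0// sqr_ge0.
have lam0 : 0 < lam by rewrite (lt_le_trans ltr01).
have lamE : 64 * C ^+ 2 / lam ^+ 4 <= eta.
  rewrite ler_pdivrMr ?exprn_gt0// (@le_trans _ _ (eta * lam))//.
    rewrite (_ : eta * lam = 64 * C ^+ 2 + eta) ?lerDl ?(ltW eta0)//.
    by rewrite /lam mulrDr mulr1 [eta * _]mulrC divfK// gt_eqF.
  by rewrite ler_wpM2l ?(ltW eta0)// ler_eXnr.
(* Variance allowed per block: a block of variance [x <= 2 q] fails with probability at most
   [64 x^2 / e1^4 <= 128 q x / e1^4], and the variances sum to at most [C]. *)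
pose q := eta * e1 ^+ 4 / (128 * C).
have q0 : 0 < q.
  by apply: divr_gt0; apply: mulr_gt0 => //; exact: exprn_gt0.
have [del d0 Hd] := v_modulus (ler0n R N.+1) q0.
have [k Hk] := archimedean_inv d0.
exists (maxn k N) => K; rewrite geq_max => /andP[kK NK].
(* Blocks up to time [N + 1], since the one containing [t <= N] may end after [N]. *)
pose J := (N.+1 * K.+1)%N.
pose tau (j : nat) : R := j%:R / K.+1%:R.
have K0 : 0 < (K.+1%:R : R) by rewrite ltr0n.
have tau_ge0 j : 0 <= tau j by rewrite divr_ge0.
have tauS j : tau j <= tau j.+1 by rewrite ler_pM2r ?invr_gt0// ler_nat.
have tauJ : tau J = N.+1%:R by rewrite /tau natrM mulfK// gt_eqF.
have tauN j : (j <= J)%N -> tau j <= N.+1%:R.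
  by move=> jJ; rewrite -tauJ ler_pM2r ?invr_gt0// ler_nat.
have block : exists n0, forall n, (n0 <= n)%N -> forall j, (j < J)%N ->
    qvar n (m n (tau j)) (m n (tau j.+1)) <= 2 * q.
  have H j : exists n0, forall n, (n0 <= n)%N -> (j < J)%N ->
      qvar n (m n (tau j)) (m n (tau j.+1)) <= 2 * q.
    have /cvg_seqP/(_ _ q0)[n0 Hn0] := qvar_cvg (tau_ge0 j) (tauS j).
    exists n0 => n /Hn0; rewrite ler_norml => /andP[_ h] jJ.
    have : v (tau j.+1) - v (tau j) <= q.
      apply: Hd => //; first exact: tauN.
      rewrite (le_trans _ Hk)// /tau -mulrBl -natr1 addrAC subrr add0r mul1r.
      by rewrite lef_pV2 ?posrE ?ltr0n// ler_nat.
    by move: h; lra.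
  have [F HF] := choice H.
  exists (\max_(j < J) F j)%N => n Hn j jJ; apply: HF => //.
  exact: leq_trans (@leq_bigmax _ (fun j : 'I_J => F j) (Ordinal jJ)) Hn.
have [n1 Hn1] := block.
have /cvg_seqP/(_ _ ltr01)[n2 Hn2] := var_cvg (ler0n R N.+1).
have [n3 Hn3] := X_approx (ler0n R N.+1) lam0 e10.
exists (maxn n1 (maxn n2 n3)) => n.
rewrite !geq_max => /and3P[n1n n2n n3n].
have qC : qvar n 0 (m n N.+1%:R) <= C.
  by have := Hn2 _ n2n; rewrite ler_norml => /andP[_]; rewrite /qvar /C; lra.
have [A0 [mA0 PA0 HA0]] := scaled_maximal n (leq0n (m n N.+1%:R)) lam0.
have mm j : (m n (tau j) <= m n (tau j.+1))%N by exact: m_mono.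
have [A HA] := choice (fun j => scaled_maximal n (mm j) e10).
have mA j : measurable (A j) by have [] := HA j.
have sumA : \sum_(j < J) fine (P (A j)) <= eta.
  have e14 : 0 < e1 ^+ 4 by rewrite exprn_gt0.
  rewrite (@le_trans _ _ (\sum_(j < J) 128 * q / e1 ^+ 4 *
      qvar n (m n (tau j)) (m n (tau j.+1))))//.
    apply: ler_sum => j _; have [_ h _] := HA j; rewrite (le_trans h)//.
    rewrite [leRHS]mulrAC ler_pM2r ?invr_gt0//.
    have := Hn1 _ n1n j (ltn_ord j); have := qvar_ge0 n (m n (tau j)) (m n (tau j.+1)).
    by move: (qvar _ _ _) => x x0 xq; nra.
  rewrite -mulr_sumr.
  have -> : \sum_(j < J) qvar n (m n (tau j)) (m n (tau j.+1)) =
      qvar n (m n (tau 0%N)) (m n (tau J)).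
    elim: (J) => [|j IH]; first by rewrite big_ord0 /qvar big_geq.
    rewrite big_ord_recr/= IH -qvar_cat//.
    by elim: j {IH} => // j IH; exact: leq_trans (mm j).
  have h1 : qvar n (m n (tau 0%N)) (m n (tau J)) <= C.
    rewrite (le_trans _ qC)// tauJ.
    rewrite (@qvar_cat n 0 (m n (tau 0%N)) (m n N.+1%:R))// ?lerDr//.
    by apply: m_mono => //; rewrite /tau mul0r.
  have pq : 0 <= 128 * q / e1 ^+ 4.
    by apply: divr_ge0; [apply: mulr_ge0 => //|]; exact: ltW.
  rewrite (le_trans (ler_wpM2l pq h1))//.
  rewrite le_eqVlt; apply/orP; left; apply/eqP; rewrite /q.
  by field; rewrite ?gt_eqF.
have [B [mB PB HB]] := bigcup_prob mA sumA.
pose D := A0 `|` B.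
have mD : measurable D by exact: measurableU.
have PD : fine (P D) <= 2 * eta.
  rewrite (@le_trans _ _ (fine (P A0) + fine (P B)))//.
    rewrite -fineD ?fin_num_measure// fine_le ?fin_numD ?fin_num_measure//.
    exact: measureU2.
  have : fine (P A0) <= eta.
    rewrite (le_trans PA0)// (le_trans _ lamE)// ler_pM2r ?invr_gt0 ?exprn_gt0//.
    by rewrite ler_wpM2l// lerXn2r ?nnegrE ?qvar_ge0 ?(ltW C0).
  by move: PB; lra.
have close w : ~ D w -> ldist (X n w) (grid_path K (grid_incr K n ^~ w)) <= 3 * e1.
  move=> wD.
  have wA0 : ~ A0 w by move=> h; apply: wD; left.
  have wB : ~ B w by move=> h; apply: wD; right.
  have hlam k' : (k' <= m n N.+1%:R)%N -> `|f n * psum z 0 k' w| <= lam.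
    by move=> h; exact: HA0.
  have hX := Hn3 _ n3n w hlam.
  rewrite (@le_trans _ _ ((e1 + e1) + expR (- N%:R)))//; last by move: eN; lra.
  apply: ldist_local => [|t t0 tN]; first by rewrite addr_ge0// ltW.
  have NN : N%:R <= N.+1%:R :> R by rewrite ler_nat.
  rewrite grid_path_incr -[X in `|X|](subrKA (f n * psum z 0 (m n t) w)).
  rewrite (le_trans (ler_normD _ _))// lerD//.
    by apply: hX => //; exact: le_trans tN NN.
  have [c0 c1 c2] := cutE t0 tN (leqW NK).
  set j := minn _ _ in c0 c1 c2 *.
  have [_ _ Hj] := HA j.
  have mj1 : (m n (tau j) <= m n t)%N by exact: m_mono.
  have mj2 : (m n t <= m n (tau j.+1))%N by exact: m_mono.
  rewrite -mulrBr.
  have -> : psum z 0 (m n t) w - psum z 0 (m n (j%:R / K.+1%:R)) w =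
      psum z (m n (tau j)) (m n t) w.
    by rewrite /psum (big_cat_nat _ mj1)//= addrAC subrr add0r.
  by apply: Hj => //; apply: HB wB _ _.
have rX : bounded_rv (fun w => g (X n w)) by split => //; exists M => w.
have rG : bounded_rv (fun w => g (grid_path K (grid_incr K n ^~ w))).
  apply: (bounded_rv_lip (M := M) _ (grid_path_lip_coords K L0 lg)) => // j.
  exact: measurable_grid_incr.
rewrite -ExB// (le_trans (normr_Ex _ _))//; first exact: bounded_rvB.
have rD := bounded_rv_indic mD.
rewrite (@le_trans _ _ (Ex P (fun w => 3 * L * e1 + 2 * M * \1_D w)))//.
  apply: le_Ex.
  - by apply: bounded_rv_norm; exact: bounded_rvB.
  - by apply: bounded_rvD; [exact: bounded_rv_cst|exact: bounded_rvZ].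
  move=> w; rewrite indicE; case: (boolP (w \in D)) => [_|/negP wD].
    rewrite mulr1 (le_trans (ler_normB _ _))//.
    have h1 := gM (X n w); have h2 := gM (grid_path K (grid_incr K n ^~ w)).
    have : 0 <= 3 * L * e1 by rewrite mulr_ge0 ?(ltW e10)// mulr_ge0.
    by move: h1 h2; lra.
  rewrite mulr0 addr0 (le_trans (lg _ _))//.
  rewrite (_ : 3 * L * e1 = L * (3 * e1)); last by ring.
  by rewrite ler_wpM2l// close// => h; apply: wD; exact: mem_set.
rewrite ExD; [|exact: bounded_rv_cst|exact: bounded_rvZ].
rewrite Ex_cst ExZ// Ex_indic//.
have h1 : 3 * L * e1 <= e / 2.
  rewrite (@le_trans _ _ (3 * (L + 1) * e1))//.
    by rewrite ler_wpM2r ?(ltW e10)// ler_wpM2l// lerDl.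
  by rewrite le_eqVlt; apply/orP; left; apply/eqP; rewrite /e1; field; rewrite gt_eqF.
have h2 : 2 * M * fine (P D) <= e / 2.
  rewrite (@le_trans _ _ (2 * (M + 1) * (2 * eta)))//.
    by rewrite ler_pM ?mulr_ge0 ?fine_ge0// ler_wpM2l// lerDl.
  by rewrite le_eqVlt; apply/orP; left; apply/eqP; rewrite /eta; field; rewrite gt_eqF.
by lra.
Qed.

Theorem functional_clt g : bounded_lip g ->
  (forall n, measurable_fun setT (fun w => g (X n w))) ->
  Ex P (fun w => g (X n w)) @[n --> \oo] --> Ex P' (fun w => g (limit_path w)).
Proof.
move=> bg mX; apply/cvg_seqP => e e0.
have e30 : 0 < e / 3 by rewrite divr_gt0.
have [K1 H1] := grid_path_approx bg mX e30.
have [[M gM] [L L0 lg]] := bg.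
have cK : Ex P' (fun w => g (grid_path K (grid_brown K ^~ w))) @[K --> \oo] -->
    Ex P' (fun w => g (limit_path w)).
  apply: (@Ex_cvg _ _ _ _ _ _ M) => // [K|w]; last exact: grid_path_limit.
  apply: (measurable_lip (grid_path_lip_coords K L0 lg)) => j _.
  exact: measurable_grid_brown.
have /cvg_seqP/(_ _ e30)[K2 H2] := cK.
pose K := maxn K1 K2.
have [n1 Hn1] := H1 K (leq_maxl _ _).
have hK := H2 K (leq_maxr _ _).
have /cvg_seqP/(_ _ e30)[n2 Hn2] := @grid_cvg K g bg.
exists (maxn n1 n2) => n; rewrite geq_max => /andP[/Hn1 h1 /Hn2 h2].
move: h1 h2 hK; rewrite !ler_norml => /andP[? ?] /andP[? ?] /andP[? ?].
by apply/andP; split; lra.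
Qed.

End FunctionalCLT.

(** * Asymptotics of the step sizes *)

Section Stability.
Context {R : realType}.

Lemma cvg_seq_cst (a : R) : (fun _ : nat => a) @ \oo --> a.
Proof. exact: cvg_cst. Qed.

Lemma cvg_seqV (u : nat -> R) (a : R) : a != 0 -> u @ \oo --> a ->
  (fun n => (u n)^-1) @ \oo --> a^-1.
Proof. by move=> a0 ua; exact: cvgV. Qed.

(** The bounds are asked at successors only, because quotients by [n%:R] or by its powers degenerate
    at 0. *)
Lemma cvg_squeezeS (lo u hi : nat -> R) (l : R) :
  (forall n, lo n.+1 <= u n.+1 <= hi n.+1) ->
  lo @ \oo --> l -> hi @ \oo --> l -> u @ \oo --> l.
Proof.
move=> H /cvg_seqP lol /cvg_seqP hil; apply/cvg_seqP => e e0.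
have [n1 H1] := lol _ e0; have [n2 H2] := hil _ e0.
exists (maxn n1 n2).+1 => -[//|n] /ltnW; rewrite geq_max => /andP[/H1 + /H2].
have /andP[a b] := H n; rewrite !ler_norml => /andP[? ?] /andP[? ?].
by apply/andP; split; lra.
Qed.

Lemma ln_step_le (j : nat) : ln (j.+2%:R : R) - ln j.+1%:R <= j.+1%:R^-1.
Proof.
have j0 : 0 < (j.+1%:R : R) by rewrite ltr0n.
rewrite -ln_div ?posrE ?ltr0n//.
rewrite (_ : j.+2%:R / j.+1%:R = 1 + j.+1%:R^-1).
  by apply: le_ln1Dx; rewrite (lt_trans (ltrN10 R))// invr_gt0.
by rewrite -(natr1 j.+1) mulrDl mul1r divff// gt_eqF.
Qed.

Lemma ln_step_ge (j : nat) : (j.+2%:R^-1 : R) <= ln j.+2%:R - ln j.+1%:R.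
Proof.
have j0 : 0 < (j.+2%:R : R) by rewrite ltr0n.
rewrite -lerN2 opprB -ln_div ?posrE ?ltr0n//.
rewrite (_ : j.+1%:R / j.+2%:R = 1 - j.+2%:R^-1).
  by apply: le_ln1Dx; rewrite ltrN2 invf_lt1// ltr1n.
apply: (mulIf (lt0r_neq0 j0)); rewrite divfK ?gt_eqF//.
by rewrite mulrBl mul1r mulVf ?gt_eqF// -(natr1 j.+1) addrK.
Qed.

Lemma harmonic_unbounded (k : nat) (x : R) : exists n0, forall n, (n0 <= n)%N ->
  x <= \sum_(k <= i < n) i.+1%:R^-1.
Proof.
have sum n : (k <= n)%N -> ln (n.+1%:R : R) - ln k.+1%:R <= \sum_(k <= i < n) i.+1%:R^-1.
  move=> kn; rewrite -(subnK kn); elim: (n - k)%N => [|j IH].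
    by rewrite add0n subrr big_geq.
  rewrite addSn big_nat_recr/= ?leq_addl//.
  by rewrite -(subrKA (ln (j + k).+1%:R)) addrC lerD// ln_step_le.
have [n0 Hn0] := archimedean_bound (expR (x + ln (k.+1%:R : R))).
exists (maxn k n0) => n; rewrite geq_max => /andP[kn n0n].
rewrite (le_trans _ (sum n kn))// lerBrDr.
rewrite -[leLHS]expRK ler_ln ?posrE ?expR_gt0 ?ltr0n//.
by rewrite (le_trans Hn0)// ler_nat leqW.
Qed.

(** The product of the factors [1 - s n] is at most the exponential of [- kappa] times a harmonic
    sum, which diverges. Used for the variance, for [decay] and for the distance of the urns to
    [q]. *)
Lemma stability (u s eps : nat -> R) (n1 : nat) (kappa : R) : 0 < kappa ->
  (forall n, 0 <= u n) ->
  (forall n, (n1 <= n)%N -> kappa / n.+1%:R <= s n <= 1) ->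
  (forall n, (n1 <= n)%N -> u n.+1 <= (1 - s n) * u n + s n * eps n) ->
  eps @ \oo --> (0 : R) -> u @ \oo --> (0 : R).
Proof.
move=> kappa0 u0 s01 urec /cvg_seqP eps0; apply/cvg_seqP => e e0.
have e20 : 0 < e / 2 by rewrite divr_gt0.
have [n2' Hn2] := eps0 _ e20.
pose n2 := maxn n1 n2'.
have s0 n : (n2 <= n)%N -> 0 <= s n.
  rewrite geq_max => /andP[/s01/andP[h _] _]; apply: le_trans h.
  by rewrite divr_ge0// ltW.
pose B := u n2.
have claim n : (n2 <= n)%N ->
    u n <= e / 2 + B * expR (- (kappa * \sum_(n2 <= i < n) i.+1%:R^-1)).
  move=> n2n; rewrite -(subnK n2n); elim: (n - n2)%N => [|j IH].
    by rewrite add0n big_geq// mulr0 oppr0 expR0 mulr1 lerDr ltW.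
  rewrite addSn; set k := (j + n2)%N in IH *.
  have n2k : (n2 <= k)%N by exact: leq_addl.
  have /andP[n1k n2'k] : (n1 <= k)%N && (n2' <= k)%N by rewrite -geq_max.
  rewrite (le_trans (urec _ n1k))// big_nat_recr//= mulrDr opprD expRD.
  have sk0 := s0 _ n2k; have /andP[sk sk1] := s01 _ n1k.
  have ek : eps k <= e / 2.
    by have := Hn2 _ n2'k; rewrite subr0 ler_norml => /andP[].
  have se : 1 - s k <= expR (- (kappa * k.+1%:R^-1)).
    rewrite (@le_trans _ _ (1 + - (kappa * k.+1%:R^-1)))//; first by rewrite lerD2l lerN2.
    exact: expR_ge1Dx.
  have B0 : 0 <= B by exact: u0.
  move: IH se (expR_ge0 (- (kappa * \sum_(n2 <= i < k) i.+1%:R^-1))).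
  move: (expR _) (expR _) => E E' IH se E'0.
  have h1 : (1 - s k) * u k <= (1 - s k) * (e / 2 + B * E').
    by rewrite ler_wpM2l// subr_ge0.
  have h2 : s k * eps k <= s k * (e / 2) by rewrite ler_wpM2l.
  have h3 : (1 - s k) * (B * E') <= E * (B * E') by rewrite ler_wpM2r// mulr_ge0.
  move: h1 h2 h3; rewrite mulrDr mulrA (mulrC E) -(mulrA B) => h1 h2 h3.
  by move: h1 h2 h3; lra.
pose a := 2 * (B + 1) / e.
have B1 : 0 < B + 1 by exact: (ltr_wpDl (u0 n2) ltr01).
have a0 : 0 < a by rewrite divr_gt0// mulr_gt0.
have [n3 Hn3] := harmonic_unbounded n2 (a / kappa).
exists (maxn n2 n3) => n; rewrite geq_max => /andP[n2n n3n].
rewrite subr0 ger0_norm// (le_trans (claim _ n2n))//.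
have : B * expR (- (kappa * \sum_(n2 <= i < n) i.+1%:R^-1)) <= (B + 1) * a^-1.
  rewrite ler_pM ?expR_ge0 ?lerDl ?u0//.
  rewrite (le_trans _ (expRN_le_inv a0))// ler_expR lerN2.
  by rewrite -ler_pdivrMl// mulrC Hn3.
have -> : (B + 1) * a^-1 = e / 2 by rewrite /a; field; rewrite !gt_eqF.
by lra.
Qed.

End Stability.

Arguments cvg_seq_cst {R} a _.

(** * Decay and quadratic variation along the step sizes *)

Section Asymptotics.
Context {R : realType}.
Variables (pw : nat -> R) (r : nat -> R) (beta c delta : R).
Hypothesis pw_ge0 : forall n, 0 <= pw n.
Hypothesis pw_gt0 : forall n, 0 < pw n.+1.
Hypothesis pw_le : forall n, pw n.+1 <= n.+1%:R.
Hypothesis pw_mono : forall n k, (n <= k)%N -> pw n <= pw k.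
Hypothesis pw_inf : (fun n => (pw n)^-1) @ \oo --> (0 : R).
Hypothesis pw_ratio : (fun n => pw n * (pw n.+1 / pw n - 1)) @ \oo --> delta.
Hypothesis beta01 : 0 < beta <= 1.
Hypothesis r01 : forall n, 0 <= r n < 1.
Hypothesis c0 : 0 < c.
Hypothesis r_cvg : (fun n => pw n * r n) @ \oo --> c.
(** Per step [pw] grows by the relative amount [delta / pw] while [decay ^+ 2] shrinks by
    [2 c beta / pw]; [kappa] is the net rate. As [delta] is 0 for [gamma < 1] and 1 for [gamma = 1],
    its positivity is the condition [1 < 2 c beta] in the second case. *)
Let kappa : R := 2 * c * beta - delta.
Hypothesis kappa0 : 0 < kappa.

Lemma cvg_seq_eqS (u v : nat -> R) (l l' : R) :
  (forall n, u n.+1 = v n.+1) -> l = l' -> v @ \oo --> l' -> u @ \oo --> l.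
Proof.
move=> uv -> /cvg_seqP vl; apply/cvg_seqP => e e0; have [n0 H] := vl _ e0.
by exists n0.+1 => -[//|n] /ltnW /H; rewrite uv.
Qed.

Let pwN0 n : pw n.+1 != 0. Proof. by rewrite gt_eqF. Qed.

Lemma step_cvg0 : r @ \oo --> (0 : R).
Proof.
apply: (cvg_seq_eqS _ _ (cvg_seqM r_cvg pw_inf)); last by rewrite mulr0.
by move=> n; rewrite mulrAC divff// mul1r.
Qed.

Lemma step_ge : exists n1, forall n, (n1 <= n)%N -> c / 2 / n.+1%:R <= r n.
Proof.
have c20 : 0 < c / 2 by rewrite divr_gt0.
have /cvg_seqP/(_ _ c20)[n0 Hn0] := r_cvg.
exists n0.+1 => -[//|n] nn0; have /andP[r0 _] := r01 n.+1.
have h : c / 2 <= pw n.+1 * r n.+1.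
  by have := Hn0 _ (ltnW nn0); rewrite ler_norml => /andP[+ _]; lra.
rewrite ler_pdivrMr ?ltr0n// (le_trans h)// mulrC ler_wpM2l//.
by rewrite (le_trans (pw_le n))// ler_nat.
Qed.

Let ratio n := pw n.+1 / pw n.

Let ratio_cvg : ratio @ \oo --> (1 : R).
Proof.
have := cvg_seqD (cvg_seqM pw_ratio pw_inf) (cvg_seq_cst 1).
apply: cvg_seq_eqS.
  by move=> n; rewrite mulrAC divff// mul1r subrK.
by rewrite mulr0 add0r.
Qed.

(** Relative loss of [pw n * decay n ^+ 2] in one step, of the order [kappa / pw n]. *)
Let drift n : R := 1 - ratio n * (1 - beta * r n) ^+ 2.

Let drift_cvg : (fun n => pw n * drift n) @ \oo --> kappa.
Proof.
have h1 := cvg_seqM ratio_cvg (cvg_seqB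
  (cvg_seqM (cvg_seq_cst (2 * beta)) r_cvg)
  (cvg_seqM (cvg_seqM (cvg_seq_cst (beta ^+ 2)) r_cvg) step_cvg0)).
have := cvg_seqB h1 pw_ratio; apply: cvg_seq_eq.
  by move=> n; rewrite /drift /ratio; ring.
by rewrite /kappa; ring.
Qed.

Let one_sub_gt0 n : 0 < 1 - beta * r n.
Proof.
have /andP[b0 b1] := beta01; have /andP[r0 r1] := r01 n.
by rewrite subr_gt0 (le_lt_trans _ r1)// ler_piMl.
Qed.

Let ratio_ge0 n : 0 <= ratio n.
Proof. by rewrite divr_ge0. Qed.

Let drift_le1 n : drift n <= 1.
Proof. by rewrite /drift lerBlDr lerDl mulr_ge0// sqr_ge0. Qed.

Let drift_ge : exists n1, forall n, (n1 <= n)%N -> (kappa / 2) / n.+1%:R <= drift n <= 1.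
Proof.
have k20 : 0 < kappa / 2 by rewrite divr_gt0.
have /cvg_seqP/(_ _ k20)[n0 Hn0] := drift_cvg.
exists n0.+1 => -[//|n] nn0; rewrite drift_le1 andbT.
have h : kappa / 2 <= pw n.+1 * drift n.+1.
  by have := Hn0 _ (ltnW nn0); rewrite ler_norml => /andP[+ _]; lra.
rewrite ler_pdivrMr ?ltr0n// (le_trans h)//.
have d0 : 0 <= drift n.+1 by rewrite -(pmulr_rge0 _ (pw_gt0 n)) (le_trans _ h)// ltW.
by rewrite mulrC ler_wpM2l// (le_trans (pw_le n))// ler_nat.
Qed.

Definition decay (n : nat) : R := \prod_(k < n) (1 - beta * r k).

Lemma decayS n : decay n.+1 = decay n * (1 - beta * r n).
Proof. by rewrite /decay big_ord_recr. Qed.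

Lemma decay_gt0 n : 0 < decay n.
Proof. by apply: prodr_gt0. Qed.

Let decayN0 n : decay n != 0. Proof. by rewrite gt_eqF// decay_gt0. Qed.

(** Up to [rho ^+ 2] and the conditional variance of the noise, the quadratic variation of the
    martingale. *)
Definition qsum (n : nat) : R := \sum_(0 <= k < n) (r k / decay k.+1) ^+ 2.

Let Q n : R := decay n ^+ 2 * qsum n.

Let QS n : Q n.+1 = (1 - beta * r n) ^+ 2 * Q n + r n ^+ 2.
Proof.
rewrite /Q /qsum big_nat_recr//= mulrDr; congr (_ + _).
  by rewrite decayS; ring.
by rewrite -exprMn mulrCA divff// mulr1.
Qed.

Let L := c ^+ 2 / kappa.

(** [pw n * Q n] obeys a recursion [(1 - drift) x + source] whose source is asymptotic to
    [c^2 / pw n]; the equilibrium is [c^2 / kappa], and [stability] applies to the distance from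
    it. *)
Lemma scaled_qsum_cvg : (fun n => pw n * (decay n ^+ 2 * qsum n)) @ \oo --> c ^+ 2 / kappa.
Proof.
rewrite -/L.
have kN0 : kappa != 0 by rewrite gt_eqF.
have [n1 Hn1] := drift_ge.
pose eps n := (pw n * r n) ^+ 2 * ratio n / (pw n * drift n) - L.
have eps0 : eps @ \oo --> (0 : R).
  have := cvg_seqB (cvg_seqM (cvg_seqM (cvg_seqM r_cvg r_cvg) ratio_cvg)
    (cvg_seqV kN0 drift_cvg)) (cvg_seq_cst L).
  apply: cvg_seq_eq => [n|]; first by rewrite /eps expr2.
  by rewrite mulr1 -expr2 -/L subrr.
apply: (@cvg_seq_dominated _ _ (fun n => `|pw n * Q n - L|)); last by [].
apply: (@stability _ _ drift (fun n => `|eps n|) n1.+1 (kappa / 2)) => //.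
- by rewrite divr_gt0.
- by move=> n /ltnW; exact: Hn1.
- move=> [//|n] n1n; have /andP[d0 d1] := Hn1 _ (ltnW n1n).
  have d0' : 0 < drift n.+1.
    by rewrite (lt_le_trans _ d0)// !divr_gt0.
  have -> : pw n.+2 * Q n.+2 - L = (1 - drift n.+1) * (pw n.+1 * Q n.+1 - L) +
      drift n.+1 * eps n.+1.
    rewrite QS /eps.
    have -> : drift n.+1 * ((pw n.+1 * r n.+1) ^+ 2 * ratio n.+1 / (pw n.+1 * drift n.+1) - L) =
       pw n.+1 * r n.+1 ^+ 2 * ratio n.+1 - drift n.+1 * L.
      by field; rewrite pwN0 gt_eqF.
    have -> : 1 - drift n.+1 = ratio n.+1 * (1 - beta * r n.+1) ^+ 2.
      by rewrite /drift; ring.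
    have -> : drift n.+1 = 1 - ratio n.+1 * (1 - beta * r n.+1) ^+ 2 by [].
    have -> : pw n.+2 = ratio n.+1 * pw n.+1 by rewrite /ratio divfK.
    by ring.
  rewrite (le_trans (ler_normD _ _))// !normrM.
  by rewrite (ger0_norm (ltW d0')) ger0_norm// subr_ge0.
- by have := cvg_seq_dist0 eps0; apply: cvg_seq_eq => // n; rewrite subr0.
Qed.

Let f2 n := pw n * decay n ^+ 2.

Let f2_ge0 n : 0 <= f2 n. Proof. by rewrite mulr_ge0// sqr_ge0. Qed.

Let f2S n : f2 n.+2 = (1 - drift n.+1) * f2 n.+1.
Proof. by rewrite /f2 decayS /drift /ratio; field. Qed.

(** Hence the initial deviation and any fixed number of early increments are negligible after
    rescaling. *)
Lemma scaled_decay_cvg0 : (fun n => pw n * decay n ^+ 2) @ \oo --> (0 : R).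
Proof.
have [n1 Hn1] := drift_ge.
apply: (@stability _ f2 drift (fun=> 0) n1.+1 (kappa / 2)) => //.
- by rewrite divr_gt0.
- by move=> n /ltnW; exact: Hn1.
- by move=> [//|n] _; rewrite f2S mulr0 addr0.
- exact: cvg_seq_cst.
Qed.

Let f2_mono : exists n1, forall n k, (n1 <= n)%N -> (n <= k)%N -> f2 k <= f2 n.
Proof.
have [n1 Hn1] := drift_ge; exists n1.+1 => n k n1n nk.
rewrite -(subnK nk); elim: (k - n)%N => // j IH.
rewrite (le_trans _ IH)// addSn.
have : (n1 < j + n)%N by rewrite (leq_trans n1n)// leq_addl.
case: (j + n)%N => // l /ltnW /Hn1/andP[h _]; rewrite f2S ler_piMl// gerBl.
by rewrite (le_trans _ h)// !divr_ge0// ltW.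
Qed.

Definition rate (n : nat) : R := - ln (1 - beta * r n).

Lemma decay_rate n k : (n <= k)%N ->
  decay k = decay n * expR (- \sum_(n <= l < k) rate l).
Proof.
move=> nk; rewrite -(subnK nk); elim: (k - n)%N => [|j IH].
  by rewrite add0n big_geq// oppr0 expR0 mulr1.
rewrite addSn decayS IH big_nat_recr ?leq_addl//= opprD expRD mulrA.
by rewrite /rate opprK lnK// posrE.
Qed.

(* [x <= - ln (1 - x) <= x / (1 - x)] *)
Lemma rate_cvg : (fun n => pw n * rate n) @ \oo --> c * beta.
Proof.
have /andP[b0 _] := beta01.
have lo : (fun n => pw n * (beta * r n)) @ \oo --> c * beta.
  apply: (cvg_seq_eq _ _ (cvg_seqM (cvg_seq_cst beta) r_cvg)); last by rewrite mulrC.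
  by move=> n; ring.
have hi : (fun n => pw n * (beta * r n) / (1 - beta * r n)) @ \oo --> c * beta.
  have h : (fun n => 1 - beta * r n) @ \oo --> (1 : R).
    have := cvg_seqB (cvg_seq_cst (1 : R)) (cvg_seqM (cvg_seq_cst beta) step_cvg0).
    by apply: cvg_seq_eq => //; rewrite mulr0 subr0.
  apply: (cvg_seq_eq _ _ (cvg_seqM lo (cvg_seqV (oner_neq0 R) h))) => //.
  by rewrite invr1 mulr1.
apply: (squeeze_cvgr _ lo hi); apply: nearW => n /=.
have x1 := one_sub_gt0 n.
have xE : beta * r n < 1 by rewrite -subr_gt0.
apply/andP; split; first rewrite ler_wpM2l// /rate lerNr.
  by have := @le_ln1Dx R (- (beta * r n)); rewrite ltrN2; apply.
rewrite -mulrA ler_wpM2l// /rate -lnV ?posrE//.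
rewrite [X in ln X](_ : (1 - beta * r n)^-1 = 1 + (beta * r n) / (1 - beta * r n)); last first.
  by field; rewrite gt_eqF.
have /andP[r0 _] := r01 n.
by apply: le_ln1Dx; rewrite (lt_le_trans (ltrN10 R))// divr_ge0 ?(ltW x1)// mulr_ge0// ltW.
Qed.

Variables (m : nat -> R -> nat) (Lam : R -> R).
Hypothesis m_ge : forall n (t : R), 0 <= t -> (n <= m n t)%N.
Hypothesis Lam_le : forall t : R, 0 <= t -> Lam t <= t.
Hypothesis block_weight : forall T e : R, 0 <= T -> 0 < e -> exists n0, forall n,
  (n0 <= n)%N -> forall t : R, 0 <= t -> t <= T ->
  `|\sum_(n <= k < m n t) (pw k)^-1 - Lam t| <= e.
Hypothesis m_ratio : forall t : R, 0 <= t ->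
  (fun n => pw n / pw (m n t)) @ \oo --> expR (- (delta * Lam t)).

(** [rate k] is [c beta / pw k] up to a vanishing relative error, and the sum of [1 / pw k] over the
    block tends to [Lam t] uniformly on bounded sets. *)
Let block_cvg (T e : R) : 0 <= T -> 0 < e -> exists n0, forall n,
  (n0 <= n)%N -> forall t : R, 0 <= t -> t <= T ->
  `|\sum_(n <= k < m n t) rate k - c * beta * Lam t| <= e.
Proof.
move=> T0 e0; have /andP[b0 _] := beta01.
have cb0 : 0 <= c * beta by rewrite mulr_ge0// ltW.
have cb1 : 0 < c * beta + 1 by rewrite ltr_wpDl.
have T1 : 0 < T + 1 by rewrite ltr_wpDl.
pose e1 := Num.min 1 (e / (2 * (c * beta + 1))).
have e10 : 0 < e1 by rewrite lt_min ltr01/= divr_gt0// mulr_gt0.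
have e2 : c * beta * e1 <= e / 2.
  rewrite (@le_trans _ _ ((c * beta + 1) * (e / (2 * (c * beta + 1)))))//.
    by rewrite ler_pM// ?(ltW e10)// ?lerDl// ge_min lexx orbT.
  by rewrite le_eqVlt; apply/orP; left; apply/eqP; field; rewrite gt_eqF.
have e30 : 0 < e / (2 * (T + 1)) by rewrite divr_gt0// mulr_gt0.
have [n1 Hn1] := block_weight T0 e10.
have /cvg_seqP/(_ _ e30)[n2 Hn2] := rate_cvg.
exists (maxn 1 (maxn n1 n2)) => n; rewrite !geq_max => /and3P[n_gt0 n1n n2n] t t0 tT.
have h1 := Hn1 _ n1n _ t0 tT.
set S := \sum_(_ <= _ < _) _^-1 in h1.
have ST : S <= T + 1.
  have : e1 <= 1 by rewrite ge_min lexx.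
  by move: h1 (Lam_le t0); rewrite ler_norml => /andP[_]; lra.
have -> : \sum_(n <= k < m n t) rate k - c * beta * Lam t =
    \sum_(n <= k < m n t) (rate k - c * beta * (pw k)^-1) + c * beta * (S - Lam t).
  by rewrite sumrB -mulr_sumr -/S; ring.
rewrite (le_trans (ler_normD _ _))// [leRHS](splitr e) lerD//; last first.
  by rewrite normrM ger0_norm// (le_trans _ e2)// ler_wpM2l.
rewrite (le_trans (ler_norm_sum _ _ _))//.
rewrite (@le_trans _ _ (\sum_(n <= k < m n t) e / (2 * (T + 1)) * (pw k)^-1))//.
  rewrite big_nat [leRHS]big_nat; apply: ler_sum => -[|k] /andP[nk _].
    by move: (leq_trans n_gt0 nk).
  have := Hn2 _ (leq_trans n2n nk).
  have -> : rate k.+1 - c * beta / pw k.+1 = (pw k.+1 * rate k.+1 - c * beta) / pw k.+1.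
    by rewrite mulrBl [pw k.+1 * _]mulrC mulfK.
  by move=> h; rewrite normrM normfV (gtr0_norm (pw_gt0 _)) ler_pM2r ?invr_gt0.
rewrite -mulr_sumr -/S (@le_trans _ _ (e / (2 * (T + 1)) * (T + 1)))//.
  by rewrite ler_wpM2l// ltW.
by rewrite le_eqVlt; apply/orP; left; apply/eqP; field; rewrite gt_eqF.
Qed.

Lemma decay_block_cvg (T e : R) : 0 <= T -> 0 < e -> exists n0, forall n,
  (n0 <= n)%N -> forall t : R, 0 <= t -> t <= T ->
  `|expR (c * beta * Lam t) * (decay (m n t) / decay n) - 1| <= e.
Proof.
move=> T0 e0.
have /cvgrPdist_le/(_ _ e0)[eta /= eta0 Heta] := @continuous_expR R 0.
have h20 : 0 < eta / 2 by rewrite divr_gt0.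
have [n0 Hn0] := block_cvg T0 h20.
exists n0 => n n0n t t0 tT; have := Hn0 _ n0n _ t0 tT.
rewrite (decay_rate (m_ge n t0)) [decay n * _]mulrC mulfK// -expRD distrC => h.
have := Heta (c * beta * Lam t - \sum_(n <= l < m n t) rate l).
rewrite expR0 distrC; apply; rewrite /= sub0r normrN.
by rewrite (le_lt_trans h)// ltr_pdivrMr// ltr_pMr// ltr1n.
Qed.

Let inv_decay_cvg (t : R) : 0 <= t ->
  (fun n => decay n / decay (m n t)) @ \oo --> expR (c * beta * Lam t).
Proof.
move=> t0; apply: (@cvg_seq_eq _ _ (fun n => expR (\sum_(n <= l < m n t) rate l)) _
   (expR (c * beta * Lam t))) => // [n|].
  rewrite (decay_rate (m_ge n t0)) invfM mulrA divff// mul1r -expRN opprK//.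
apply: continuous_cvg; first exact: continuous_expR.
apply/cvg_seqP => e e0; have [n0 H] := block_cvg t0 e0.
by exists n0 => n n0n; exact: H.
Qed.

(** The quantity is [pw Q] at the block end, times [pw n / pw (m n t)], times a squared ratio of
    decays; the exponents [- delta Lam] and [2 c beta Lam] add up to [kappa Lam]. *)
Lemma qsum_block_cvg (t : R) : 0 <= t ->
  (fun n => pw n * decay n ^+ 2 * qsum (m n t)) @ \oo -->
  c ^+ 2 / kappa * expR (kappa * Lam t).
Proof.
move=> t0.
have xm : (fun n => pw (m n t) * Q (m n t)) @ \oo --> L.
  apply/cvg_seqP => e e0; have /cvg_seqP/(_ _ e0)[n0 H] := scaled_qsum_cvg.
  by exists n0 => n n0n; apply: H; rewrite (leq_trans n0n)// m_ge.
have := cvg_seqM (cvg_seqM xm (m_ratio t0))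
   (cvg_seqM (inv_decay_cvg t0) (inv_decay_cvg t0)).
apply: cvg_seq_eqS => [n|].
  have : pw (m n.+1 t) != 0.
    by have := m_ge n.+1 t0; case: (m _ _).
  rewrite /Q => h; have := decayN0 (m n.+1 t).
  by move: h (decayN0 n.+1) => h1 h2 h3; field; rewrite h1 h3.
rewrite -/L -mulrA -!expRD; congr (_ * expR _); rewrite /kappa; ring.
Qed.

(** The Lindeberg condition. For the finitely many [k < K] the factor [pw n * decay n ^+ 2]
    vanishes; for later [k] it is at most a constant times its value at [k + 1], and
    [pw k.+1 * r k ^+ 2] tends to 0. *)
Lemma max_block_cvg (T e : R) : 0 <= T -> 0 < e ->
  exists n0, forall n,
  (n0 <= n)%N -> forall k, (k < m n T)%N ->
  pw n * decay n ^+ 2 * (r k / decay k.+1) ^+ 2 <= e.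
Proof.
move=> T0 e0.
have [n1 Hn1] := f2_mono.
pose C := expR (c * beta * Lam T) + 1.
have C1 : 1 <= C by rewrite lerDr expR_ge0.
have C0 : 0 < C by rewrite (lt_le_trans ltr01).
have eC0 : 0 < e / C ^+ 2 by rewrite divr_gt0// exprn_gt0.
have tail0 : (fun k => pw k.+1 * r k ^+ 2) @ \oo --> (0 : R).
  have := cvg_seqM ratio_cvg (cvg_seqM r_cvg step_cvg0).
  apply: cvg_seq_eqS => [n|]; last by rewrite mulr0 mulr0.
  by rewrite /ratio; field.
have /cvg_seqP/(_ _ eC0)[n2 Hn2] := tail0.
have /cvg_seqP/(_ _ ltr01)[n3 Hn3] := inv_decay_cvg T0.
pose K := maxn n1 n2.
pose S := \sum_(k < K) (r k / decay k.+1) ^+ 2.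
have S0 : 0 <= S by apply: sumr_ge0 => i _; exact: sqr_ge0.
have S1 : 0 < S + 1 by rewrite ltr_wpDl.
have /cvg_seqP/(_ _ (divr_gt0 e0 S1))[n4 Hn4] := scaled_decay_cvg0.
exists (maxn (maxn n1 n3) n4) => n; rewrite !geq_max => /andP[/andP[n1n n3n] n4n] k km.
rewrite -/(f2 n).
have [kK|Kk] := ltnP k K.
  have := Hn4 _ n4n; rewrite subr0 ger0_norm; last exact: f2_ge0.
  rewrite -/(f2 n) => h.
  rewrite (@le_trans _ _ (e / (S + 1) * (S + 1)))//; last by rewrite divfK// gt_eqF.
  rewrite ler_pM ?sqr_ge0//.
  rewrite (@le_trans _ _ S) ?lerDl//.
  rewrite /S (bigD1 (Ordinal kK))//= lerDl.
  by apply: sumr_ge0 => i _; exact: sqr_ge0.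
move: Kk; rewrite geq_max => /andP[n1k n2k].
have x0 : 0 <= pw k.+1 * r k ^+ 2 by rewrite mulr_ge0// sqr_ge0.
have := Hn2 _ n2k; rewrite subr0 ger0_norm// => h.
have f2k : 0 < f2 k.+1 by rewrite mulr_gt0// exprn_gt0// decay_gt0.
have -> : f2 n * (r k / decay k.+1) ^+ 2 = (f2 n / f2 k.+1) * (pw k.+1 * r k ^+ 2).
  rewrite /f2; have := decayN0 k.+1; have := pwN0 k.
  by move: (decay k.+1) (pw k.+1) (pw n) (decay n) => x y a b yN0 xN0; field; rewrite xN0 yN0.
have ratioC : f2 n / f2 k.+1 <= C ^+ 2.
  have [kn|nk] := leqP k.+1 n.
    rewrite ler_pdivrMr// (@le_trans _ _ (1 * f2 k.+1))//.
      by rewrite mul1r Hn1// leqW.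
    by rewrite ler_wpM2r// exprn_ege1.
  have nm := m_ge n T0.
  have f2m : 0 < f2 (m n T).
    case: (m n T) nm km => // j _ _.
    by rewrite mulr_gt0// exprn_gt0// decay_gt0.
  rewrite (@le_trans _ _ (f2 n / f2 (m n T)))//.
    by rewrite ler_wpM2l// lef_pV2 ?posrE// Hn1// leqW.
  rewrite /f2 invfM mulrACA -exprVn -exprMn -[leRHS]mul1r ler_pM//.
  - by rewrite divr_ge0.
  - exact: sqr_ge0.
  - case: (m n T) nm km => // j nj _; rewrite ler_pdivrMr// mul1r; exact: pw_mono.
  have dm : 0 <= decay n / decay (m n T) by rewrite divr_ge0// ltW// decay_gt0.
  rewrite lerXn2r ?nnegrE ?(ltW C0)//.
  by have := Hn3 _ n3n; rewrite ler_norml => /andP[_]; rewrite /C; lra.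
rewrite (@le_trans _ _ (C ^+ 2 * (e / C ^+ 2)))//.
  by rewrite ler_pM// divr_ge0.
by rewrite mulrC divfK// gt_eqF// exprn_gt0.
Qed.

End Asymptotics.

(** * Powers of [n] and ends of blocks *)

Section PowerSteps.
Context {R : realType}.
Variable gamma : R.
Hypothesis gamma01 : 0 < gamma <= 1.

Definition pow_step (n : nat) : R := n%:R `^ gamma.
Definition block_end (n : nat) (t : R) : nat := Num.truncn (n%:R + n%:R `^ gamma * t).

Local Notation pw := pow_step.
Local Notation m := block_end.

Let gamma_gt0 : 0 < gamma. Proof. by have /andP[] := gamma01. Qed.
Let gamma_le1 : gamma <= 1. Proof. by have /andP[] := gamma01. Qed.

Lemma pow_step_ge0 n : 0 <= pw n.
Proof. exact: powR_ge0. Qed.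

Lemma pow_step_gt0 n : 0 < pw n.+1.
Proof. by rewrite powR_gt0// ltr0n. Qed.

Lemma pow_step_le n : pw n.+1 <= n.+1%:R.
Proof. by rewrite -[leRHS]powRr1// ler_powR// ler1n. Qed.

Lemma pow_step_mono n k : (n <= k)%N -> pw n <= pw k.
Proof. by move=> nk; rewrite ge0_ler_powR ?nnegrE ?ler_nat// ltW. Qed.

Lemma block_end_itv n (t : R) : 0 <= t ->
  (m n t)%:R <= n%:R + pw n * t < (m n t)%:R + 1.
Proof.
move=> t0; have h : 0 <= n%:R + pw n * t by rewrite addr_ge0// mulr_ge0// pow_step_ge0.
by have := truncn_itv h; rewrite natr1.
Qed.

Lemma block_end_mono n (a b : R) : 0 <= a -> a <= b -> (m n a <= m n b)%N.
Proof.
move=> a0 ab; apply: le_truncn; rewrite lerD2l ler_wpM2l// pow_step_ge0//.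
Qed.

Lemma block_end_ge n (t : R) : 0 <= t -> (n <= m n t)%N.
Proof.
move=> t0; rewrite -[leqLHS](@natrK R); apply: le_truncn.
by rewrite lerDl mulr_ge0// pow_step_ge0.
Qed.

End PowerSteps.

Section PowerStepsCvg.
Context {R : realType}.

Lemma pow_step_inf (gamma : R) : 0 < gamma ->
  (fun n => (pow_step gamma n)^-1) @ \oo --> (0 : R).
Proof.
move=> g0; apply/cvg_seqP => e e0.
have [n0 Hn0] := archimedean_bound (e^-1 `^ gamma^-1).
exists n0.+1 => n n0n; have n0' : 0 < (n%:R : R) by rewrite ltr0n (leq_trans _ n0n).
have p0 : 0 < pow_step gamma n by rewrite powR_gt0.
rewrite subr0 ger0_norm ?invr_ge0 ?(ltW p0)// invf_ple ?posrE//.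
rewrite (@le_trans _ _ ((e^-1 `^ gamma^-1) `^ gamma))//.
  by rewrite -powRrM mulVf ?gt_eqF// powRr1// invr_ge0 ltW.
rewrite ge0_ler_powR ?nnegrE ?powR_ge0 ?(ltW g0) ?(ltW n0')//.
by rewrite (le_trans Hn0)// ler_nat ltnW.
Qed.

Lemma pow_step_div (gamma : R) n : pow_step gamma n.+1 / n.+1%:R = (pow_step (1 - gamma) n.+1)^-1.
Proof.
have n0 : 0 < (n.+1%:R : R) by rewrite ltr0n.
have h : pow_step (1 - gamma) n.+1 * pow_step gamma n.+1 = n.+1%:R.
  by rewrite /pow_step -powRD ?subrK ?powRr1 ?ltW// gt_eqF ?implybT.
have p0 : 0 < pow_step gamma n.+1 by rewrite powR_gt0.
have p1 : 0 < pow_step (1 - gamma) n.+1 by rewrite powR_gt0.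
by rewrite -[X in _ / X]h; field; rewrite !gt_eqF.
Qed.

Lemma pow_step_quot (gamma : R) k n :
  pow_step gamma k / pow_step gamma n.+1 = (k%:R / n.+1%:R) `^ gamma.
Proof.
have n0 : 0 < (n.+1%:R : R) by rewrite ltr0n.
have p0 : 0 < pow_step gamma n.+1 by rewrite powR_gt0.
have -> : pow_step gamma k = (k%:R / n.+1%:R) `^ gamma * pow_step gamma n.+1.
  by rewrite /pow_step -(powRM gamma (divr_ge0 (ler0n R k) (ltW n0)) (ltW n0)) divfK// gt_eqF.
by rewrite mulfK// gt_eqF.
Qed.

(** Applied to ratios close to 1, this crude bound plays the part of the expansion of a power. *)
Lemma powR_le_id (x gamma : R) : 1 <= x -> gamma <= 1 -> x `^ gamma <= x.
Proof.
move=> x1 g1; rewrite -[leRHS]powRr1 ?ler_powR//.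
exact: le_trans x1.
Qed.

Section Subcritical.
Variable gamma : R.
Hypothesis gamma01 : 0 < gamma < 1.
Let gamma_gt0 : 0 < gamma. Proof. by have /andP[] := gamma01. Qed.
Let gamma_lt1 : gamma < 1. Proof. by have /andP[] := gamma01. Qed.
Let gamma01' : 0 < gamma <= 1. Proof. by rewrite gamma_gt0 ltW. Qed.
Local Notation pw := (pow_step gamma).
Local Notation m := (block_end gamma).

Let pw0 n : 0 < pw n.+1. Proof. exact: pow_step_gt0. Qed.

Let eps (n : nat) : R := (pow_step (1 - gamma) n)^-1.
Let eps0 : eps @ \oo --> (0 : R).
Proof. by apply: pow_step_inf; rewrite subr_gt0. Qed.

(** By [powR_le_id] the bracket is at most [1 / n], and [n^gamma / n] tends to 0. *)
Lemma pow_step_ratio_lt : (fun n => pw n * (pw n.+1 / pw n - 1)) @ \oo --> (0 : R).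
Proof.
apply: (@cvg_squeezeS _ (fun=> 0) _ eps) => // [k|]; last exact: cvg_seq_cst.
have k0 : 0 < (k.+1%:R : R) by rewrite ltr0n.
have x1 : 1 <= k.+2%:R / k.+1%:R :> R by rewrite ler_pdivlMr// mul1r ler_nat.
have E := pow_step_quot gamma k.+2 k.
rewrite mulr_ge0 ?(ltW (pw0 _))//=.
  rewrite /eps -pow_step_div ler_wpM2l ?(ltW (pw0 _))// E.
  rewrite lerBlDr (le_trans (powR_le_id x1 (ltW gamma_lt1)))//.
  by rewrite -(natr1 k.+1) mulrDl mul1r divff ?gt_eqF// addrC.
rewrite subr_ge0 ler_pdivlMr// mul1r; exact: pow_step_mono.
Qed.

Let block_le n (t : R) : 0 <= t -> (m n.+1 t)%:R / n.+1%:R <= 1 + eps n.+1 * t.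
Proof.
move=> t0; have /andP[h _] := block_end_itv gamma n.+1 t0.
have n0 : 0 < (n.+1%:R : R) by rewrite ltr0n.
rewrite ler_pdivrMr// (le_trans h)// mulrDl mul1r lerD2l.
by rewrite /eps -pow_step_div mulrAC divfK// gt_eqF.
Qed.

Lemma block_end_ratio_lt (t : R) : 0 <= t ->
  (fun n => pw n / pw (m n t)) @ \oo --> (1 : R).
Proof.
move=> t0.
have lo : (fun n => (1 + eps n * t)^-1) @ \oo --> (1 : R).
  have h := cvg_seqD (cvg_seq_cst (1 : R)) (cvg_seqM eps0 (cvg_seq_cst t)).
  have h1 : 1 + 0 * t != 0 by rewrite mul0r addr0 oner_neq0.
  have := cvg_seqV h1 h; apply: cvg_seq_eq => //.
  by rewrite mul0r addr0 invr1.
apply: (cvg_squeezeS _ lo (cvg_seq_cst 1)) => k.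
have k0 : 0 < (k.+1%:R : R) by rewrite ltr0n.
have mk := block_end_ge gamma k.+1 t0.
have m0 : 0 < (m k.+1 t)%:R :> R by rewrite ltr0n (leq_trans _ mk).
have pm0 : 0 < pw (m k.+1 t) by rewrite powR_gt0.
apply/andP; split; last by rewrite ler_pdivrMr// mul1r; exact: pow_step_mono.
have x1 : 1 <= (m k.+1 t)%:R / k.+1%:R :> R by rewrite ler_pdivlMr// mul1r ler_nat.
have E := pow_step_quot gamma (m k.+1 t) k.
rewrite -[leRHS]invrK invf_div lef_pV2 ?posrE ?divr_gt0//; last first.
  exact: lt_le_trans (lt_le_trans ltr01 x1) (block_le k t0).
by rewrite E (le_trans (powR_le_id x1 (ltW gamma_lt1)))// block_le.
Qed.

(** The block has about [n^gamma t] terms, all close to [n^(- gamma)] because the block is short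
    compared with [n]. *)
Lemma block_weight_lt (T e : R) : 0 <= T -> 0 < e -> exists n0, forall n,
  (n0 <= n)%N -> forall t : R, 0 <= t -> t <= T ->
  `|\sum_(n <= k < m n t) (pw k)^-1 - t| <= e.
Proof.
move=> T0 e0.
have e20 : 0 < e / 2 by rewrite divr_gt0.
have T1 : 0 < T + 1 by rewrite ltr_wpDl.
have e30 : 0 < e / 2 / (T + 1) ^+ 2 by rewrite divr_gt0// exprn_gt0.
have /cvg_seqP/(_ _ e20)[n1 Hn1] := pow_step_inf gamma_gt0.
have /cvg_seqP/(_ _ e30)[n2 Hn2] := eps0.
exists (maxn 1 (maxn n1 n2)) => -[|n]; rewrite !geq_max => /and3P[// _ n1n n2n] t t0 tT.
have h1 := Hn1 _ n1n; have h2 := Hn2 _ n2n.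
rewrite subr0 ger0_norm ?invr_ge0 ?pow_step_ge0// in h1.
rewrite subr0 ger0_norm ?invr_ge0 ?pow_step_ge0// in h2.
have /andP[i1 i2] := block_end_itv gamma n.+1 t0.
have mk := block_end_ge gamma n.+1 t0.
have cst (x : R) : \sum_(n.+1 <= k < m n.+1 t) x = ((m n.+1 t)%:R - n.+1%:R) * x.
  by rewrite big_const_nat iter_addr_0 -[LHS]mulr_natl natrB.
have p0 := pw0 n; have pi0 : 0 < (pw n.+1)^-1 by rewrite invr_gt0.
have hi : \sum_(n.+1 <= k < m n.+1 t) (pw k)^-1 <= t.
  rewrite (@le_trans _ _ (\sum_(n.+1 <= k < m n.+1 t) (pw n.+1)^-1))//.
    rewrite big_nat [leRHS]big_nat; apply: ler_sum => -[|k] /andP[nk _]//.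
    by rewrite lef_pV2 ?posrE// pow_step_mono.
  rewrite cst ler_pdivrMr// lerBlDl (le_trans i1)// lerD2l mulrC//.
(* [(pw k)^-1 >= (1 - eps T) / pw n] since [(1 + x)^-1 >= 1 - x] *)
have lo : ((m n.+1 t)%:R - n.+1%:R) * ((1 - eps n.+1 * T) / pw n.+1) <=
    \sum_(n.+1 <= k < m n.+1 t) (pw k)^-1.
  rewrite -cst big_nat [leRHS]big_nat; apply: ler_sum => k /andP[nk km].
  have k0 : (0 < k)%N by exact: leq_trans nk.
  have kR : 0 < (k%:R : R) by rewrite ltr0n.
  have n0 : 0 < (n.+1%:R : R) by rewrite ltr0n.
  have pk0 : 0 < pw k by rewrite powR_gt0.
  rewrite ler_pdivrMr// [leRHS]mulrC ler_pdivlMr//.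
  have x1 : 1 <= k%:R / n.+1%:R :> R by rewrite ler_pdivlMr// mul1r ler_nat.
  have E : pw k = pw n.+1 * (k%:R / n.+1%:R) `^ gamma.
    by rewrite -pow_step_quot mulrC divfK// gt_eqF.
  rewrite E mulrCA ler_piMr ?(ltW p0)//.
  have y : (k%:R / n.+1%:R) `^ gamma <= 1 + eps n.+1 * T.
    rewrite (le_trans (powR_le_id x1 (ltW gamma_lt1)))//.
    rewrite (@le_trans _ _ ((m n.+1 t)%:R / n.+1%:R))//.
      by rewrite ler_pM2r ?invr_gt0// ler_nat ltnW.
    rewrite (le_trans (block_le n t0))// lerD2l ler_wpM2l//.
    by rewrite invr_ge0 pow_step_ge0.
  have [x0|x0] := leP (1 - eps n.+1 * T) 0.
    by rewrite (@le_trans _ _ 0)// mulr_le0_ge0// powR_ge0.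
  rewrite (le_trans (ler_wpM2l (ltW x0) y))//.
  by move: (eps _ * T) => x; rewrite -subr_ge0; have := sqr_ge0 x; lra.
have lo2 : t - (pw n.+1)^-1 <= ((m n.+1 t)%:R - n.+1%:R) / pw n.+1.
  rewrite ler_pdivlMr// mulrBl mulVf ?gt_eqF// (mulrC t).
  by move: i2; rewrite -/(pw n.+1); move: (_%:R) (n.+1%:R) (pw _ * t) => a b y; lra.
rewrite ler_norml; apply/andP; split; last by rewrite lerBlDr (le_trans hi)// lerDr ltW.
have eT : eps n.+1 * T * T <= e / 2.
  rewrite (@le_trans _ _ (e / 2 / (T + 1) ^+ 2 * (T + 1) ^+ 2))//; last first.
    by rewrite divfK// gt_eqF// exprn_gt0.
  rewrite -mulrA -expr2 ler_pM ?sqr_ge0 ?invr_ge0 ?pow_step_ge0//.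
  by rewrite lerXn2r ?nnegrE ?(ltW T1)// lerDl.
set S := \sum_(_ <= _ < _) _ in lo hi *.
set a := ((m n.+1 t)%:R - n.+1%:R) in lo lo2.
have aT : a / pw n.+1 <= T.
  rewrite ler_pdivrMr// (le_trans _ (ler_wpM2r (ltW p0) tT))// mulrC /a lerBlDl//.
have en0 : 0 <= eps n.+1 * T by rewrite mulr_ge0// invr_ge0 pow_step_ge0.
have lo3 : a / pw n.+1 - T * (eps n.+1 * T) <= S.
  rewrite (le_trans _ lo)// [leRHS](_ : _ = a / pw n.+1 - a / pw n.+1 * (eps n.+1 * T)).
    by rewrite lerD2l lerN2 ler_wpM2r.
  by ring.
move: lo2 lo3 h1 eT; rewrite [T * _]mulrC.
by move: (_^-1) (a / _) (eps _ * T * T) => x y z'; lra.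
Qed.

End Subcritical.

Local Notation m := (block_end (1 : R)).
Local Notation pw := (pow_step (1 : R)).

Lemma pow_step1 n : pw n = n%:R.
Proof. by rewrite /pow_step powRr1. Qed.

Lemma pow_step_ratio1 : (fun n => pw n * (pw n.+1 / pw n - 1)) @ \oo --> (1 : R).
Proof.
have := cvg_seq_cst (1 : R); apply: cvg_seq_eqS => // n; rewrite !pow_step1.
rewrite mulrBr mulr1 mulrC divfK ?pnatr_eq0//.
by rewrite -(natr1 n.+1) addrAC subrr add0r.
Qed.

Let block_ln n (t : R) : 0 <= t ->
  0 <= ln (1 + t) - (ln (m n.+1 t)%:R - ln n.+1%:R) <= n.+1%:R^-1.
Proof.
move=> t0; have /andP[] := block_end_itv 1 n.+1 t0.
rewrite pow_step1 (_ : n.+1%:R + n.+1%:R * t = n.+1%:R * (1 + t)) => [i1 i2|]; last first.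
  by rewrite mulrDr mulr1.
have mn := block_end_ge 1 n.+1 t0.
have n0 : 0 < (n.+1%:R : R) by rewrite ltr0n.
have m0 : 0 < (m n.+1 t)%:R :> R by rewrite ltr0n (leq_trans _ mn).
have t1 : 0 < 1 + t by rewrite ltr_wpDr.
have -> : ln (1 + t) - (ln (m n.+1 t)%:R - ln n.+1%:R) =
    ln (n.+1%:R * (1 + t) / (m n.+1 t)%:R).
  by rewrite ln_div ?posrE ?mulr_gt0// lnM ?posrE//; ring.
have x1 : 1 <= n.+1%:R * (1 + t) / (m n.+1 t)%:R by rewrite ler_pdivlMr// mul1r.
rewrite ln_ge0//= -[X in ln X](subrKC 1) (le_trans (le_ln1Dx _))//.
  by rewrite (lt_le_trans (ltrN10 R))// subr_ge0.
rewrite (@le_trans _ _ (m n.+1 t)%:R^-1)//.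
  rewrite lerBlDr ler_pdivrMr// mulrDl mulVf ?gt_eqF// mul1r [leRHS]addrC; exact: ltW.
by rewrite lef_pV2 ?posrE// ler_nat.
Qed.

Lemma block_end_ratio1 (t : R) : 0 <= t ->
  (fun n => pw n / pw (m n t)) @ \oo --> expR (- (1 * ln (1 + t))).
Proof.
move=> t0; rewrite mul1r.
have h : (fun n => - (ln (m n t)%:R - ln n%:R) : R) @ \oo --> - ln (1 + t).
  apply/cvg_seqP => e e0; have [k Hk] := archimedean_inv e0.
  exists k.+1 => -[//|n] kn; have /andP[h1 h2] := block_ln n t0.
  rewrite addrC opprK ger0_norm// (le_trans h2)// (le_trans _ Hk)//.
  by rewrite lef_pV2 ?posrE ?ltr0n// ler_nat.
have h2 : (fun n => expR (- (ln (m n t)%:R - ln n%:R)) : R) @ \oo --> expR (- ln (1 + t)).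
  by apply: continuous_cvg => //; exact: continuous_expR.
move: h2; apply: cvg_seq_eqS => // n.
have mn := block_end_ge 1 n.+1 t0.
have m0 : 0 < (m n.+1 t)%:R :> R by rewrite ltr0n (leq_trans _ mn).
have n0 : 0 < (n.+1%:R : R) by rewrite ltr0n.
rewrite !pow_step1 opprB -(ln_div (x := n.+1%:R)) ?posrE//.
by rewrite lnK// posrE divr_gt0.
Qed.

Lemma block_weight1 (T e : R) : 0 <= T -> 0 < e -> exists n0, forall n,
  (n0 <= n)%N -> forall t : R, 0 <= t -> t <= T ->
  `|\sum_(n <= k < m n t) (pw k)^-1 - ln (1 + t)| <= e.
Proof.
move=> T0 e0; have [k Hk] := archimedean_inv e0.
exists k.+1 => -[//|n] kn t t0 tT; have /andP[h1 h2] := block_ln n t0.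
have mn := block_end_ge 1 n.+1 t0.
have nV : n.+1%:R^-1 <= e.
  by rewrite (le_trans _ Hk)// lef_pV2 ?posrE ?ltr0n// ler_nat.
(* Each [1 / l] is compared with a difference of logarithms; the errors [1 / l - 1 / (l + 1)]
   telescope. *)
have bounds M : (n < M)%N -> ln (M%:R : R) - ln n.+1%:R <=
    \sum_(n.+1 <= k < M) (k%:R : R)^-1 <= ln M%:R - ln n.+1%:R + (n.+1%:R^-1 - M%:R^-1).
  move=> nM; rewrite -(subnK nM); elim: (M - n.+1)%N => [|j /andP[IH1 IH2]].
    by rewrite add0n big_geq// !subrr addr0 lexx.
  rewrite addSn; set l := (j + n.+1)%N in IH1 IH2 *.
  have nl : (n.+1 <= l)%N by exact: leq_addl.
  rewrite big_nat_recr//=; case: l nl IH1 IH2 => // l _ IH1 IH2.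
  have := @ln_step_le R l; have := @ln_step_ge R l.
  move: IH1 IH2; move: (\sum_(_ <= _ < _) _) (ln _) (ln _) (ln _) (_^-1) (_^-1) (_^-1).
  by move=> S a b x y u v' *; apply/andP; split; lra.
have /andP[b1 b2] := bounds _ mn.
have mV : 0 <= ((m n.+1 t)%:R : R)^-1 by rewrite invr_ge0.
under eq_bigr do rewrite pow_step1.
by rewrite ler_norml; apply/andP; split; move: b1 b2 h1 h2 nV mV;
  move: (\sum_(_ <= _ < _) _) (ln _) (ln _) (ln _) (_^-1) (_^-1) => *; lra.
Qed.

End PowerStepsCvg.

(** * The reinforced urns *)

Section UrnModel.
Context {R : realType} {d : measure_display} {Omega : measurableType d}.
Variables (P : probability Omega R) (N : nat) (rho alpha q : R) (r : nat -> R).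
Variables (Z : nat -> 'I_N -> Omega -> R) (I : nat -> 'I_N -> Omega -> bool).
Variable i : 'I_N.
Hypothesis rho01 : 0 <= rho < 1.
Hypothesis alpha01 : 0 <= alpha <= 1.
Hypothesis q01 : 0 < q < 1.
Hypothesis r01 : forall n, 0 <= r n < 1.
Hypothesis model : urn_model P r rho alpha q Z I.
Local Notation gen := (gen_F Z).
Implicit Types (k : nat) (j l : 'I_N) (w : Omega) (U : Omega -> R).

Let Z_measurable k j : measurable_fun setT (Z k j). Proof. by case: model. Qed.
Let I_measurable k j : measurable [set w | I k j w]. Proof. by case: model => _ []. Qed.
Let Z01 k j w : 0 <= Z k j w <= 1. Proof. by case: model => _ [_ []]. Qed.
Let Z_rec k j w : Z k.+1 j w =
  (1 - r k) * Z k j w + r k * (rho * (I k.+1 j w)%:R + (1 - rho) * q).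
Proof. by case: model => _ [_ [_ []]]. Qed.

Let N0 : (0 < N)%N. Proof. exact: leq_ltn_trans (ltn_ord i). Qed.
Let NR : 0 < (N%:R : R). Proof. by rewrite ltr0n. Qed.
Let NV1 : (N%:R : R)^-1 <= 1. Proof. by rewrite invf_le1// ler1n. Qed.

Lemma urn_genS k : gen k `<=` gen k.+1.
Proof.
by move=> A [l [j [B [lk [mB ->]]]]]; exists l, j, B; split; [exact: leqW|].
Qed.

Lemma urn_genM k : gen k `<=` measurable.
Proof.
move=> A [l [j [B [lk [mB ->]]]]]; rewrite -[X in measurable X]setTI.
exact: Z_measurable.
Qed.

Lemma urn_adapted k j : badapted gen k (Z k j).
Proof.
split; last by exists 1 => w; have /andP[h0 h1] := Z01 k j w; rewrite ger0_norm.
move=> _ B mB; rewrite setTI; apply: sub_sigma_algebra.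
by exists k, j, B.
Qed.

Lemma avg_adapted k : badapted gen k (avg Z k).
Proof. by apply: bounded_rvZ; apply: bounded_rv_sum => j; exact: urn_adapted. Qed.

Definition urn_prob k j w : R := (1 - alpha) * Z k j w + alpha * avg Z k w.
Local Notation p := urn_prob.

Lemma urn_prob_adapted k j : badapted gen k (p k j).
Proof.
apply: bounded_rvD; apply: bounded_rvZ; [exact: urn_adapted|exact: avg_adapted].
Qed.

Let avg01 k w : 0 <= avg Z k w <= 1.
Proof.
apply/andP; split.
  by rewrite mulr_ge0 ?invr_ge0// sumr_ge0// => j _; have /andP[] := Z01 k j w.
rewrite /avg mulrC ler_pdivrMr// mul1r.
rewrite (@le_trans _ _ (\sum_(j < N) 1))//.
  by apply: ler_sum => j _; have /andP[] := Z01 k j w.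
by rewrite sumr_const card_ord.
Qed.

Let p01 k j w : 0 <= p k j w <= 1.
Proof.
have /andP[? ?] := Z01 k j w; have /andP[? ?] := avg01 k w; have /andP[? ?] := alpha01.
by rewrite /urn_prob; apply/andP; split; nra.
Qed.

Definition urn_draw k j w : R := (I k.+1 j w)%:R.
Local Notation Iv := urn_draw.

Let Iv_rv k j : bounded_rv (Iv k j).
Proof.
rewrite (_ : Iv k j = \1_[set w | I k.+1 j w]); first exact: bounded_rv_indic.
apply/funext => w; rewrite indicE /urn_draw; case: (boolP (w \in _)) => [/set_mem/= ->//|/negP wI].
by case: (boolP (I _ _ _)) => // h; exfalso; apply: wI; exact: mem_set.
Qed.

Let p_rv k j : bounded_rv (p k j).
Proof. exact: (badapted_rv urn_genM (urn_prob_adapted k j)). Qed.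

Let weight k (e : 'I_N -> bool) w : R :=
  \prod_(j < N) (if e j then p k j w else 1 - p k j w).

Let atom k (e : 'I_N -> bool) w : R := \prod_(j < N) (I k.+1 j w == e j)%:R.

Let weight_rv k e : bounded_rv (weight k e).
Proof.
apply: bounded_rv_prod => j; case: (e j) => //.
by apply: bounded_rvB => //; exact: bounded_rv_cst.
Qed.

Let atom_rv k e : bounded_rv (atom k e).
Proof.
apply: bounded_rv_prod => j.
rewrite (_ : (fun w => _) = fun w => if e j then Iv k j w else 1 - Iv k j w).
  by case: (e j) => //; apply: bounded_rvB => //; exact: bounded_rv_cst.
by apply/funext => w; rewrite /urn_draw; case: (I _ _ _); case: (e j); rewrite /= ?subrr ?subr0.
Qed.

Let atomE k e w : atom k e w = \1_[set w | forall j, I k.+1 j w = e j] w.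
Proof.
rewrite indicE /atom; case: (boolP (w \in _)) => [|wE].
  by move=> /set_mem/= wE; rewrite big1// => j _; rewrite wE eqxx.
have [j Ij] : exists j, I k.+1 j w != e j.
  apply: contrapT => h; move/negP: wE; apply; apply: mem_set => j.
  by apply/eqP; apply: contrapT => /negP Ij; apply: h; exists j.
by rewrite (bigD1 j)//= (negbTE Ij) mul0r.
Qed.

(** The model states this for indicators of events of [F_k]; [Ex_orth] extends it to bounded [U]. *)
Let atom_weight k U e : badapted gen k U ->
  Ex P (fun w => U w * (atom k e w - weight k e w)) = 0.
Proof.
move=> aU; have rU := badapted_rv urn_genM aU.
apply: Ex_orth => //; first exact: bounded_rvB.
move=> B mB; set A := U @^-1` B.
have FA : filtration Z k A by have [/(_ measurableT B mB)] := aU; rewrite setTI.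
have mA : measurable A by have [/(_ measurableT B mB)] := rU; rewrite setTI.
set E := [set w | forall j, I k.+1 j w = e j].
have mE : measurable E.
  rewrite (_ : E = atom k e @^-1` [set 1]).
    rewrite -[X in measurable X]setTI; have [m _] := atom_rv k e.
    exact: m.
  apply/seteqP; split => w /=; rewrite atomE indicE.
    by move=> wE; rewrite mem_set.
  case: (boolP (w \in _)) => [/set_mem//|_].
  by move=> /esym/eqP; rewrite oner_eq0.
have [_ [_ [_ [_ /(_ k A FA e)]]]] := model.
rewrite -/E -/(weight k e _) (Ex_indicM P mA (weight_rv k e)) => PE.
have -> : (fun w => \1_A w * (atom k e w - weight k e w)) =
    (fun w => \1_(A `&` E) w - \1_A w * weight k e w).
  by apply/funext => w; rewrite mulrBr atomE indicI.
rewrite ExB; last 2 first.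
- by apply: bounded_rv_indic; exact: measurableI.
- by apply: bounded_rvM => //; exact: bounded_rv_indic.
by rewrite Ex_indic; [rewrite PE subrr|exact: measurableI].
Qed.

(** Both products expand over the [2^N] outcomes [e], into the indicators [atom] and the
    probabilities [weight]. With [g j] equal to 1 for all but one or two [j] it gives conditional
    means and mixed moments of the draws. *)
Lemma urn_cond_prod k U (g : 'I_N -> bool -> R) : badapted gen k U ->
  Ex P (fun w => U w * \prod_(j < N) g j (I k.+1 j w)) =
  Ex P (fun w => U w * \prod_(j < N) (g j true * p k j w + g j false * (1 - p k j w))).
Proof.
move=> aU; have rU := badapted_rv urn_genM aU.
have E1 w : \prod_(j < N) g j (I k.+1 j w) =
    \sum_(e : {ffun 'I_N -> bool}) (\prod_(j < N) g j (e j)) * atom k e w.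
  rewrite [RHS](eq_bigr (fun e : {ffun 'I_N -> bool} =>
    \prod_(j < N) (g j (e j) * (I k.+1 j w == e j)%:R))); last first.
    by move=> e _; rewrite big_split.
  rewrite -(bigA_distr_bigA (fun j b => g j b * (I k.+1 j w == b)%:R)).
  apply: eq_bigr => j _; rewrite big_bool/=.
  by case: (I _ _ _); rewrite /= !(mulr0, mulr1, addr0, add0r).
have E2 w : \prod_(j < N) (g j true * p k j w + g j false * (1 - p k j w)) =
    \sum_(e : {ffun 'I_N -> bool}) (\prod_(j < N) g j (e j)) * weight k e w.
  rewrite [RHS](eq_bigr (fun e : {ffun 'I_N -> bool} =>
    \prod_(j < N) (g j (e j) * (if e j then p k j w else 1 - p k j w)))); last first.
    by move=> e _; rewrite big_split.
  rewrite -(bigA_distr_bigA (fun j b => g j b * (if b then p k j w else 1 - p k j w))).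
  by apply: eq_bigr => j _; rewrite big_bool.
apply/eqP; rewrite -subr_eq0 -ExB; last 2 first.
- apply: bounded_rvM => //; under [X in bounded_rv X]funext do rewrite E1.
  by apply: bounded_rv_sum => e; exact: bounded_rvZ.
- apply: bounded_rvM => //; under [X in bounded_rv X]funext do rewrite E2.
  by apply: bounded_rv_sum => e; exact: bounded_rvZ.
have -> : (fun w => U w * \prod_(j < N) g j (I k.+1 j w) - U w *
    \prod_(j < N) (g j true * p k j w + g j false * (1 - p k j w))) =
    (fun w => \sum_(e : {ffun 'I_N -> bool}) (\prod_(j < N) g j (e j)) *
       (U w * (atom k e w - weight k e w))).
  apply/funext => w; rewrite E1 E2 -mulrBr -sumrB mulr_sumr.
  by apply: eq_bigr => e _; ring.
have rUe e : bounded_rv (fun w => U w * (atom k e w - weight k e w)).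
  by apply: bounded_rvM => //; exact: bounded_rvB.
rewrite Ex_sum; last by move=> e; exact: bounded_rvZ.
by rewrite big1// => e _; rewrite (ExZ _ _ (rUe e)) atom_weight// mulr0.
Qed.

Let prod_at (F : 'I_N -> R) j : \prod_(j' < N) (if j' == j then F j' else 1) = F j.
Proof. by rewrite -big_mkcond/= big_pred1_eq. Qed.

Let prod_at2 (F : 'I_N -> R) j l : j != l ->
  \prod_(j' < N) (if (j' == j) || (j' == l) then F j' else 1) = F j * F l.
Proof.
move=> jl; rewrite (bigD1 j)//= eqxx (bigD1 l)/= ?(eq_sym l) ?jl// eqxx orbT.
by rewrite big1 ?mulr1// => j' /andP[/negbTE -> /negbTE ->].
Qed.

Let cond1 k U j : badapted gen k U ->
  Ex P (fun w => U w * Iv k j w) = Ex P (fun w => U w * p k j w).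
Proof.
move=> aU; have := urn_cond_prod (fun j' b => if j' == j then b%:R else 1) aU.
rewrite (_ : Ex P _ = Ex P (fun w => U w * Iv k j w)); last first.
  by apply: Ex_ext => w; rewrite (prod_at (fun j' => (I k.+1 j' w)%:R)).
move=> ->; apply: Ex_ext => w; congr (_ * _).
rewrite -[RHS](prod_at (fun j' => p k j' w)); apply: eq_bigr => j' _.
by case: ifP => _ /=; ring.
Qed.

Let cond2 k U j l : j != l -> badapted gen k U ->
  Ex P (fun w => U w * (Iv k j w * Iv k l w)) = Ex P (fun w => U w * (p k j w * p k l w)).
Proof.
move=> jl aU.
have := urn_cond_prod (fun j' b => if (j' == j) || (j' == l) then b%:R else 1) aU.
rewrite (_ : Ex P _ = Ex P (fun w => U w * (Iv k j w * Iv k l w))); last first.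
  by apply: Ex_ext => w; rewrite (prod_at2 (fun j' => (I k.+1 j' w)%:R)).
move=> ->; apply: Ex_ext => w; congr (_ * _).
rewrite -[RHS](prod_at2 (fun j' => p k j' w))//; apply: eq_bigr => j' _.
by case: ifP => _ /=; ring.
Qed.

Definition draw_noise k j w : R := Iv k j w - p k j w.
Local Notation noise := draw_noise.

Let noise_rv k j : bounded_rv (noise k j).
Proof. exact: bounded_rvB. Qed.

Lemma noise_mean k U j : badapted gen k U -> Ex P (fun w => U w * noise k j w) = 0.
Proof.
move=> aU; have rU := badapted_rv urn_genM aU.
under Ex_ext do rewrite mulrBr.
by rewrite ExB ?cond1 ?subrr//; exact: bounded_rvM.
Qed.

Lemma noise_cov k U j l : badapted gen k U ->
  Ex P (fun w => U w * (noise k j w * noise k l w)) =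
  if j == l then Ex P (fun w => U w * (p k j w * (1 - p k j w))) else 0.
Proof.
move=> aU; have rU := badapted_rv urn_genM aU.
have aUp j' : badapted gen k (fun w => U w * p k j' w).
  by apply: bounded_rvM => //; exact: urn_prob_adapted.
have rUp j' : bounded_rv (fun w => U w * p k j' w) by exact: bounded_rvM.
case: eqVneq => [<-|jl].
  transitivity (Ex P (fun w => (U w * Iv k j w - 2 * (U w * p k j w * Iv k j w)) +
      U w * p k j w * p k j w)).
    apply: Ex_ext => w; rewrite /draw_noise.
    have : Iv k j w ^+ 2 = Iv k j w by rewrite /urn_draw -natrX; case: (I _ _ _).
    by move: (Iv k j w) => x xx; rewrite -[X in _ = U w * X - _ + _]xx; ring.
  have r1 : bounded_rv (fun w => U w * Iv k j w) by exact: bounded_rvM.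
  have r2 : bounded_rv (fun w => U w * p k j w * Iv k j w) by exact: bounded_rvM.
  have r3 : bounded_rv (fun w => U w * p k j w * p k j w) by exact: bounded_rvM.
  have r2' := bounded_rvZ 2 r2.
  rewrite (ExD _ (bounded_rvB r1 r2') r3) (ExB _ r1 r2') (ExZ _ _ r2).
  rewrite cond1// cond1//.
  transitivity (Ex P (fun w => U w * p k j w) - Ex P (fun w => U w * p k j w * p k j w)).
    by ring.
  by rewrite -ExB//; apply: Ex_ext => w; ring.
transitivity (Ex P (fun w => (U w * (Iv k j w * Iv k l w) - U w * p k l w * noise k j w) -
   U w * p k j w * Iv k l w)).
  by apply: Ex_ext => w; rewrite /draw_noise; ring.
have r1 : bounded_rv (fun w => U w * (Iv k j w * Iv k l w)).
  by apply: bounded_rvM => //; exact: bounded_rvM.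
have r2 : bounded_rv (fun w => U w * p k l w * noise k j w) by exact: bounded_rvM.
have r3 : bounded_rv (fun w => U w * p k j w * Iv k l w) by exact: bounded_rvM.
rewrite (ExB _ (bounded_rvB r1 r2) r3) (ExB _ r1 r2) cond2// noise_mean// cond1//.
rewrite subr0; apply/eqP; rewrite subr_eq0; apply/eqP.
by apply: Ex_ext => w; rewrite mulrA.
Qed.

(** The deviation of urn [i] from the mean is the sum of [centering j * Z_n(j)] over [j]. The
    squares of these coefficients add up to [1 - 1/N], the factor in front of [V_t]. *)
Definition centering j : R := (j == i)%:R - N%:R^-1.
Local Notation kap := centering.

Let sum_kap (F : 'I_N -> R) : \sum_j kap j * F j = F i - N%:R^-1 * \sum_j F j.
Proof.
rewrite /centering; under eq_bigr do rewrite mulrBl.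
rewrite sumrB -mulr_sumr; congr (_ - _).
rewrite (bigD1 i)//= eqxx mul1r big1 ?addr0// => j /negbTE ->; exact: mul0r.
Qed.

Let kap2 : \sum_j kap j ^+ 2 = 1 - N%:R^-1.
Proof.
under eq_bigr do rewrite expr2.
rewrite sum_kap.
have -> : \sum_j kap j = 0.
  under eq_bigr do rewrite -[kap _]mulr1.
  by rewrite sum_kap sumr_const card_ord mulVf ?subrr// gt_eqF.
by rewrite mulr0 subr0 /centering eqxx.
Qed.

Definition urn_noise k w : R := \sum_j kap j * noise k j w.
Definition urn_var k w : R := \sum_j kap j ^+ 2 * (p k j w * (1 - p k j w)).
Definition urn_omega : R := (1 - N%:R^-1) * (q * (1 - q)).

Lemma urn_noise_bound k w : `|urn_noise k w| <= 2.
Proof.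
rewrite (le_trans (ler_norm_sum _ _ _))//.
rewrite (@le_trans _ _ (\sum_j ((j == i)%:R * 1 + N%:R^-1)))//; last first.
  rewrite big_split/= sumr_const card_ord -[X in _ + X]mulr_natl divff ?gt_eqF//.
  rewrite (bigD1 i)//= eqxx mul1r big1 ?addr0// => j /negbTE ->; exact: mul0r.
apply: ler_sum => j _; rewrite normrM mulr1 -[leRHS]mulr1 ler_pM//.
  by rewrite /centering (le_trans (ler_normB _ _))// lerD ?ger0_norm ?invr_ge0.
rewrite /draw_noise /urn_draw; have /andP[h0 h1] := p01 k j w.
by rewrite ler_norml; case: (I _ _ _) => /=; apply/andP; split; lra.
Qed.

Lemma urn_noise_mean k U : badapted gen k U -> Ex P (fun w => U w * urn_noise k w) = 0.
Proof.
move=> aU; have rU := badapted_rv urn_genM aU.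
have rn j : bounded_rv (fun w => U w * noise k j w) by exact: bounded_rvM.
transitivity (Ex P (fun w => \sum_j kap j * (U w * noise k j w))).
  by apply: Ex_ext => w; rewrite mulr_sumr; apply: eq_bigr => j _; ring.
rewrite Ex_sum => [|j]; last exact: bounded_rvZ.
by rewrite big1// => j _; rewrite (ExZ _ _ (rn j)) noise_mean// mulr0.
Qed.

(** Conditional independence of the draws removes the mixed terms of the square. *)
Lemma urn_noise_var k U : badapted gen k U ->
  Ex P (fun w => U w * urn_noise k w ^+ 2) = Ex P (fun w => U w * urn_var k w).
Proof.
move=> aU; have rU := badapted_rv urn_genM aU.
have rn j l : bounded_rv (fun w => U w * (noise k j w * noise k l w)).
  by apply: bounded_rvM => //; exact: bounded_rvM.
have rp j : bounded_rv (fun w => U w * (p k j w * (1 - p k j w))).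
  do 2 (apply: bounded_rvM => //).
  by apply: bounded_rvB => //; exact: bounded_rv_cst.
transitivity (Ex P (fun w => \sum_j \sum_l kap j * kap l * (U w * (noise k j w * noise k l w)))).
  apply: Ex_ext => w; rewrite expr2 /urn_noise mulr_suml mulr_sumr.
  apply: eq_bigr => j _; rewrite !mulr_sumr; apply: eq_bigr => l _; ring.
rewrite Ex_sum; last by move=> j; apply: bounded_rv_sum => l; exact: bounded_rvZ.
transitivity (\sum_j kap j ^+ 2 * Ex P (fun w => U w * (p k j w * (1 - p k j w)))).
  apply: eq_bigr => j _; rewrite Ex_sum => [|l]; last exact: bounded_rvZ.
  rewrite (bigD1 j)//= (ExZ _ _ (rn j j)) noise_cov// eqxx -expr2 big1 ?addr0//.
  move=> l lj; rewrite (ExZ _ _ (rn j l)) noise_cov//.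
  by rewrite eq_sym (negbTE lj) mulr0.
under eq_bigr do rewrite -(ExZ _ _ (rp _)).
rewrite -Ex_sum => [|j]; last exact: bounded_rvZ.
by apply: Ex_ext => w; rewrite mulr_sumr; apply: eq_bigr => j _; ring.
Qed.

Lemma urn_var_adapted k : badapted gen k (urn_var k).
Proof.
apply: bounded_rv_sum => j; apply: bounded_rvZ; apply: bounded_rvM.
  exact: urn_prob_adapted.
by apply: bounded_rvB; [exact: bounded_rv_cst|exact: urn_prob_adapted].
Qed.

Lemma urn_omega01 : 0 <= urn_omega <= 1.
Proof.
have /andP[? ?] := q01.
have h0 : 0 <= 1 - (N%:R^-1 : R) by rewrite subr_ge0.
have h1 : 1 - (N%:R^-1 : R) <= 1 by rewrite gerBl invr_ge0.
have h2 : 0 <= q * (1 - q) by nra.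
have h3 : q * (1 - q) <= 1 by nra.
by rewrite /urn_omega mulr_ge0//= mulr_ile1.
Qed.

Let spread k w : R := \sum_j `|Z k j w - q|.

Let avg_q k w : avg Z k w - q = N%:R^-1 * \sum_j (Z k j w - q).
Proof.
by rewrite sumrB sumr_const card_ord mulrBr -[q *+ N]mulr_natl mulKf// gt_eqF.
Qed.

Let p_spread k j w : `|p k j w - q| <= spread k w.
Proof.
have h1 : `|Z k j w - q| <= spread k w.
  by rewrite /spread (bigD1 j)//= lerDl sumr_ge0.
have h2 : `|avg Z k w - q| <= spread k w.
  rewrite avg_q normrM ger0_norm ?invr_ge0// -[leRHS]mul1r ler_pM ?invr_ge0//.
  exact: ler_norm_sum.
have /andP[a0 a1] := alpha01.
have -> : p k j w - q = (1 - alpha) * (Z k j w - q) + alpha * (avg Z k w - q).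
  by rewrite /urn_prob; ring.
rewrite (le_trans (ler_normD _ _))// !normrM (ger0_norm a0) ger0_norm ?subr_ge0//.
by nra.
Qed.

(** [x (1 - x) - q (1 - q)] is [x - q] times a cofactor of modulus at most 1. *)
Let var_spread k w : `|urn_var k w - urn_omega| <= spread k w.
Proof.
have s0 : 0 <= spread k w by apply: sumr_ge0.
rewrite /urn_omega -kap2 mulr_suml -sumrB.
rewrite (le_trans (ler_norm_sum _ _ _))//.
rewrite (@le_trans _ _ (\sum_j kap j ^+ 2 * spread k w))//.
  apply: ler_sum => j _; rewrite -mulrBr normrM ger0_norm ?sqr_ge0//.
  rewrite ler_wpM2l ?sqr_ge0// (le_trans _ (p_spread k j w))//.
  have -> : p k j w * (1 - p k j w) - q * (1 - q) = (p k j w - q) * (1 - p k j w - q) by ring.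
  rewrite normrM ler_piMr//.
  have /andP[? ?] := p01 k j w; have /andP[? ?] := q01.
  by rewrite ler_norml; apply/andP; split; lra.
by rewrite -mulr_suml kap2 ler_piMl// gerBl invr_ge0.
Qed.

Lemma urn_om_err_le k : om_err P urn_var urn_omega k <= 2.
Proof.
have rv : bounded_rv (fun w => `|urn_var k w - urn_omega|).
  apply: bounded_rv_norm; apply: bounded_rvB; last exact: bounded_rv_cst.
  exact: (badapted_rv urn_genM (urn_var_adapted k)).
rewrite -[leRHS](Ex_cst P); apply: le_Ex => //; first exact: bounded_rv_cst.
move=> w; have v0 : 0 <= urn_var k w.
  apply: sumr_ge0 => j _; have /andP[? ?] := p01 k j w.
  by rewrite mulr_ge0 ?sqr_ge0// mulr_ge0// subr_ge0.
have v1 : urn_var k w <= 1.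
  rewrite (@le_trans _ _ (\sum_j kap j ^+ 2 * 1))//.
    apply: ler_sum => j _; have /andP[? ?] := p01 k j w.
    by rewrite ler_wpM2l ?sqr_ge0//; nra.
  by rewrite -mulr_suml kap2 mulr1 gerBl invr_ge0.
have /andP[? ?] := urn_omega01.
by rewrite ler_norml; apply/andP; split; lra.
Qed.

Let msq k : R := \sum_j Ex P (fun w => (Z k j w - q) ^+ 2).

Let Zq_rv k j : bounded_rv (fun w => Z k j w - q).
Proof.
apply: bounded_rvB; last exact: bounded_rv_cst.
exact: (badapted_rv urn_genM (urn_adapted k j)).
Qed.

Let jensen2 (a b x y : R) : 0 <= a -> 0 <= b -> a + b <= 1 ->
  (a * x + b * y) ^+ 2 <= a * x ^+ 2 + b * y ^+ 2.
Proof.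
move=> a0 b0 ab1.
have h1 : 0 <= a * x ^+ 2 + b * y ^+ 2 by rewrite addr_ge0// mulr_ge0// sqr_ge0.
have h2 : 0 <= a * b * (x - y) ^+ 2 by rewrite mulr_ge0 ?sqr_ge0// mulr_ge0.
have h3 : (a + b) * (a * x ^+ 2 + b * y ^+ 2) <= a * x ^+ 2 + b * y ^+ 2.
  by rewrite ler_piMl.
apply: le_trans h3; rewrite -subr_ge0; apply: le_trans h2 _.
by rewrite le_eqVlt; apply/orP; left; apply/eqP; ring.
Qed.

(** Convexity, once for the mixture of [Z k j] with the mean and once for the mean itself: replacing
    values by their mean does not increase the sum of squares. *)
Let sum_p_sqr k w : \sum_j (p k j w - q) ^+ 2 <= \sum_j (Z k j w - q) ^+ 2.
Proof.
have /andP[a0 a1] := alpha01.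
pose y := avg Z k w - q.
have a1' : 0 <= 1 - alpha by rewrite subr_ge0.
rewrite (@le_trans _ _ (\sum_j ((1 - alpha) * (Z k j w - q) ^+ 2 + alpha * y ^+ 2)))//.
  apply: ler_sum => j _; rewrite (_ : p k j w - q = (1 - alpha) * (Z k j w - q) + alpha * y).
    by apply: jensen2 => //; rewrite subrK.
  by rewrite /urn_prob /y; ring.
rewrite big_split/= -mulr_sumr sumr_const card_ord.
set S := \sum_j _.
have h : y ^+ 2 *+ N <= S.
  have : 0 <= \sum_j ((Z k j w - q) - y) ^+ 2 by apply: sumr_ge0 => j _; exact: sqr_ge0.
  have -> : \sum_j ((Z k j w - q) - y) ^+ 2 =
      S - 2 * y * \sum_j (Z k j w - q) + y ^+ 2 *+ N.
    have -> : y ^+ 2 *+ N = \sum_(j < N) y ^+ 2 by rewrite sumr_const card_ord.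
    rewrite mulr_sumr -sumrB -big_split/=.
    by apply: eq_bigr => j _; ring.
  have -> : \sum_j (Z k j w - q) = N%:R * y by rewrite /y avg_q mulVKf// gt_eqF.
  rewrite -[y ^+ 2 *+ N]mulr_natl => h; rewrite -subr_ge0; apply: le_trans h _.
  by rewrite le_eqVlt; apply/orP; left; apply/eqP; ring.
rewrite -mulrnAr.
have : alpha * (y ^+ 2 *+ N) <= alpha * S by rewrite ler_wpM2l.
by move: (alpha * (_ *+ _)) => z; lra.
Qed.

(** The update pulls with strength [rho] towards the urns themselves and with strength [1 - rho]
    towards [q]; the latter yields the contraction, and the draw adds at most [r k ^+ 2] per urn.
    The last term is [N r_k^2] in the form that [stability] expects. *)
Let msq_rec k : msq k.+1 <= (1 - (1 - rho) * r k) * msq k +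
  (1 - rho) * r k * (N%:R / (1 - rho) * r k).
Proof.
have /andP[rho0 rho1] := rho01; have /andP[r0 r1] := r01 k.
have -> : (1 - rho) * r k * (N%:R / (1 - rho) * r k) = \sum_(j < N) r k ^+ 2.
  rewrite sumr_const card_ord -[RHS]mulr_natl; field.
  by rewrite gt_eqF// subr_gt0.
(* Predictable part: [Z k.+1 j - q] is [b j] plus [r k * rho] times the centred draw. *)
pose b j w := (1 - r k) * (Z k j w - q) + r k * rho * (p k j w - q).
have ab j : badapted gen k (b j).
  apply: bounded_rvD; apply: bounded_rvZ; apply: bounded_rvB; try exact: bounded_rv_cst.
    exact: urn_adapted.
  exact: urn_prob_adapted.
have rb j := badapted_rv urn_genM (ab j).
have one : badapted gen k (fun=> 1 : R) by exact: bounded_rv_cst.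
have step j : Ex P (fun w => (Z k.+1 j w - q) ^+ 2) <=
    Ex P (fun w => b j w ^+ 2) + r k ^+ 2.
  have rx : bounded_rv (fun w => b j w * noise k j w) by exact: bounded_rvM.
  have rx2 : bounded_rv (fun w => 1 * (noise k j w * noise k j w)).
    by apply: bounded_rvZ; exact: bounded_rvM.
  have rb2 := bounded_rvX 2 (rb j).
  have -> : Ex P (fun w => (Z k.+1 j w - q) ^+ 2) =
     Ex P (fun w => b j w ^+ 2 + (2 * (r k * rho)) * (b j w * noise k j w) +
       (r k * rho) ^+ 2 * (1 * (noise k j w * noise k j w))).
    by apply: Ex_ext => w; rewrite Z_rec /b /draw_noise /urn_draw; ring.
  rewrite (ExD _ (bounded_rvD rb2 (bounded_rvZ _ rx)) (bounded_rvZ _ rx2)).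
  rewrite (ExD _ rb2 (bounded_rvZ _ rx)) (ExZ _ _ rx) (ExZ _ _ rx2).
  rewrite noise_mean// mulr0 addr0 lerD2l noise_cov// eqxx.
  have : Ex P (fun w => 1 * (p k j w * (1 - p k j w))) <= 1.
    rewrite -[leRHS](Ex_cst P); apply: le_Ex.
    - apply: bounded_rvZ; apply: bounded_rvM => //.
      by apply: bounded_rvB => //; exact: bounded_rv_cst.
    - exact: bounded_rv_cst.
    by move=> w; have /andP[? ?] := p01 k j w; nra.
  have : 0 <= Ex P (fun w => 1 * (p k j w * (1 - p k j w))).
    by apply: Ex_ge0 => w; have /andP[? ?] := p01 k j w; nra.
  move=> e0 e1; rewrite -[leRHS]mulr1 ler_pM ?sqr_ge0//.
  by rewrite lerXn2r ?nnegrE ?mulr_ge0// ler_piMr// ltW.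
rewrite (le_trans (ler_sum _ (fun j _ => step j)))// big_split/= lerD2r.
rewrite -Ex_sum; last by move=> j; exact: bounded_rvX.
rewrite /msq -Ex_sum; last by move=> j; apply: bounded_rvX.
have rs : bounded_rv (fun w => \sum_j (Z k j w - q) ^+ 2).
  by apply: bounded_rv_sum => j; exact: bounded_rvX.
rewrite -(ExZ _ _ rs); apply: le_Ex.
- by apply: bounded_rv_sum => j; exact: bounded_rvX.
- exact: bounded_rvZ.
move=> w.
have rr0 : 0 <= r k * rho by rewrite mulr_ge0.
have r1' : 0 <= 1 - r k by rewrite subr_ge0 ltW.
rewrite (@le_trans _ _ (\sum_j ((1 - r k) * (Z k j w - q) ^+ 2 +
    r k * rho * (p k j w - q) ^+ 2)))//.
  apply: ler_sum => j _; apply: jensen2 => //.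
  by have := ler_piMr r0 (ltW rho1); lra.
rewrite big_split/= -!mulr_sumr.
have := ler_wpM2l rr0 (sum_p_sqr k w).
move: (\sum_j _) (\sum_j _) => x y h.
rewrite (_ : (1 - (1 - rho) * r k) * x = (1 - r k) * x + r k * rho * x); last by ring.
by rewrite lerD2l.
Qed.

Hypothesis r_cvg0 : r @ \oo --> (0 : R).
Variable r_low : R.
Hypothesis r_low0 : 0 < r_low.
Hypothesis r_ge : exists n1, forall n, (n1 <= n)%N -> r_low / n.+1%:R <= r n.

Let msq_cvg : msq @ \oo --> (0 : R).
Proof.
have /andP[rho0 rho1] := rho01; have [n1 Hn1] := r_ge.
have rho1' : 0 < 1 - rho by rewrite subr_gt0.
apply: (@stability _ msq (fun k => (1 - rho) * r k) (fun k => N%:R / (1 - rho) * r k)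
  n1 ((1 - rho) * r_low)) => //.
- by rewrite mulr_gt0.
- by move=> n; apply: sumr_ge0 => j _; apply: Ex_ge0 => w; exact: sqr_ge0.
- move=> n n1n; rewrite -mulrA ler_wpM2l ?Hn1 ?(ltW rho1')//=.
  have /andP[? /ltW ?] := r01 n.
  by rewrite mulr_ile1// ?(ltW rho1')// gerBl.
- have := cvg_seqM (cvg_seq_cst (N%:R / (1 - rho))) r_cvg0.
  by rewrite mulr0.
Qed.

Lemma urn_om_err_cvg : (fun k => om_err P urn_var urn_omega k) @ \oo --> (0 : R).
Proof.
apply/cvg_seqP => e e0.
(* [|x| <= eps + x^2 / eps] splits the mean into [N eps = e / 2] and [msq / eps], which is at most
   [e / 2] once [msq <= eps e / 2]. *)
pose eps := e / (2 * N%:R); have eps0 : 0 < eps by rewrite divr_gt0// mulr_gt0.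
have ee0 : 0 < eps * (e / 2) by rewrite mulr_gt0// divr_gt0.
have /cvg_seqP/(_ _ ee0)[n0 Hn0] := msq_cvg.
exists n0 => k n0k; rewrite subr0 ger0_norm; last by apply: Ex_ge0 => w.
have := Hn0 _ n0k; rewrite subr0 => /(le_trans (ler_norm _)) hm.
have rs : bounded_rv (fun w => \sum_j (Z k j w - q) ^+ 2).
  by apply: bounded_rv_sum => j; exact: bounded_rvX.
have rE : bounded_rv (fun w => \sum_(j < N) eps + eps^-1 * \sum_j (Z k j w - q) ^+ 2).
  by apply: bounded_rvD; [exact: bounded_rv_cst|exact: bounded_rvZ].
rewrite (@le_trans _ _ (Ex P (fun w => \sum_(j < N) eps + eps^-1 * \sum_j (Z k j w - q) ^+ 2)))//.
  apply: le_Ex => //.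
    apply: bounded_rv_norm; apply: bounded_rvB; last exact: bounded_rv_cst.
    exact: (badapted_rv urn_genM (urn_var_adapted k)).
  move=> w; rewrite (le_trans (var_spread k w))// mulr_sumr -big_split/=.
  apply: ler_sum => j _; rewrite -(ler_pM2l eps0) mulrDr mulVKf ?gt_eqF//.
  rewrite -(real_normK (num_real (Z k j w - q))).
  move: (`|_|) => x; have := sqr_ge0 (eps - x); have := sqr_ge0 (eps + x).
  by rewrite -subr_ge0; nra.
rewrite ExD; [|exact: bounded_rv_cst|exact: bounded_rvZ].
rewrite Ex_cst (ExZ _ _ rs) Ex_sum; last by move=> j; exact: bounded_rvX.
rewrite -/(msq k) sumr_const card_ord [leRHS](splitr e) lerD//.
  rewrite -mulr_natl le_eqVlt; apply/orP; left; apply/eqP; rewrite /eps.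
  by field; rewrite gt_eqF.
by rewrite ler_pdivrMl.
Qed.

Local Notation beta := (1 - rho * (1 - alpha)).

Lemma urn_beta01 : 0 < beta <= 1.
Proof.
have /andP[? ?] := rho01; have /andP[? ?] := alpha01.
have h : rho * (1 - alpha) <= rho by rewrite ler_piMr// gerBl.
have h' : 0 <= rho * (1 - alpha) by rewrite mulr_ge0// subr_ge0.
by apply/andP; split; lra.
Qed.

Definition urn_dev k w : R := Z k i w - avg Z k w.

(** The common mean in [urn_prob] and the constant [(1 - rho) q] cancel in a deviation from the
    mean. What remains of the reinforcement is [rho (1 - alpha)] times the deviation, hence
    [beta]. *)
Lemma urn_dev_rec k w : urn_dev k.+1 w =
  (1 - beta * r k) * urn_dev k w + r k * rho * urn_noise k w.
Proof.
rewrite /urn_noise sum_kap /draw_noise /urn_dev sumrB.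
have avgS : avg Z k.+1 w = (1 - r k) * avg Z k w +
    r k * (rho * (N%:R^-1 * \sum_j Iv k j w) + (1 - rho) * q).
  rewrite /avg; under eq_bigr do rewrite Z_rec.
  rewrite big_split/= -!mulr_sumr big_split/= -mulr_sumr sumr_const card_ord.
  rewrite -[_ *+ N]mulr_natl /urn_draw; field; rewrite gt_eqF//.
have avgp : N%:R^-1 * \sum_j p k j w = avg Z k w.
  rewrite /urn_prob big_split/= -mulr_sumr sumr_const card_ord.
  rewrite -[alpha * _ *+ N]mulr_natl mulrDr mulKf ?gt_eqF// mulrCA -/(avg Z k w); ring.
rewrite avgS Z_rec [N%:R^-1 * (_ - _)]mulrBr avgp /urn_prob /urn_draw; ring.
Qed.

Lemma urn_dev_bound k w : `|urn_dev k w| <= 1.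
Proof.
have /andP[? ?] := Z01 k i w; have /andP[? ?] := avg01 k w.
by rewrite ler_norml /urn_dev; apply/andP; split; lra.
Qed.

Lemma urn_dev_adapted k : badapted gen k (urn_dev k).
Proof. by apply: bounded_rvB; [exact: urn_adapted|exact: avg_adapted]. Qed.

Definition urn_incr k w : R :=
  urn_dev k.+1 w / decay r beta k.+1 - urn_dev k w / decay r beta k.
Definition urn_scale k : R := rho * (r k / decay r beta k.+1).

Let decay0 k : 0 < decay r beta k.
Proof. exact: decay_gt0 urn_beta01 r01 k. Qed.

Lemma urn_incrE k w : urn_incr k w = urn_scale k * urn_noise k w.
Proof.
have dk := decay0 k; have dk1 := decay0 k.+1.
have h : 1 - beta * r k != 0.
  by move: dk1; rewrite decayS => /lt0r_neq0; rewrite mulf_eq0 negb_or => /andP[].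
rewrite /urn_incr /urn_scale urn_dev_rec decayS.
move: h (lt0r_neq0 dk); move: (1 - _ * r k) (decay _ _ _) => x y x0 y0.
by field; rewrite x0 y0.
Qed.

Lemma urn_incr_adapted k : badapted gen k.+1 (urn_incr k).
Proof.
rewrite /urn_incr; apply: bounded_rvB; apply: bounded_rvM; try exact: bounded_rv_cst.
  exact: urn_dev_adapted.
exact: (badapted_le urn_genS (leqnSn k) (urn_dev_adapted k)).
Qed.

Lemma urn_scale_ge0 k : 0 <= urn_scale k.
Proof.
have /andP[? ?] := rho01; have /andP[? ?] := r01 k.
by rewrite mulr_ge0// divr_ge0// ltW.
Qed.

Lemma urn_incr_bound k w : `|urn_incr k w| <= 2 * urn_scale k.
Proof.
rewrite urn_incrE normrM ger0_norm ?urn_scale_ge0// mulrC.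
by rewrite ler_wpM2r ?urn_scale_ge0// urn_noise_bound.
Qed.

Let urn_noise_rv k : bounded_rv (urn_noise k).
Proof. by apply: bounded_rv_sum => j; exact: bounded_rvZ. Qed.

Lemma urn_incr_mean k U : badapted gen k U -> Ex P (fun w => U w * urn_incr k w) = 0.
Proof.
move=> aU; have rU := badapted_rv urn_genM aU.
have rn : bounded_rv (fun w => U w * urn_noise k w) by exact: bounded_rvM.
transitivity (Ex P (fun w => urn_scale k * (U w * urn_noise k w))).
  by apply: Ex_ext => w; rewrite urn_incrE mulrCA.
by rewrite (ExZ _ _ rn) urn_noise_mean// mulr0.
Qed.

Lemma urn_incr_var k U : badapted gen k U ->
  Ex P (fun w => U w * urn_incr k w ^+ 2) =
  Ex P (fun w => U w * (urn_scale k ^+ 2 * urn_var k w)).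
Proof.
move=> aU; have rU := badapted_rv urn_genM aU.
have rn : bounded_rv (fun w => U w * urn_noise k w ^+ 2).
  by apply: bounded_rvM => //; exact: bounded_rvX.
have rv : bounded_rv (fun w => U w * urn_var k w).
  by apply: bounded_rvM => //; exact: (badapted_rv urn_genM (urn_var_adapted k)).
transitivity (urn_scale k ^+ 2 * Ex P (fun w => U w * urn_noise k w ^+ 2)).
  rewrite -(ExZ _ _ rn); apply: Ex_ext => w; rewrite urn_incrE; ring.
rewrite urn_noise_var// -(ExZ _ _ rv); apply: Ex_ext => w; ring.
Qed.

Lemma urn_psum k w : psum urn_incr 0 k w = urn_dev k w / decay r beta k - urn_dev 0 w.
Proof.
rewrite /psum /urn_incr (telescope_sumr (fun k => urn_dev k w / decay r beta k))//.
by rewrite /decay big_ord0 divr1.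
Qed.

End UrnModel.

(** * Convergence of the rescaled deviations *)

Section Paths.
Context {R : realType}.
Implicit Types (x : R -> R) (s t : R).

(** Continuity on the half-line alone, in a form blind to negative times, where values are
    arbitrary. *)
Definition nonneg_continuous x : Prop := forall t e : R, 0 <= t -> 0 < e ->
  exists2 eta : R, 0 < eta & forall s : R, 0 <= s -> `|t - s| < eta ->
    `|x t - x s| <= e.

Lemma nonneg_continuous_right x t : nonneg_continuous x -> 0 <= t ->
  x @ at_right t --> x t.
Proof.
move=> cx t0; apply/cvgrPdist_le => e e0.
have [eta eta0 H] := cx t e t0 e0.
near=> s.
have ts : t < s by near: s; exact: nbhs_right_gt.
have st : s < t + eta by near: s; apply: nbhs_right_lt; rewrite ltrDl.
apply: H; first exact: le_trans t0 (ltW ts).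
by rewrite distrC gtr0_norm ?subr_gt0// ltrBlDl.
Unshelve. all: by end_near.
Qed.

Lemma nonneg_continuous_left x t : nonneg_continuous x -> 0 < t ->
  x @ at_left t --> x t.
Proof.
move=> cx t0; apply/cvgrPdist_le => e e0.
have [eta eta0 H] := cx t e (ltW t0) e0.
near=> s.
have ts : s < t by near: s; exact: nbhs_left_lt.
have s0 : 0 < s by near: s; exact: nbhs_left_gt.
have st : t - eta < s by near: s; apply: nbhs_left_gt; rewrite gtrBl.
apply: H; first exact: ltW.
by rewrite gtr0_norm ?subr_gt0// ltrBlDl -ltrBlDr.
Unshelve. all: by end_near.
Qed.

Lemma nonneg_continuous_cadlag x : nonneg_continuous x -> cadlag x.
Proof.
move=> cx; split => t t0; first exact: nonneg_continuous_right.
by apply/cvg_ex; exists (x t); exact: nonneg_continuous_left.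
Qed.

Lemma nonneg_continuous_ext x y : (forall t, 0 <= t -> x t = y t) ->
  nonneg_continuous y -> nonneg_continuous x.
Proof.
move=> xy cy t e t0 e0; have [eta eta0 H] := cy t e t0 e0.
by exists eta => // s s0 ts; rewrite !xy//; exact: H.
Qed.

Lemma nonneg_continuous_comp x (g : R -> R) : continuous g ->
  nonneg_continuous x -> nonneg_continuous (fun t => g (x t)).
Proof.
move=> cg cx t e t0 e0.
have /cvgrPdist_le/(_ _ e0)[e1 /= e10 He1] := cg (x t).
have e20 : 0 < e1 / 2 by rewrite divr_gt0.
have [eta eta0 H] := cx t _ t0 e20.
exists eta => // s s0 ts; apply: He1 => /=.
by rewrite (le_lt_trans (H _ s0 ts))// ltr_pdivrMr// ltr_pMr// ltr1n.
Qed.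

Section StepPath.
Variables (a b : R) (H : nat -> R).
Hypotheses (a0 : 0 <= a) (b0 : 0 <= b).

Let val_ge0 t : 0 <= t -> 0 <= a + b * t.
Proof. by move=> t0; rewrite addr_ge0// mulr_ge0. Qed.

Lemma step_path_right t : 0 <= t ->
  (fun s => H (Num.truncn (a + b * s))) @ at_right t --> H (Num.truncn (a + b * t)).
Proof.
move=> t0; apply/cvgrPdist_le => e e0.
have /andP[] := truncn_itv (val_ge0 t0).
move: (Num.truncn _) => k h1 h2.
(* The slope [n^gamma] is 0 for [n = 0]; the path then has no jumps. *)
have [b_eq0|b_neq0] := eqVneq b 0.
  apply: nearW => s; rewrite (@truncn_def _ _ k); first by rewrite subrr normr0 ltW.
  by move: h1 h2; rewrite b_eq0 !mul0r => -> ->.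
have bp : 0 < b by rewrite lt_neqAle eq_sym b_neq0.
have hb : t < (k.+1%:R - a) / b by rewrite ltr_pdivlMr// ltrBrDl (mulrC t).
near=> s.
have ts : t < s by near: s; exact: nbhs_right_gt.
have -> : Num.truncn (a + b * s) = k; last by rewrite subrr normr0 ltW.
apply: truncn_def; apply/andP; split.
  by rewrite (le_trans h1)// lerD2l ler_wpM2l// ltW.
by rewrite -ltrBrDl (mulrC b) -ltr_pdivlMr//; near: s; exact: nbhs_right_lt.
Unshelve. all: by end_near.
Qed.

Lemma step_path_left t : 0 < t ->
  exists l : R, (fun s => H (Num.truncn (a + b * s))) @ at_left t --> l.
Proof.
move=> t0; have [b_eq0|b_neq0] := eqVneq b 0.
  exists (H (Num.truncn a)); apply/cvgrPdist_le => e e0; apply: nearW => s.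
  by rewrite b_eq0 mul0r addr0 subrr normr0 ltW.
have bp : 0 < b by rewrite lt_neqAle eq_sym b_neq0.
have y0 : 0 < a + b * t by rewrite ltr_wpDl// mulr_gt0.
(* Approached from the left, an integer value [a + b t = k + 1] still belongs to the step [k], hence
   an interval closed on the right. *)
have [k /andP[k1 k2]] : exists k : nat, k%:R < a + b * t <= k.+1%:R.
  have /andP[h1 h2] := truncn_itv (ltW y0).
  have [E|Ne] := eqVneq (Num.truncn (a + b * t))%:R (a + b * t); last first.
    by exists (Num.truncn (a + b * t)); rewrite lt_neqAle Ne h1 ltW.
  move: E y0; case: (Num.truncn _) => [<-|k <- _]; first by rewrite ltxx.
  by exists k; rewrite lexx andbT ltr_nat.
have hb : (k%:R - a) / b < t by rewrite ltr_pdivrMr// ltrBlDl (mulrC t).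
exists (H k); apply/cvgrPdist_le => e e0.
near=> s.
have st : s < t by near: s; exact: nbhs_left_lt.
have -> : Num.truncn (a + b * s) = k; last by rewrite subrr normr0 ltW.
apply: truncn_def; apply/andP; split; last first.
  by rewrite (lt_le_trans _ k2)// ltrD2l ltr_pM2l.
rewrite ltW// -ltrBlDl (mulrC b) -ltr_pdivrMr//; near: s; exact: nbhs_left_gt.
Unshelve. all: by end_near.
Qed.

Lemma step_path_cadlag x : nonneg_continuous x ->
  cadlag (fun t => x t * H (Num.truncn (a + b * t))).
Proof.
move=> cx; split => t t0.
  by apply: cvgM; [exact: nonneg_continuous_right|exact: step_path_right].
have [l Hl] := step_path_left t0.
apply/cvg_ex; exists (x t * l).
by apply: cvgM => //; exact: nonneg_continuous_left.
Qed.

End StepPath.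

End Paths.

(** * The limit theorem for a general clock *)

Section UrnFunctionalCLT.
Context {R : realType} {d d' : measure_display}.
Context {Omega : measurableType d} {Omega' : measurableType d'}.
Variables (P : probability Omega R) (N : nat) (rho alpha q : R) (r : nat -> R).
Variables (Z : nat -> 'I_N -> Omega -> R) (I : nat -> 'I_N -> Omega -> bool).
Variable i : 'I_N.
Hypothesis rho01 : 0 <= rho < 1.
Hypothesis alpha01 : 0 <= alpha <= 1.
Hypothesis q01 : 0 < q < 1.
Hypothesis r01 : forall n, 0 <= r n < 1.
Hypothesis model : urn_model P r rho alpha q Z I.
Variables (P' : probability Omega' R) (W : R -> Omega' -> R).
Hypothesis bm : brownian_motion P' W.
Variables (gamma c delta : R) (Lam : R -> R).
Hypothesis gamma01 : 0 < gamma <= 1.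
Hypothesis c0 : 0 < c.
Local Notation pw := (pow_step gamma).
Local Notation m := (block_end gamma).
Local Notation beta := (1 - rho * (1 - alpha)).
Local Notation kappa := (2 * c * beta - delta).
Hypothesis r_cvg : (fun n => pw n * r n) @ \oo --> c.
Hypothesis kappa0 : 0 < kappa.
Hypothesis pw_ratio : (fun n => pw n * (pw n.+1 / pw n - 1)) @ \oo --> delta.
Hypothesis Lam_le : forall t : R, 0 <= t -> Lam t <= t.
Hypothesis Lam_lt : forall a b : R, 0 <= a -> a < b -> Lam a < Lam b.
Hypothesis Lam_lip : forall a b : R, 0 <= a -> a <= b -> Lam b - Lam a <= b - a.
Hypothesis block_weight : forall T e : R, 0 <= T -> 0 < e -> exists n0, forall n,
  (n0 <= n)%N -> forall t : R, 0 <= t -> t <= T ->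
  `|\sum_(n <= k < m n t) (pw k)^-1 - Lam t| <= e.
Hypothesis m_ratio : forall t : R, 0 <= t ->
  (fun n => pw n / pw (m n t)) @ \oo --> expR (- (delta * Lam t)).
Variables (pre : nat -> R) (A v : R -> R).
Hypothesis pre_ge0 : forall n, 0 <= pre n.
Hypothesis pre_sqr : forall n, pre n ^+ 2 = pw n.
Hypothesis AE : forall t : R, 0 <= t -> A t = expR (c * beta * Lam t).
Hypothesis vE : forall t : R, 0 <= t -> v t = rho ^+ 2 * (c ^+ 2 / kappa) * expR (kappa * Lam t).

Let beta01 : 0 < beta <= 1. Proof. exact: urn_beta01. Qed.
Let pw_ge0 := pow_step_ge0 gamma.
Let pw_gt0 := pow_step_gt0 gamma.
Let pw_le := pow_step_le gamma01.
Let pw_mono := pow_step_mono gamma01.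
Let pw_inf : (fun n => (pw n)^-1) @ \oo --> (0 : R).
Proof. by apply: pow_step_inf; have /andP[] := gamma01. Qed.
Let m_ge := block_end_ge gamma.
Let m_mono := block_end_mono gamma.

Local Notation a := (decay r beta).
Local Notation D := (urn_dev Z i).
Local Notation z := (urn_incr rho alpha r Z i).
Local Notation s := (urn_scale rho alpha r).
Local Notation omega := (urn_omega N q).

Let a_gt0 n : 0 < a n. Proof. exact: decay_gt0. Qed.

Let f n : R := pre n * a n.
Let f_ge0 n : 0 <= f n. Proof. by rewrite mulr_ge0// ltW. Qed.
Let f_sqr n : f n ^+ 2 = pw n * a n ^+ 2. Proof. by rewrite exprMn pre_sqr. Qed.

Let path n w t : R := pre n * A t * (Z (m n t) i w - avg Z (m n t) w).

Let f_cvg0 (e : R) : 0 < e -> exists n0, forall n, (n0 <= n)%N -> f n <= e.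
Proof.
move=> e0; have e20 : 0 < e ^+ 2 by exact: exprn_gt0.
have := scaled_decay_cvg0 pw_ge0 pw_gt0 pw_le pw_inf pw_ratio r_cvg kappa0.
move=> /cvg_seqP/(_ _ e20)[n0 Hn0]; exists n0 => n /Hn0.
rewrite subr0 -f_sqr ger0_norm ?sqr_ge0// => h.
by rewrite -(@ler_pXn2r _ 2)// nnegrE// ltW.
Qed.

Let var_cvg (t : R) : 0 <= t -> (fun n => \sum_(0 <= k < m n t) (f n * s k) ^+ 2) @ \oo --> v t.
Proof.
move=> t0; rewrite vE//.
have := cvg_seqM (cvg_seq_cst (rho ^+ 2)) (qsum_block_cvg pw_ge0 pw_gt0 pw_le pw_inf
  pw_ratio beta01 r01 c0 r_cvg kappa0 m_ge Lam_le block_weight m_ratio t0).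
apply: cvg_seq_eq => [n|]; last by rewrite -!mulrA.
rewrite -f_sqr /qsum !mulr_sumr; apply: eq_bigr => k _.
by rewrite /urn_scale; ring.
Qed.

Let max_cvg (T e : R) : 0 <= T -> 0 < e -> exists n0, forall n,
  (n0 <= n)%N -> forall k, (k < m n T)%N -> f n * s k <= e.
Proof.
move=> T0 e0; have e20 : 0 < e ^+ 2 by exact: exprn_gt0.
have [n0 Hn0] := max_block_cvg pw_ge0 pw_gt0 pw_le pw_mono pw_inf
  pw_ratio beta01 r01 c0 r_cvg kappa0 m_ge Lam_le block_weight T0 e20.
exists n0 => n n0n k km; have h := Hn0 _ n0n _ km.
have s0 : 0 <= s k by exact: urn_scale_ge0.
have fs0 := mulr_ge0 (f_ge0 n) s0.
rewrite -(@ler_pXn2r _ 2) ?nnegrE ?(ltW e0)//.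
rewrite (le_trans _ h)// exprMn f_sqr /urn_scale exprMn mulrCA ler_piMl//.
  by rewrite mulr_ge0 ?sqr_ge0// mulr_ge0// sqr_ge0.
by have /andP[? ?] := rho01; rewrite exprn_ile1// ltW.
Qed.

(** With [S] the martingale, the path is [f n (S + D_0)] times the ratio [rt], which tends to 1 by
    [decay_block_cvg]. The error [(rt - 1) f n S] is small only where [f n S] is bounded, hence the
    condition with [lam]; the contribution of [D_0] disappears with [f n]. *)
Let path_approx (T lam e : R) : 0 <= T -> 0 < lam -> 0 < e ->
  exists n0, forall n, (n0 <= n)%N -> forall w,
  (forall k, (k <= m n T)%N -> `|f n * psum z 0 k w| <= lam) ->
  forall t : R, 0 <= t -> t <= T -> `|path n w t - f n * psum z 0 (m n t) w| <= e.
Proof.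
move=> T0 lam0 e0.
have lam1 : 0 < lam + 1 by rewrite addr_gt0.
pose eta := e / (2 * (lam + 1)).
have eta0 : 0 < eta by rewrite divr_gt0// mulr_gt0.
pose e1 := Num.min 1 (e / 2).
have e10 : 0 < e1 by rewrite lt_min ltr01 divr_gt0.
have [n1 Hn1] := decay_block_cvg pw_ge0 pw_gt0 pw_inf beta01 r01 c0 r_cvg m_ge Lam_le
  block_weight T0 eta0.
have [n2 Hn2] := f_cvg0 e10.
exists (maxn n1 n2) => n; rewrite geq_max => /andP[n1n n2n] w Hlam t t0 tT.
have h1 := Hn1 _ n1n _ t0 tT; have := Hn2 _ n2n; rewrite le_min => /andP[f1 f2].
have hl := Hlam _ (m_mono n t0 tT).
have an := a_gt0 n; have am := a_gt0 (m n t).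
set S := psum z 0 _ w in hl *.
have DE : D (m n t) w = a (m n t) * (S + D 0 w).
  by rewrite /S urn_psum// subrK mulrC divfK// gt_eqF.
have D0 := urn_dev_bound i model 0 w.
set rt := expR _ * _ in h1.
have -> : path n w t - f n * S = (rt - 1) * (f n * S + f n * D 0 w) + f n * D 0 w.
  rewrite /path -/(D (m n t) w) DE AE// /rt /f.
  by field; rewrite gt_eqF.
have fD : `|f n * D 0 w| <= f n by rewrite normrM ger0_norm// ler_piMr.
rewrite (le_trans (ler_normD _ _))// [leRHS](splitr e) lerD ?(le_trans fD)//.
rewrite normrM (@le_trans _ _ (eta * (lam + 1)))//.
  rewrite ler_pM// (le_trans (ler_normD _ _))// lerD// (le_trans fD)//.
by rewrite le_eqVlt; apply/orP; left; apply/eqP; rewrite /eta; field; rewrite gt_eqF.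
Qed.

Let C : R := rho ^+ 2 * (c ^+ 2 / kappa).
Let C_ge0 : 0 <= C.
Proof. by rewrite mulr_ge0 ?sqr_ge0// divr_ge0 ?sqr_ge0// ltW. Qed.

Let v_modulus (T e : R) : 0 <= T -> 0 < e -> exists2 eta : R,
  0 < eta & forall a b : R, 0 <= a -> a <= b -> b <= T -> b - a <= eta ->
    v b - v a <= e.
Proof.
move=> T0 e0; pose B := C * expR (kappa * T) * kappa.
have B0 : 0 <= B.
  by rewrite mulr_ge0 ?(ltW kappa0)//; apply: mulr_ge0 => //; exact: expR_ge0.
have B1 : 0 < B + 1 by rewrite ltr_wpDl.
exists (e / (B + 1)); first exact: divr_gt0.
move=> x y x0 xy yT xye; have y0 := le_trans x0 xy.
rewrite !vE// -/C -mulrBr.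
have h : expR (kappa * Lam y) - expR (kappa * Lam x) <= expR (kappa * T) * (kappa * (y - x)).
  have -> : expR (kappa * Lam y) - expR (kappa * Lam x) =
      expR (kappa * Lam y) * (1 - expR (kappa * Lam x - kappa * Lam y)).
    by rewrite [RHS]mulrBr mulr1 -[in RHS]expRD subrKC.
  rewrite ler_pM ?expR_ge0//.
  - rewrite subr_ge0 -[leRHS]expR0 ler_expR subr_le0 ler_pM2l//.
    by move: xy; rewrite le_eqVlt => /predU1P[->//|xy]; rewrite ltW// Lam_lt.
  - by rewrite ler_expR ler_pM2l// (le_trans (Lam_le y0)).
  rewrite lerBlDr -lerBlDl (le_trans _ (expR_ge1Dx _))// lerD2l.
  by rewrite -[leRHS]opprB lerN2 -[leLHS]mulrBr ler_pM2l// Lam_lip.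
rewrite (le_trans (ler_wpM2l C_ge0 h))// (@le_trans _ _ (B * (y - x)))//.
  by rewrite le_eqVlt; apply/orP; left; apply/eqP; rewrite /B; ring.
rewrite (@le_trans _ _ ((B + 1) * (e / (B + 1))))//.
  by rewrite ler_pM ?subr_ge0// lerDl.
by rewrite mulrC divfK// gt_eqF.
Qed.

(** The variance vanishes identically for [N = 1] or [rho = 0]; otherwise it is a positive multiple
    of the exponential of a strictly increasing clock. *)
Let V_cases : (forall t : R, 0 <= t -> omega * v t = 0) \/
  (0 < omega * v 0 /\ forall x y : R, 0 <= x -> x < y -> omega * v x < omega * v y).
Proof.
have /andP[om0 _] := urn_omega01 i q01.
have [C_eq0|CN0] := eqVneq (omega * C) 0.
  by left => t t0; rewrite vE// -/C mulrA C_eq0 mul0r.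
have C0 : 0 < omega * C by rewrite lt_neqAle eq_sym CN0 mulr_ge0.
right; split; first by rewrite vE// -/C mulrA mulr_gt0// expR_gt0.
move=> x y x0 xy; have y0 := le_trans x0 (ltW xy).
by rewrite !vE// -/C [ltLHS]mulrA [ltRHS]mulrA ltr_pM2l// ltr_expR ltr_pM2l// Lam_lt.
Qed.

Let Lam_continuous : nonneg_continuous Lam.
Proof.
move=> t e t0 e0; exists e => // u u0 tu; rewrite (le_trans _ (ltW tu))//.
have h x y : 0 <= x -> x <= y -> `|Lam x - Lam y| <= `|x - y|.
  move=> x0 xy; rewrite distrC [leRHS]distrC ger0_norm; last first.
    by rewrite subr_ge0; move: xy; rewrite le_eqVlt => /predU1P[->//|xy]; rewrite ltW// Lam_lt.
  by rewrite ger0_norm ?subr_ge0//; exact: Lam_lip.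
by have [tu'|ut'] := leP t u; [exact: h|rewrite distrC [leRHS]distrC; apply: h => //; exact: ltW].
Qed.

Let expR_affine (x y : R) : continuous (fun t : R => x * expR (y * t)).
Proof.
move=> t; apply: cvgM; first exact: cvg_cst.
apply: continuous_cvg; first exact: continuous_expR.
by apply: cvgM; [exact: cvg_cst|exact: cvg_id].
Qed.

Let path_cadlag n w : cadlag (path n w).
Proof.
apply: (@step_path_cadlag _ n%:R (n%:R `^ gamma) (fun k => D k w) _ _ (fun t => pre n * A t)) => //.
apply: (nonneg_continuous_ext (y := fun t => pre n * expR (c * beta * Lam t))).
  by move=> t t0; rewrite AE.
exact: (nonneg_continuous_comp (g := fun t => pre n * expR (c * beta * t)) (@expR_affine _ _) Lam_continuous).
Qed.

Let limit_cadlag w : cadlag (fun t => W (omega * v t) w).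
Proof.
apply: nonneg_continuous_cadlag => t e t0 e0.
have /andP[om0 _] := urn_omega01 i q01.
have V0 u : 0 <= u -> 0 <= omega * v u.
  by move=> u0; rewrite vE// mulr_ge0// mulr_ge0// expR_ge0.
have cW : {within `[0, +oo[%classic, continuous (fun t => W t w)}.
  by case: bm => _ [_ []].
have [e1 e10 He1] := within_continuous_dist cW (V0 t t0) e0.
have cV : nonneg_continuous (fun t => omega * v t).
  apply: (nonneg_continuous_ext (y := fun t => omega * C * expR (kappa * Lam t))).
    by move=> u u0; rewrite vE// mulrA.
  exact: (nonneg_continuous_comp (g := fun t => omega * C * expR (kappa * t)) (@expR_affine _ _) Lam_continuous).
have e20 : 0 < e1 / 2 by rewrite divr_gt0.
have [eta eta0 H] := cV t _ t0 e20.
exists eta => // u u0 tu; apply: He1; first exact: V0.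
by rewrite (le_lt_trans (H _ u0 tu))// ltr_pdivrMr// ltr_pMr// ltr1n.
Qed.

(** Stopped at time [T], the path depends in a Lipschitz way on finitely many deviations; stopping
    changes it by at most [expR (- T)] in [ldist]. *)
Let path_measurable g : bounded_lip g -> forall n,
  measurable_fun setT (fun w => g (path n w)).
Proof.
move=> [_ [L L0 lg]] n; have /andP[b0 _] := beta01.
pose cut (T : nat) (x : nat -> R) (t : R) : R :=
  pre n * A (Num.min t T%:R) * x (m n (Num.min t T%:R)).
apply: (@measurable_fun_cvg _ _ _ _ (fun T w => g (cut T (D ^~ w)))) => [T|w _].
  pose B := pre n * expR (c * beta * T%:R).
  have B0 : 0 <= B by rewrite mulr_ge0// expR_ge0.
  apply: (@measurable_lip _ _ _ (m n T%:R).+1 (L * B) (fun x => g (cut T x)) (fun k w => D k w)); last first.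
    by move=> j _; have [] := badapted_rv (urn_genM model) (urn_dev_adapted i model j).
  split; first exact: mulr_ge0.
  move=> x y; rewrite (le_trans (lg _ _))// -mulrA ler_wpM2l//.
  apply: ldist_lip => [|t t0]; first by rewrite mulr_ge0// sumr_ge0.
  have u0 : 0 <= Num.min t T%:R by rewrite le_min t0/=.
  have uT : Num.min t T%:R <= T%:R by rewrite ge_min lexx orbT.
  rewrite /cut -mulrBr normrM ler_pM//.
    rewrite ger0_norm ?mulr_ge0 ?AE ?expR_ge0// ler_wpM2l// ler_expR.
    by rewrite ler_wpM2l ?mulr_ge0 ?(ltW c0) ?(ltW b0)// (le_trans (Lam_le u0)).
  have mT : (m n (Num.min t T%:R) < (m n T%:R).+1)%N by rewrite ltnS; exact: m_mono.
  by rewrite (bigD1 (Ordinal mT))//= lerDl sumr_ge0.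
apply/cvg_seqP => e e0; have [k Hk] := archimedean_bound ((L + 1) / e).
have L1 : 0 < L + 1 by rewrite ltr_wpDl.
have Le : 0 < (L + 1) / e by rewrite divr_gt0.
exists k => T kT.
have T0 : 0 < (T%:R : R).
  by rewrite (lt_le_trans Le)// (le_trans Hk)// ler_nat.
rewrite (le_trans (lg _ _))//.
have : ldist (cut T (D ^~ w)) (path n w) <= 0 + expR (- T%:R).
  apply: ldist_local => // t t0 tT.
  by rewrite /cut min_l// subrr normr0.
rewrite add0r => h.
rewrite (@le_trans _ _ ((L + 1) * T%:R^-1))//.
  by rewrite ler_pM ?ldist_ge0 ?lerDl// (le_trans h)// expRN_le_inv.
by rewrite ler_pdivrMr// mulrC -ler_pdivrMr// (le_trans Hk)// ler_nat.
Qed.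

Theorem urn_functional_clt : sk_conv_dist P P'
  (fun n w t => pre n * A t * (Z (m n t) i w - avg Z (m n t) w))
  (fun w t => W (omega * v t) w).
Proof.
have genS := @urn_genS _ _ _ _ Z.
have genM := urn_genM model.
have om01 := urn_omega01 i q01.
have c20 : 0 < c / 2 by rewrite divr_gt0.
have r0 := step_cvg0 pw_gt0 pw_inf r_cvg.
have rlow := step_ge pw_le r01 c0 r_cvg.
apply: sk_conv_dist_bounded_lip.
- exact: path_cadlag.
- exact: limit_cadlag.
- exact: path_measurable.
- move=> g bg; exact: (measurable_limit_path bm om01 m_mono var_cvg v_modulus bg).
move=> g bg.
apply: (functional_clt genS genM (urn_scale_ge0 rho01 alpha01 r01)
  (urn_incr_adapted i model) (urn_incr_bound i rho01 alpha01 r01 model)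
  (urn_incr_mean i rho01 alpha01 r01 model) bm om01
  (urn_var_adapted i model) (urn_incr_var i rho01 alpha01 r01 model)
  (urn_om_err_le i alpha01 q01 model)
  (urn_om_err_cvg i rho01 alpha01 q01 r01 model r0 c20 rlow)
  f_ge0 m_mono var_cvg max_cvg path_approx v_modulus V_cases bg).
exact: path_measurable.
Qed.

End UrnFunctionalCLT.

Theorem theorem2p9 (R : realType) (d : measure_display) (Omega : measurableType d)
  (P : probability Omega R) (N : nat) (rho alpha q gamma c : R)
  (r : nat -> R) (Z : nat -> 'I_N -> Omega -> R)
  (I : nat -> 'I_N -> Omega -> bool) (i : 'I_N)
  (d' : measure_display) (Omega' : measurableType d')
  (P' : probability Omega' R) (W : R -> Omega' -> R) :
  (1 <= N)%N ->
  0 <= rho < 1 -> 0 <= alpha <= 1 -> 0 < q < 1 ->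
  (forall n, 0 <= r n < 1) ->
  2^-1 < gamma <= 1 -> 0 < c ->
  (fun n : nat => n%:R `^ gamma * r n) @ \oo --> c ->
  urn_model P r rho alpha q Z I ->
  (* the law of (Z_0(1), ..., Z_0(N)) is permutation invariant *)
  (forall (s : {perm 'I_N}) (B : 'I_N -> set R), (forall j, measurable (B j)) ->
     P [set w | forall j, Z 0%N j w \in B j] =
     P [set w | forall j, Z 0%N (s j) w \in B j]) ->
  (forall j, (\int[P]_w (Z 0%N j w)%:E = (2^-1 : R)%:E)%E) ->
  (0 < \int[P]_w (avg Z 0 w * (1 - avg Z 0 w))%:E)%E ->
  brownian_motion P' W ->
  let beta := 1 - rho * (1 - alpha) in
  (* (i) *)
  (gamma < 1 ->
   sk_conv_dist P P'
     (fun n w t =>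
        let m := Num.truncn (n%:R + n%:R `^ gamma * t) in
        n%:R `^ (gamma / 2) * expR (c * beta * t) * (Z m i w - avg Z m w))
     (fun w t =>
        W ((1 - N%:R^-1) * (c * rho ^+ 2 * q * (1 - q) / (2 * beta))
             * expR (2 * c * beta * t)) w)) /\
  (* (ii) *)
  (gamma = 1 -> 1 < 2 * c * beta ->
   sk_conv_dist P P'
     (fun n w t =>
        let m := Num.truncn (n%:R + n%:R * t) in
        Num.sqrt n%:R * (1 + t) `^ (c * beta) * (Z m i w - avg Z m w))
     (fun w t =>
        W ((1 - N%:R^-1) * (c ^+ 2 * rho ^+ 2 * q * (1 - q) / (2 * c * beta - 1))
             * (1 + t) `^ (2 * c * beta - 1)) w)).
Proof.
move=> N1 rho01 alpha01 q01 r01 /andP[gamma_gt gamma_le] c0 r_cvg model _ _ _ bm beta.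
have gamma0 : 0 < gamma by rewrite (lt_trans _ gamma_gt)// invr_gt0.
have gamma01 : 0 < gamma <= 1 by rewrite gamma0.
have /andP[b0 b1] := urn_beta01 rho01 alpha01.
rewrite -/beta in b0 b1.
have gE : gamma / 2 + gamma / 2 = gamma by rewrite -splitr.
split=> [gamma_lt|gamma_eq cb1].
- have kappa0 : 0 < 2 * c * beta - 0 by rewrite subr0 !mulr_gt0.
  have g01 : 0 < gamma < 1 by rewrite gamma0.
  (* Over a stretch of length [n^gamma] the power [n^gamma] does not grow noticeably, so
     [delta = 0], and the clock is [t] itself. *)
  have := @urn_functional_clt _ _ _ _ _ P N rho alpha q r Z I i rho01 alpha01 q01 r01
    model P' W bm gamma c 0 id gamma01 c0 r_cvg kappa0 (pow_step_ratio_lt g01)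
    (fun t _ => lexx t) (fun a b _ ab => ab) (fun a b _ _ => lexx _)
    (block_weight_lt g01) _ (fun n => n%:R `^ (gamma / 2))
    (fun t => expR (c * beta * t))
    (fun t => rho ^+ 2 * (c ^+ 2 / (2 * c * beta - 0)) * expR ((2 * c * beta - 0) * t)).
  rewrite (_ : (fun w t => W (urn_omega N q * _) w) = fun w t =>
      W ((1 - N%:R^-1) * (c * rho ^+ 2 * q * (1 - q) / (2 * beta))
             * expR (2 * c * beta * t)) w); last first.
    apply/funext => w; apply/funext => t; congr (W _ w).
    rewrite /urn_omega subr0 [LHS]mulrA; congr (_ * expR _).
    by move: (N%:R^-1) => y; field; rewrite !gt_eqF.
  apply => //.
  + move=> t t0; rewrite mul0r oppr0 expR0; exact: block_end_ratio_lt.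
  + move=> n; rewrite expr2 /pow_step -powRD gE//.
    by rewrite (gt_eqF gamma0).
- subst gamma.
  have kappa0 : 0 < 2 * c * beta - 1 by rewrite subr_gt0.
  have l1 (t : R) : 0 <= t -> 0 < 1 + t by move=> t0; rewrite ltr_wpDr.
  (* Here [delta = 1] and the clock is [ln (1 + t)], whose exponentials are the powers of
     [1 + t]. *)
  have := @urn_functional_clt _ _ _ _ _ P N rho alpha q r Z I i rho01 alpha01 q01 r01
    model P' W bm 1 c 1 (fun t => ln (1 + t)) gamma01 c0 r_cvg kappa0 (@pow_step_ratio1 R)
    _ _ _ (@block_weight1 R) (@block_end_ratio1 R) (fun n => Num.sqrt n%:R)
    (fun t => (1 + t) `^ (c * beta))
    (fun t => rho ^+ 2 * (c ^+ 2 / (2 * c * beta - 1)) * (1 + t) `^ (2 * c * beta - 1)).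
  rewrite (_ : (fun w t => W (urn_omega N q * _) w) = fun w t =>
      W ((1 - N%:R^-1) * (c ^+ 2 * rho ^+ 2 * q * (1 - q) / (2 * c * beta - 1))
             * (1 + t) `^ (2 * c * beta - 1)) w); last first.
    apply/funext => w; apply/funext => t; congr (W _ w).
    rewrite /urn_omega [LHS]mulrA; congr (_ * _).
    by move: (N%:R^-1) => y; field; rewrite gt_eqF.
  have mE : block_end (1 : R) = (fun n t => Num.truncn (n%:R + n%:R * t)).
    by apply/funext => n; apply/funext => t; rewrite /block_end powRr1.
  rewrite mE.
  apply => //.
  + by move=> t t0; apply: le_ln1Dx; rewrite (lt_le_trans (ltrN10 R)).
  + by move=> a b a0 ab; rewrite ltr_ln ?posrE ?l1 ?ltrD2l// (le_trans a0)// ltW.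
  + move=> a b a0 ab; have b_ge0 := le_trans a0 ab.
    rewrite -ln_div ?posrE ?l1//.
    rewrite (_ : (1 + b) / (1 + a) = 1 + (b - a) / (1 + a)).
      have ba : 0 <= (b - a) / (1 + a) by rewrite divr_ge0 ?subr_ge0// ltW// l1.
      rewrite (le_trans (le_ln1Dx _))//; first exact: lt_le_trans (ltrN10 R) ba.
      by rewrite ler_pdivrMr ?l1// ler_peMr ?subr_ge0// lerDl.
    by field; rewrite gt_eqF// l1.
  + by move=> n; rewrite pow_step1 sqr_sqrtr.
  + by move=> t t0; rewrite /powR gt_eqF ?l1.
  + by move=> t t0; rewrite /powR gt_eqF ?l1.
Qed.
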